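(* Assume that $1<q<\alpha<p<\gamma<p^*$. Then $(1^o)$ $0<\lambda^e<\lambda^n<+\infty$; $(2^o)$ $0<\mu^{n,+}_\lambda<\mu^{e,+}_\lambda<\mu^{e,-}_\lambda<\mu^{n,-}_\lambda<+\infty$ for every $\lambda\in(0,\lambda^e)$.
   Context: Let $\Omega\subset\mathbb{R}^N$, $N\ge1$, be a smooth bounded domain; $p^*=\frac{pN}{N-p}$ if $p<N$ and $p^*=+\infty$ if $p\ge N$. All integrals are over $\Omega$; $W^{1,p}_0=W^{1,p}_0(\Omega)$ with norm $(\int|\nabla u|^p)^{1/p}$. Fibering derivatives: $F'(u)=\frac{d}{dt}F(tu)|_{t=1}$, $F''(u)=\frac{d^2}{dt^2}F(tu)|_{t=1}$. For $u\in W^{1,p}_0\setminus\{0\}$, $\lambda\in\mathbb{R}$: $\mathcal{R}^n_\lambda(u)=\dfrac{\int|\nabla u|^p+\lambda\int|u|^q-\int|u|^\gamma}{\int|u|^\alpha}$, $\quad\mathcal{R}^e_\lambda(u)=\dfrac{\frac1p\int|\nabla u|^p+\frac\lambda q\int|u|^q-\frac1\gamma\int|u|^\gamma}{\frac1\alpha\int|u|^\alpha}$. For $j\in\{e,n\}$, $\mu^{j,+}_\lambda=\inf\{\mathcal{R}^j_\lambda(u):u\in W^{1,p}_0\setminus\{0\},\ (\mathcal{R}^j_\lambda)'(u)=0,\ (\mathcal{R}^j_\lambda)''(u)>0\}$, $\mu^{j,-}_\lambda=\inf\{\mathcal{R}^j_\lambda(u):u\in W^{1,p}_0\setminus\{0\},\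 (\mathcal{R}^j_\lambda)'(u)=0,\ (\mathcal{R}^j_\lambda)''(u)<0\}$. $\lambda^n=c^n_{q,\gamma}\bar\lambda$ and $\lambda^e=c^e_{q,\gamma}\bar\lambda$, where $\bar\lambda=\inf_{u\in W^{1,p}_0\setminus\{0\}}\dfrac{(\int|\nabla u|^p)^{\frac{\gamma-q}{\gamma-p}}}{(\int|u|^q)(\int|u|^\gamma)^{\frac{p-q}{\gamma-p}}}$, $c^n_{q,\gamma}=\dfrac{(p-\alpha)^{\frac{\gamma-q}{\gamma-p}}(p-q)^{\frac{p-q}{\gamma-p}}(\gamma-p)}{(\alpha-q)(\gamma-\alpha)^{\frac{p-q}{\gamma-p}}(\gamma-q)^{\frac{\gamma-q}{\gamma-p}}}$, $\quad c^e_{q,\gamma}=\dfrac{q\,\gamma^{\frac{p-q}{\gamma-p}}}{p^{\frac{\gamma-q}{\gamma-p}}}\,c^n_{q,\gamma}$. Equivalently, $\lambda^n=\inf_u\sup_{t>0}\Lambda^n(tu)$ and $\lambda^e=\inf_u\sup_{t>0}\Lambda^e(tu)$ (infima over $u\in W^{1,p}_0\setminus\{0\}$) with $\Lambda^n(u)=\dfrac{(p-\alpha)\int|\nabla u|^p-(\gamma-\alpha)\int|u|^\gamma}{(\alpha-q)\int|u|^q}$, $\Lambda^e(u)=q\,\dfrac{\frac{p-\alpha}{p}\int|\nabla u|^p-\frac{\gamma-\alpha}{\gamma}\int|u|^\gamma}{(\alpha-q)\int|u|^q}$. *)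

(* Defs.v *)
From HB Require Import structures.
From mathcomp Require Import all_boot all_order all_algebra.
From mathcomp Require Import all_classical all_reals all_analysis.

Set Implicit Arguments.
Unset Strict Implicit.
Unset Printing Implicit Defensive.
Import Order.TTheory GRing.Theory Num.Theory.
Import numFieldNormedType.Exports.

Local Open Scope classical_set_scope.
Local Open Scope ring_scope.

(** * Lebesgue measure on [R^N]

    As for [n.-tuple T] in MathComp-Analysis, the sigma-algebra on row vectors
    is the one generated by the coordinates, i.e. the Borel one. *)

Section rV_measurable.
Context (R : realType) (n : nat).

Let coors : 'I_n -> 'rV[R]_n -> R := fun i x => x ord0 i.

Let rV_set0 : g_sigma_preimage coors set0.
Proof. exact: sigma_algebra0. Qed.

Let rV_setC A : g_sigma_preimage coors A -> g_sigma_preimage coors (~` A).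
Proof. exact: sigma_algebraC. Qed.

Let rV_bigcup (F : (set 'rV[R]_n)^nat) :
  (forall i, g_sigma_preimage coors (F i)) ->
  g_sigma_preimage coors (\bigcup_i (F i)).
Proof. exact: sigma_algebra_bigcup. Qed.

HB.instance Definition _ :=
  @isMeasurable.Build (measure_tuple_display default_measure_display)
    'rV[R]_n (g_sigma_preimage coors) rV_set0 rV_setC rV_bigcup.

End rV_measurable.

Lemma measurable_rV_coord (R : realType) n (i : 'I_n) :
  measurable_fun [set: 'rV[R]_n] (fun x : 'rV[R]_n => x ord0 i).
Proof.
move=> _ Y mY; rewrite setTI; apply: sub_sigma_algebra => /=.
rewrite -bigcup_seq/=; exists i => /=; first by rewrite mem_index_enum.
by exists Y => //; rewrite setTI.
Qed.

Lemma measurable_fun_rVP d (T : measurableType d) (R : realType) n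
    (f : T -> 'rV[R]_n) :
  measurable_fun [set: T] f <->
  forall i, measurable_fun [set: T] (fun x => f x ord0 i).
Proof.
apply: (@iff_trans _ (g_sigma_preimage
    (fun i => (fun x : 'rV[R]_n => x ord0 i) \o f) `<=` measurable)).
  rewrite g_sigma_preimage_comp; split=> [mf A [/= C preC <-]|prefS].
    exact: mf.
  by move=> _ A mA; apply: prefS; exists A.
split=> [fS i|mf].
- move=> _ A mA; apply: fS; apply: sub_sigma_algebra.
  rewrite -bigcup_seq/=; exists i => /=; first by rewrite mem_index_enum.
  by exists A.
- apply: smallest_sub; first exact: sigma_algebra_measurable.
  rewrite -bigcup_seq; apply: bigcup_sub => i _.
  by move=> A [B mB <-]; exact: mf.
Qed.

Section rV_cons.
Context (R : realType) (n : nat).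

Definition rV_cons (x : R * 'rV[R]_n) : 'rV[R]_n.+1 :=
  row_mx (x.1)%:M x.2.

Definition rV_uncons (x : 'rV[R]_n.+1) : R * 'rV[R]_n :=
  (x ord0 ord0, @rsubmx R 1 1 n x).

Lemma rV_consK : cancel rV_cons rV_uncons.
Proof.
move=> [a v]; rewrite /rV_uncons /rV_cons /= row_mxKr; congr pair.
by rewrite mxE; case: splitP => // j _; rewrite (ord1 j) mxE.
Qed.

Lemma measurable_rV_cons : measurable_fun setT rV_cons.
Proof.
apply/measurable_fun_rVP => i.
have [j ->|j ->] := @split_ordP 1 n i.
- rewrite (_ : (fun _ => _) = fst)//; apply/funext => x.
  by rewrite (row_mxEl (x.1)%:M x.2) (ord1 j) mxE.
- rewrite (_ : (fun _ => _) = (fun v : 'rV[R]_n => v ord0 j) \o snd).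
    by apply: measurableT_comp => //; exact: measurable_rV_coord.
  by apply/funext => x; exact: (row_mxEr (x.1)%:M x.2).
Qed.

Lemma measurable_rV_uncons : measurable_fun setT rV_uncons.
Proof.
apply/measurable_fun_pairP; split; first exact: measurable_rV_coord.
apply/measurable_fun_rVP => i.
rewrite (_ : (fun _ => _) = (fun x : 'rV[R]_n.+1 => x ord0 (rshift 1 i))).
  exact: measurable_rV_coord.
by apply/funext => x; rewrite mxE.
Qed.

Variable m : {sigma_finite_measure set 'rV[R]_n -> \bar R}.

Definition rV_cons_measure : set 'rV[R]_n.+1 -> \bar R :=
  pushforward (@lebesgue_measure R \x m)%E rV_cons.

Let rV_cons_measure0 : rV_cons_measure set0 = 0%E.
Proof. by rewrite /rV_cons_measure /pushforward preimage_set0 measure0. Qed.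

Let rV_cons_measure_ge0 A : (0 <= rV_cons_measure A)%E.
Proof. exact: (measure_ge0 (@lebesgue_measure R \x m)%E). Qed.

Let rV_cons_measure_sigma_additive : semi_sigma_additive rV_cons_measure.
Proof.
move=> F mF tF mUF; rewrite /rV_cons_measure /pushforward preimage_bigcup.
apply: measure_semi_sigma_additive.
- by move=> k; rewrite -[X in measurable X]setTI; exact: measurable_rV_cons.
- apply/trivIsetP => /= i j _ _ ij; rewrite -preimage_setI.
  by move/trivIsetP : tF => /(_ _ _ _ _ ij) ->//; rewrite preimage_set0.
- by rewrite -preimage_bigcup -[X in measurable X]setTI;
    exact: measurable_rV_cons.
Qed.

HB.instance Definition _ := isMeasure.Build _ _ _ rV_cons_measure
  rV_cons_measure0 rV_cons_measure_ge0 rV_cons_measure_sigma_additive.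

Let rV_cons_measure_sigma_finite : sigma_finite setT rV_cons_measure.
Proof.
have /sigma_finiteP[F [FT ndF Foo]] := sigma_finiteT (@lebesgue_measure R).
have /sigma_finiteP[G [GT ndG Goo]] := sigma_finiteT m.
exists (fun k => rV_uncons @^-1` (F k `*` G k)).
  rewrite -preimage_bigcup (_ : \bigcup_k _ = setT) ?preimage_setT//.
  rewrite -setXTT FT GT predeqE => -[x y]; split.
    by move=> [k _ []/= ? ?]; split; exists k.
  move=> [/= [k _ Fkx] [l _ Gly]]; exists (maxn k l) => //; split.
  - by move: x Fkx; exact/subsetPset/ndF/leq_maxl.
  - by move: y Gly; exact/subsetPset/ndG/leq_maxr.
move=> k; have [? ?] := Foo k; have [? ?] := Goo k; split.
  by rewrite -[X in measurable X]setTI; apply: measurable_rV_uncons => //;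
    exact: measurableX.
rewrite /rV_cons_measure /pushforward -comp_preimage.
rewrite (_ : rV_uncons \o rV_cons = id).
  by rewrite preimage_id product_measure1E// lte_mul_pinfty// ge0_fin_numE.
by apply/funext => x; exact: rV_consK.
Qed.

HB.instance Definition _ := Measure_isSigmaFinite.Build _ _ _ rV_cons_measure
  rV_cons_measure_sigma_finite.

End rV_cons.

Fixpoint lebesgue_rV (R : realType) (n : nat) :
    {sigma_finite_measure set 'rV[R]_n -> \bar R} :=
  match n with
  | 0 => \d_(0 : 'rV[R]_0)
  | k.+1 => rV_cons_measure (lebesgue_rV R k)
  end.

(** * Smooth functions and smooth bounded domains *)

Section smooth.
Context (R : realType) (N : nat).
Implicit Types (f phi : 'rV[R]_N -> R) (Om : set 'rV[R]_N).

(** The norm of the library on ['rV[R]_N] is the sup norm. *)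
Definition enorm (v : 'rV[R]_N) : R := Num.sqrt (\sum_(i < N) v ord0 i ^+ 2).

Definition partial (i : 'I_N) f : 'rV[R]_N -> R :=
  fun x => 'D_(delta_mx ord0 i) f x.

Definition gradient f (x : 'rV[R]_N) : 'rV[R]_N := \row_i partial i f x.

Definition smooth f : Prop := forall s : seq 'I_N,
  continuous (foldr partial f s) /\
  forall (i : 'I_N) x, derivable (foldr partial f s) x (delta_mx ord0 i).

(** [C_c^infty(Om)], functions being extended by zero outside [Om]. *)
Definition test_function Om : set ('rV[R]_N -> R) :=
  [set phi | [/\ smooth phi,
                 compact (closure [set x | phi x != 0]) &
                 closure [set x | phi x != 0] `<=` Om]].

(** Near each boundary point, [Om] is the set [rho < 0] for a smooth [rho] with
    nonvanishing gradient at that point. *)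
Definition smooth_boundary Om : Prop := forall x, (closure Om `\` interior Om) x ->
  exists rho : 'rV[R]_N -> R,
    [/\ smooth rho, gradient rho x != 0 & \forall y \near x, Om y <-> rho y < 0].

Definition smooth_bounded_domain Om : Prop :=
  [/\ open Om, connected Om, Om !=set0, bounded_set Om & smooth_boundary Om].

End smooth.

(** * Sobolev spaces

    A Sobolev function is represented by a pair [w = (u, g)] where [g] is (a
    representative of) the weak gradient of [u]. Only the values on [Om]
    matter. Pairs are added and scaled componentwise, in accordance with the
    linearity of the weak gradient. *)

Section sobolev.
Context (R : realType) (N : nat) (Om : set 'rV[R]_N).

Local Notation mu := (lebesgue_rV R N).

Definition sobolev_pair : lmodType R :=
  (('rV[R]_N -> R) * ('rV[R]_N -> 'rV[R]_N))%type.

Implicit Type w : sobolev_pair.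

Definition is_Lp (p : R) (f : 'rV[R]_N -> R) : Prop :=
  measurable_fun Om f /\ (\int[mu]_(x in Om) (`|f x| `^ p)%:E < +oo)%E.

Definition is_weak_gradient (u : 'rV[R]_N -> R) (g : 'rV[R]_N -> 'rV[R]_N) :
    Prop :=
  forall phi, test_function Om phi -> forall i : 'I_N,
    \int[mu]_(x in Om) (u x * partial i phi x) =
    - \int[mu]_(x in Om) (g x ord0 i * phi x).

Definition W1p (p : R) : set sobolev_pair :=
  [set w : sobolev_pair |
    [/\ is_Lp p w.1, forall i, is_Lp p (fun x => w.2 x ord0 i) &
        is_weak_gradient w.1 w.2]].

Definition W1p0 (p : R) : set sobolev_pair :=
  [set w : sobolev_pair | W1p p w /\ forall e : R, 0 < e ->
    exists2 phi, test_function Om phi &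
      (\int[mu]_(x in Om) (`|w.1 x - phi x| `^ p)%:E +
       \int[mu]_(x in Om) (enorm (w.2 x - gradient phi x) `^ p)%:E < e%:E)%E].

(** [W^{1,p}_0 \ {0}] *)
Definition W1p0_nz (p : R) : set sobolev_pair :=
  [set w : sobolev_pair | W1p0 p w /\ ~ {ae mu, forall x, Om x -> w.1 x = 0}].

Definition int_pow (r : R) w : R := \int[mu]_(x in Om) (`|w.1 x| `^ r).

Definition int_grad_pow (p : R) w : R :=
  \int[mu]_(x in Om) (enorm (w.2 x) `^ p).

End sobolev.

Definition sobolev_exponent (R : realType) (N : nat) (p : R) : \bar R :=
  if p < N%:R then (p * N%:R / (N%:R - p))%:E else +oo%E.

(** * Fibering derivatives and the generalized Rayleigh quotients *)

Section fibering.
Context (R : realType) (V : lmodType R).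
Implicit Types (F : V -> R) (S : set V).

Definition fiber_derive1 F (u : V) : R := derive1 (fun t : R => F (t *: u)) 1.

Definition fiber_derive2 F (u : V) : R := derive1n 2 (fun t : R => F (t *: u)) 1.

Definition inf_fiber_pos F S : \bar R :=
  ereal_inf [set (F u)%:E | u in
    [set u | [/\ S u, fiber_derive1 F u = 0 & 0 < fiber_derive2 F u]]].

Definition inf_fiber_neg F S : \bar R :=
  ereal_inf [set (F u)%:E | u in
    [set u | [/\ S u, fiber_derive1 F u = 0 & fiber_derive2 F u < 0]]].

End fibering.

Section rayleigh.
Context (R : realType) (N : nat) (Om : set 'rV[R]_N) (p q alpha gamma : R).

Local Notation G := (int_grad_pow Om p).
Local Notation I := (int_pow Om).

Definition rayleigh_n (lambda : R) (w : sobolev_pair R N) : R :=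
  (G w + lambda * I q w - I gamma w) / I alpha w.

Definition rayleigh_e (lambda : R) (w : sobolev_pair R N) : R :=
  (p^-1 * G w + lambda / q * I q w - gamma^-1 * I gamma w) /
  (alpha^-1 * I alpha w).

Definition mu_n_pos (lambda : R) : \bar R :=
  inf_fiber_pos (rayleigh_n lambda) (W1p0_nz Om p).
Definition mu_n_neg (lambda : R) : \bar R :=
  inf_fiber_neg (rayleigh_n lambda) (W1p0_nz Om p).
Definition mu_e_pos (lambda : R) : \bar R :=
  inf_fiber_pos (rayleigh_e lambda) (W1p0_nz Om p).
Definition mu_e_neg (lambda : R) : \bar R :=
  inf_fiber_neg (rayleigh_e lambda) (W1p0_nz Om p).

Definition lambda_bar : \bar R :=
  ereal_inf [set (G w `^ ((gamma - q) / (gamma - p)) /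
                  (I q w * I gamma w `^ ((p - q) / (gamma - p))))%:E
            | w in W1p0_nz Om p].

Definition c_n : R :=
  ((p - alpha) `^ ((gamma - q) / (gamma - p)) *
   (p - q) `^ ((p - q) / (gamma - p)) * (gamma - p)) /
  ((alpha - q) * (gamma - alpha) `^ ((p - q) / (gamma - p)) *
   (gamma - q) `^ ((gamma - q) / (gamma - p))).

Definition c_e : R :=
  q * gamma `^ ((p - q) / (gamma - p)) / p `^ ((gamma - q) / (gamma - p)) * c_n.

Definition lambda_n : \bar R := (c_n%:E * lambda_bar)%E.
Definition lambda_e : \bar R := (c_e%:E * lambda_bar)%E.

End rayleigh.

(* Main.v *)
From HB Require Import structures.
Require Import Defs.
From mathcomp Require Import all_boot all_order all_algebra.
From mathcomp Require Import all_classical all_reals all_analysis.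
From mathcomp Require Import measurable_realfun ring lra.
Set Implicit Arguments.
Unset Strict Implicit.
Unset Printing Implicit Defensive.
Import Order.TTheory GRing.Theory Num.Theory.
Import numFieldNormedType.Exports.
Local Open Scope classical_set_scope.
Local Open Scope ring_scope.

(** In the variable s = ln t, the fibre t |-> R^n(t u) is, up to an exponential
    factor in its derivative, governed by a function a - b e^{-(p-q)s} -
    c e^{(gamma-p)s}, which is concave; the same holds for R^e with other
    coefficients. Moreover d/ds R^e(e^s u) = alpha (R^n - R^e)(e^s u), so the two
    quotients coincide at the critical points of the e-fibre, and the sign of the
    second derivative of the e-fibre there is that of the slope of the n-fibre.

    The bound lambda < lambda^e gives more than the existence of two critical
    points on each e-fibre: they are nondegenerate uniformly in u. Taylor's formula
    then shows, without any compactness, that an e+ value dominates (1 + d) times an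
    n+ value taken further left on the same ray, and similarly for e- over e+ and
    n- over e-, with d > 0 independent of u. Since mu^{n,+} > 0 by Poincaré's
    inequality, these multiplicative gaps pass to the infima as strict inequalities.

    That 0 < lambda^e is the Sobolev inequality for exponents below p^*. It follows
    from the bound |y|^p ||grad u||_p^p on the p-th power of the L^p norm of
    u(. + y) - u: comparing u with its translates over a cube adapted to the level
    set {|u| ~ 2^j} improves an L^s bound to an L^{s'} bound for every
    s' < p + p s / N, and gamma is reached after finitely many steps. Finally
    lambda^e < lambda^n is the strict concavity of the logarithm. *)

(** * Translation invariance and boxes *)

(** The fibre functions are linear in the coefficients [a], [b], [c], so every bound is measured
    against one of them: [a], the gradient integral over the [alpha] integral. At a critical point
    of the e-fibre the derivative reads [x = y + z], with [x], [y], [z] fixed multiples of [a], [b],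
    [c]; hence [b] and [c] are at most a constant times [a], and the second derivative is
    [(p - q) x - (gam - q) z]. It vanishes only at the maximum of [x e^{(p-q)s} - z e^{(gam-q)s}],
    whose height is at least [kap * y] with [kap = lambda^e / lambda > 1]. This keeps the critical
    point off the maximum and the second derivative at least [eta * a] in absolute value. As the
    next derivative is also bounded by a multiple of [a], it keeps half of its size on a window in
    [s] whose width is the same for all [u]. The critical values involved are at most [(1 + K) * a],
    which turns an additive gain [d * a] on the window into the factor [1 + d / (1 + K)]. *)

Section lebesgue_shift.
Context (R : realType).

(** Lebesgue measure is determined by its values on half-open intervals, and those are unchanged by
    a shift. *)
Lemma lebesgue_measure_shift (c : R) (A : set R) : measurable A ->
  pushforward (@lebesgue_measure R) (fun x => x + c) A = lebesgue_measure A.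
Proof.
move=> mA.
have ms : measurable_fun setT (fun x : measurableTypeR R => x + c : measurableTypeR R).
  exact: (measurable_funD (@measurable_id _ R setT) (@measurable_cst _ _ _ R _ c)).
pose mm := isMeasurableFun.Build _ _ _ _ _ ms.
pose phi : {mfun _ >-> _} := HB.pack (fun x : measurableTypeR R => x + c : measurableTypeR R) mm.
have := @lebesgue_measure_unique R (pushforward (@lebesgue_measure R) phi) _ _ mA.
move=> <-//= _ [[a b]] _ <-.
rewrite /pushforward.
rewrite (_ : _ @^-1` _ = `]a - c, b - c]%classic).
  rewrite !lebesgue_measure_itv/= !lte_fin ltrD2r; case: ifPn => // _.
  by rewrite -!EFinB; congr EFin; ring.
by apply/seteqP; split=> x /=; rewrite !in_itv/= ltrBlDr lerBrDr.
Qed.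

Lemma integral_shift (c : R) (f : R -> \bar R) :
  measurable_fun setT f -> (forall x, 0 <= f x)%E ->
  (\int[lebesgue_measure]_x f (x + c)%R = \int[lebesgue_measure]_x f x)%E.
Proof.
move=> mf f0.
have ms : measurable_fun setT (fun x : measurableTypeR R => x + c : measurableTypeR R).
  exact: (measurable_funD (@measurable_id _ R setT) (@measurable_cst _ _ _ R _ c)).
have <- := @ge0_integral_pushforward _ _ (measurableTypeR R) (measurableTypeR R) R
  (fun x => x + c) ms (@lebesgue_measure R) setT f
  measurableT mf (fun x _ => f0 x).
apply: eq_measure_integral => A mA _; exact: lebesgue_measure_shift.
Qed.

End lebesgue_shift.

Section lebesgue_rV.
Context (R : realType).

Lemma measurable_rV_add n : measurable_fun setT
  (fun z : 'rV[R]_n * 'rV[R]_n => z.1 + z.2).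
Proof.
apply/measurable_fun_rVP => i.
under eq_fun do rewrite mxE.
apply: measurable_funD.
  by apply: (measurableT_comp (measurable_rV_coord i)); exact: measurable_fst.
by apply: (measurableT_comp (measurable_rV_coord i)); exact: measurable_snd.
Qed.

Lemma measurable_rV_shift n (y : 'rV[R]_n) : measurable_fun setT
  (fun x : 'rV[R]_n => x + y).
Proof.
apply/measurable_fun_rVP => i.
under eq_fun do rewrite mxE.
by apply: measurable_funD => //; exact: measurable_rV_coord.
Qed.

(** [lebesgue_rV] is built by recursion on the dimension; translation invariance and the volume of
    boxes follow by induction, splitting off the first coordinate with Tonelli. *)
Lemma integral_lebesgue_rVS n (f : 'rV[R]_n.+1 -> \bar R) :
  measurable_fun setT f -> (forall x, 0 <= f x)%E ->
  (\int[lebesgue_rV R n.+1]_x f x =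
   \int[lebesgue_measure]_a \int[lebesgue_rV R n]_v f (rV_cons (a, v)))%E.
Proof.
move=> mf f0.
transitivity (\int[pushforward (@lebesgue_measure R \x lebesgue_rV R n)%E
   (@rV_cons R n)]_x f x)%E.
  by apply: eq_measure_integral => //; exact: measurable_rV_cons.
rewrite ge0_integral_pushforward; [|exact: measurable_rV_cons|by []|by []|by []].
rewrite preimage_setT fubini_tonelli1; [by []| |by move=> x; exact: f0].
by apply: measurableT_comp => //; exact: measurable_rV_cons.
Qed.

Lemma rV_cons0 n (z : R * 'rV[R]_n) : rV_cons z ord0 ord0 = z.1.
Proof.
transitivity (((z.1)%:M : 'M[R]_(1, 1)) ord0 ord0); last by rewrite mxE mulr1n.
have := @row_mxEl R 1 1 n (z.1)%:M z.2 ord0 ord0 => <-.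
by congr (fun_of_matrix _ _ _); exact/val_inj.
Qed.

Lemma rV_consS n (z : R * 'rV[R]_n) i : rV_cons z ord0 (lift ord0 i) = z.2 ord0 i.
Proof.
have := @row_mxEr R 1 1 n (z.1)%:M z.2 ord0 i => <-.
by congr (fun_of_matrix _ _ _); exact/val_inj.
Qed.

Lemma rV_consD n (a : R) (v : 'rV[R]_n) (y : 'rV[R]_n.+1) :
  rV_cons (a, v) + y = rV_cons (a + (rV_uncons y).1, v + (rV_uncons y).2).
Proof.
apply/rowP => i; rewrite mxE.
have [j ->|->] := unliftP ord0 i; rewrite ?rV_cons0 ?rV_consS//= !mxE.
by congr (_ + y _ _); exact/val_inj.
Qed.

Lemma integral_rV_shift n (y : 'rV[R]_n) (f : 'rV[R]_n -> \bar R) :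
  measurable_fun setT f -> (forall x, 0 <= f x)%E ->
  (\int[lebesgue_rV R n]_x f (x + y)%R = \int[lebesgue_rV R n]_x f x)%E.
Proof.
elim: n y f => [|n IH] y f mf f0.
  by apply: eq_integral => x _; congr f; apply/rowP => -[].
rewrite !integral_lebesgue_rVS//; last first.
  by apply: measurableT_comp => //; exact: measurable_rV_shift.
have mF : measurable_fun setT (f \o @rV_cons R n).
  by apply: measurableT_comp => //; exact: measurable_rV_cons.
rewrite -[RHS](integral_shift (rV_uncons y).1); last 2 first.
- exact: (@measurable_fun_fubini_tonelli_F _ _ _ _ R (lebesgue_rV R n)
    (f \o @rV_cons R n) mF (fun x => f0 _)).
- by move=> a; apply: integral_ge0.
apply: eq_integral => a _.
rewrite -[RHS](IH (rV_uncons y).2)//; last first.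
  have mp : measurable_fun setT (fun v : 'rV[R]_n => (a + (rV_uncons y).1, v)).
    by apply: measurable_fun_pair => //.
  exact: (measurableT_comp mF mp).
by apply: eq_integral => v _; rewrite rV_consD.
Qed.

Definition rV_box n (a b : 'I_n -> R) : set 'rV[R]_n :=
  [set x | forall i, a i < x ord0 i <= b i].

Lemma measurable_rV_box n (a b : 'I_n -> R) : measurable (rV_box a b).
Proof.
rewrite (_ : rV_box a b = \bigcap_(i in setT)
  ((fun x : 'rV[R]_n => x ord0 i) @^-1` `]a i, b i])).
  apply: fin_bigcap_measurable; [exact: finite_finset|move=> i _].
  by rewrite -[X in measurable X]setTI; exact: measurable_rV_coord.
apply/seteqP; split=> x /= h i; first by move=> _ /=; rewrite in_itv/=; exact: h.
by have := h i I; rewrite /= in_itv.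
Qed.

Lemma lebesgue_rV_box n (a b : 'I_n -> R) : (forall i, a i <= b i) ->
  lebesgue_rV R n (rV_box a b) = (\prod_(i < n) (b i - a i))%:E.
Proof.
elim: n a b => [|n IH] a b ab.
  rewrite big_ord0 /= diracE (_ : _ \in _) //.
  by rewrite inE => -[].
have := @integral_indic _ _ R (lebesgue_rV R n.+1) setT measurableT _
  (measurable_rV_box a b).
rewrite setIT => <-.
rewrite integral_lebesgue_rVS//; last first.
  by apply/measurable_EFinP; apply: measurable_indic; exact: measurable_rV_box.
pose a' (i : 'I_n) := a (lift ord0 i); pose b' (i : 'I_n) := b (lift ord0 i).
have E x v : \1_(rV_box a b) (rV_cons (x, v)) =
    (\1_`]a ord0, b ord0]%classic x * \1_(rV_box a' b') v : R).
  rewrite !indicE -natrM mulnb; congr (nat_of_bool _)%:R.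
  apply/idP/andP; rewrite !inE.
    move=> h; split=> [|i].
      by have := h ord0; rewrite /= in_itv/= rV_cons0.
    by have := h (lift ord0 i); rewrite rV_consS.
  move=> [h1 h2] i; have [j ->|->] := unliftP ord0 i.
    by rewrite rV_consS; exact: h2.
  by rewrite rV_cons0; move: h1; rewrite /= in_itv.
have Ein x : (\int[lebesgue_rV R n]_v (\1_(rV_box a b) (rV_cons (x, v)))%:E =
    (\1_`]a ord0, b ord0]%classic x)%:E * (\prod_(i < n) (b' i - a' i))%:E)%E.
  under eq_integral => v _ do rewrite E EFinM.
  rewrite ge0_integralZl//; last first.
    by apply/measurable_EFinP; apply: measurable_indic; exact: measurable_rV_box.
  congr (_ * _)%E.
  have := @integral_indic _ _ R (lebesgue_rV R n) setT measurableT _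
    (measurable_rV_box a' b').
  by rewrite setIT => ->; apply: IH => i; exact: ab.
under eq_integral => x _ do rewrite Ein.
rewrite ge0_integralZr//; last 2 first.
- by apply/measurable_EFinP; apply: measurable_indic.
- by rewrite lee_fin; apply: prodr_ge0 => i _; rewrite subr_ge0; exact: ab.
rewrite big_ord_recl EFinM; congr (_ * _)%E.
have L : (@lebesgue_measure R `]a ord0, b ord0]%classic = (b ord0 - a ord0)%:E)%E.
  rewrite lebesgue_measure_itv/= lte_fin; case: ltP => // ba.
  by rewrite (_ : b ord0 = a ord0) ?subrr//; apply/eqP; rewrite eq_le ba ab.
have := @integral_indic _ _ R (@lebesgue_measure R) setT measurableT _
  (@measurable_itv R `]a ord0, b ord0]).
by rewrite setIT => h; apply: (etrans h); exact: L.
Qed.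

(* Rational boxes form a countable basis. *)
Lemma open_measurable_rV n (A : set 'rV[R]_n) : open A -> measurable A.
Proof.
move=> oA.
pose B (c : 'rV[rat]_n * nat) : set 'rV[R]_n :=
  rV_box (fun i => ratr (c.1 ord0 i) - c.2.+1%:R^-1)
         (fun i => ratr (c.1 ord0 i) + c.2.+1%:R^-1).
rewrite (_ : A = \bigcup_(c in [set c | B c `<=` A]) B c); last first.
  apply/seteqP; split=> [x Ax|x [c /= cA Bx]]; last exact: cA.
  have /nbhs_ballP[e /= e0 eA] : nbhs x A by exact: open_nbhs_nbhs.
  have [k ke] : exists k, k.+1%:R^-1 < e / 2.
    have [k _ /(_ _ (leqnn _))] := near_infty_natSinv_lt (PosNum (divr_gt0 e0 (@ltr0n R 2))).
    by exists k.
  have [d dE] : exists d : R, d = k.+1%:R^-1 by eexists.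
  have d0 : 0 < d by rewrite dE.
  have rx i : {r : rat | `|x ord0 i - ratr r| < d}.
    apply: cid; have [] := @rat_in_itvoo R (x ord0 i - d) (x ord0 i + d).
      by rewrite ltrBlDr -addrA ltrDl addr_gt0.
    move=> r; rewrite in_itv/= => /andP[h1 h2]; exists r.
    by rewrite ltr_norml; apply/andP; split; lra.
  exists (\row_i sval (rx i), k) => /=.
    move=> y By; apply: eA; rewrite -ball_normE /= /ball_.
    rewrite [ltLHS]/Num.norm/= mx_normrE; apply/bigmax_ltP; split=> // -[u i] _ /=.
    rewrite (ord1 u) !mxE.
    have := By i; rewrite /B/= !mxE -dE => /andP[h1 h2].
    have := svalP (rx i); rewrite ltr_norml => /andP[h3 h4].
    move: ke; rewrite -dE => ke.
    by rewrite ltr_norml; apply/andP; split; lra.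
  move=> i; rewrite /B/= !mxE -dE.
  have := svalP (rx i); rewrite ltr_norml => /andP[h3 h4].
  by apply/andP; split; lra.
rewrite bigcup_mkcond; apply: countable_bigcupT_measurable => // c.
by case: ifP => // _; exact: measurable_rV_box.
Qed.

Lemma continuous_measurable_rV n (f : 'rV[R]_n -> R) :
  continuous f -> measurable_fun setT f.
Proof.
move=> /continuousP cf; apply: (measurability _ (RGenOpens.measurableE R)) => //.
move=> _ [_ [a [b ->]] <-]; rewrite setTI; apply: open_measurable_rV.
by apply: cf; exact: interval_open.
Qed.

Lemma bounded_set_box n (A : set 'rV[R]_n) : bounded_set A ->
  exists2 M : R, 0 < M & forall x, A x -> forall i, `|x ord0 i| < M.
Proof.
move=> [M [Mr /(_ (`|M| + 1))]] h; exists (`|M| + 2) => [|x Ax i].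
  by rewrite ltr_wpDl.
have : `|x| <= `|M| + 1.
  by apply: h => //; rewrite (le_lt_trans (ler_norm M))// ltrDl.
move=> hx; apply: (@le_lt_trans _ _ (`|M| + 1)); last by rewrite ltrD2l ltr1n.
apply: le_trans hx; rewrite [leRHS]/Num.norm/= mx_normrE.
by apply/bigmax_geP; right; exists (ord0, i).
Qed.

Lemma bounded_set_lty n (A : set 'rV[R]_n) : measurable A -> bounded_set A ->
  (lebesgue_rV R n A < +oo)%E.
Proof.
move=> mA /bounded_set_box[M M0 AM].
apply: (@le_lt_trans _ _ (lebesgue_rV R n (rV_box (fun _ => - M) (fun _ => M)))).
  apply: le_measure; rewrite ?inE//; first exact: measurable_rV_box.
  by move=> x /AM Ax i; have := Ax i; rewrite ltr_norml => /andP[-> /ltW ->].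
by rewrite lebesgue_rV_box ?ltry// => i; lra.
Qed.

End lebesgue_rV.

(** * Elementary inequalities for real powers *)

Section powR_extra.
Context (R : realType).
Implicit Types (a b x p : R).

Lemma powR_homo p a b : 0 <= p -> 0 <= a -> a <= b -> a `^ p <= b `^ p.
Proof.
by move=> p0 a0 ab; apply: ge0_ler_powR; rewrite ?nnegrE// (le_trans a0).
Qed.

(** Midpoint convexity. The sharp constant matters: two equal terms give the factor [2 ^ p], exactly
    the price of a halved increment in [shift_int_test], where the inequality is iterated without
    end. *)
Lemma powR_mean p a b : 1 <= p -> 0 <= a -> 0 <= b ->
  (a + b) `^ p <= 2 `^ p / 2 * (a `^ p + b `^ p).
Proof.
move=> p1 a0 b0.
have h0 : (0 : R) <= 2^-1 by rewrite invr_ge0.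
have h1 : (2^-1 : R) <= 1 by rewrite invf_le1// ler1n.
have := @convex_powR R p p1 (Itv01 h0 h1) a b.
rewrite !inE /= !in_itv/= !andbT => /(_ a0 b0).
rewrite convRE [X in X `^ _ <= _ -> _]convRE /=.
rewrite (_ : unstable.onem 2^-1 = 2^-1); last by rewrite /unstable.onem; lra.
rewrite -!mulrDr => h.
rewrite (_ : a + b = 2 * (2^-1 * (a + b))); last by lra.
rewrite powRM ?mulr_ge0 ?addr_ge0// -mulrA ler_wpM2l ?powR_ge0//.
Qed.

Lemma powR_add_le p a b : 1 <= p -> 0 <= a -> 0 <= b ->
  (a + b) `^ p <= 2 `^ p * (a `^ p + b `^ p).
Proof.
move=> p1 a0 b0; apply: le_trans (powR_mean p1 a0 b0) _.
rewrite ler_wpM2r ?addr_ge0 ?powR_ge0// ler_pdivrMr// ler_peMr ?powR_ge0//.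
by rewrite ler1n.
Qed.

Lemma powR_add3_le p a b c : 1 <= p -> 0 <= a -> 0 <= b -> 0 <= c ->
  (a + b + c) `^ p <= 2 `^ p * 2 `^ p * (a `^ p + b `^ p + c `^ p).
Proof.
move=> p1 a0 b0 c0; apply: le_trans (powR_add_le p1 _ c0) _; first exact: addr_ge0.
rewrite -mulrA ler_wpM2l ?powR_ge0// mulrDr lerD//; first exact: powR_add_le.
rewrite ler_peMl ?powR_ge0//.
rewrite -{1}(@powRr0 R 2); apply: ler_powR; rewrite ?ler1n//.
exact: le_trans p1.
Qed.

Lemma continuous_normr_powR p : 0 < p -> continuous (fun x => `|x| `^ p).
Proof.
(* The power is differentiable on the open half-line only, so continuity at 0 is checked by hand. *)
move=> p0 x; have [->|x0] := eqVneq x 0.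
  apply/cvgrPdist_lt => e e0; near=> y.
  rewrite normr0 powR0 ?gt_eqF// sub0r normrN ger0_norm ?powR_ge0//.
  have -> : e = (e `^ p^-1) `^ p by rewrite -powRrM mulVf ?gt_eqF// powRr1 ?ltW.
  apply: gt0_ltr_powR; rewrite ?nnegrE ?powR_ge0//.
  near: y; exists (e `^ p^-1); first exact: powR_gt0.
  by move=> z /=; rewrite sub0r normrN.
have x1 : 0 < `|x| by rewrite normr_gt0.
have c1 : {for `|x|, continuous (fun z : R => z `^ p)}.
  apply: differentiable_continuous; apply/derivable1_diffP.
  by apply: derivable_powR; rewrite in_itv/= x1.
exact: (@continuous_comp R R R Num.norm (fun z => z `^ p) x
  (@norm_continuous R R x) c1).
Unshelve. all: by end_near. Qed.

End powR_extra.

(** * Translates of Sobolev functions *)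

Section test_functions.
Context (R : realType) (N : nat).
Implicit Types (f phi : 'rV[R]_N -> R) (Om : set 'rV[R]_N).
Local Notation e_ i := (delta_mx ord0 i : 'rV[R]_N).

Lemma smooth_continuous f : smooth f -> continuous f.
Proof. by move=> /(_ [::])[]. Qed.

Lemma smooth_derivable f : smooth f -> forall (i : 'I_N) x, derivable f x (e_ i).
Proof. by move=> sf i x; have [_] := sf [::]; apply. Qed.

Lemma smooth_partial f i : smooth f -> smooth (partial i f).
Proof. by move=> sf s; have := sf (rcons s i); rewrite foldr_rcons. Qed.

Lemma partial_eq0 f i x : ~ closure [set y | f y != 0] x -> partial i f x = 0.
Proof.
move=> fx; rewrite /partial.
rewrite (@near_eq_derive _ _ _ f (cst 0)) ?derive_cst//.
have : nbhs x (~` closure [set y | f y != 0]).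
  by apply: open_nbhs_nbhs; split => //; apply: closed_openC; exact: closed_closure.
apply: filterS => y /= fy; apply/eqP/negPn/negP => fy0; apply: fy.
exact: subset_closure.
Qed.

Lemma closure_support_partial f i :
  closure [set y | partial i f y != 0] `<=` closure [set y | f y != 0].
Proof.
rewrite [X in _ `<=` X](closure_id _).1; last exact: closed_closure.
apply: closure_subset => y /= /eqP fy; apply: contrapT => ny.
by apply: fy; exact: partial_eq0.
Qed.

Lemma test_function_partial Om f i :
  test_function Om f -> test_function Om (partial i f).
Proof.
move=> [sf cf fOm]; split; first exact: smooth_partial.
- apply: subclosed_compact cf _; first exact: closed_closure.
  exact: closure_support_partial.
- exact: subset_trans (@closure_support_partial f i) fOm.
Qed.

Lemma test_function_out Om f x : test_function Om f -> ~ Om x -> f x = 0.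
Proof.
move=> [_ _ fOm] Ox; apply/eqP/negPn/negP => fx; apply/Ox/fOm.
exact: subset_closure.
Qed.

Lemma test_function_bounded Om f : test_function Om f ->
  exists2 M : R, 0 <= M & forall x, `|f x| <= M.
Proof.
move=> [sf cf _].
have /compact_bounded [M [Mr /(_ (`|M| + 1))]] :
    compact (f @` closure [set y | f y != 0]).
  apply: continuous_compact => //; apply: continuous_subspaceT.
  exact: smooth_continuous.
rewrite (le_lt_trans (ler_norm M)) ?ltrDl// => /(_ isT) h.
exists (`|M| + 1) => [|x]; first by rewrite addr_ge0.
have [->|fx] := eqVneq (f x) 0; first by rewrite normr0 addr_ge0.
by apply: h; exists x => //; exact: subset_closure.
Qed.

Lemma test_function_box Om f : test_function Om f ->
  exists2 M : R, 0 < M & forall x, f x != 0 -> forall i, `|x ord0 i| < M.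
Proof.
move=> [_ cf _]; have [M M0 h] := bounded_set_box (compact_bounded cf).
by exists M => // x fx; apply: h; exact: subset_closure.
Qed.

Lemma is_derive_line f (i : 'I_N) x (t : R) : smooth f ->
  is_derive t 1 (fun s : R => f (x + s *: e_ i)) (partial i f (x + t *: e_ i)).
Proof.
move=> sf; have d := @smooth_derivable _ sf i (x + t *: e_ i).
have E : (fun h => h^-1 *: (((fun s : R => f (x + s *: e_ i)) \o shift t) (h *: 1)
      - f (x + t *: e_ i))) =
   (fun h => h^-1 *: ((f \o shift (x + t *: e_ i)) (h *: e_ i) - f (x + t *: e_ i))).
  apply/funext => h /=; congr (_ *: (f _ - _)).
  by rewrite scalerDl [h *: 1]mulr1 addrCA.
by split; [rewrite /derivable E | rewrite /partial /derive E].
Qed.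

Lemma le_line f i M h x : smooth f -> (forall y, `|partial i f y| <= M) ->
  0 <= h -> `|f (x + h *: e_ i) - f x| <= M * h.
Proof.
move=> sf fM h0.
have := @MVT_segment R (fun s : R => f (x + s *: e_ i))
  (fun s => partial i f (x + s *: e_ i)) 0 h h0 (fun s _ => is_derive_line i x s sf).
rewrite scale0r addr0 subr0 => /(_ _)[].
  apply: continuous_subspaceT => s.
  apply: differentiable_continuous; apply/derivable1_diffP.
  by have [] := is_derive_line i x s sf.
by move=> c _ ->; rewrite normrM (ger0_norm h0) ler_wpM2r.
Qed.

Lemma cvg_line f i x (h : nat -> R) : smooth f ->
  h n @[n --> \oo] --> 0 -> (forall n, h n != 0) ->
  (h n)^-1 * (f (x + h n *: e_ i) - f x) @[n --> \oo] --> partial i f x.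
Proof.
move=> sf h0 hn0.
have d : derivable f x (e_ i) := @smooth_derivable _ sf i x.
have hd : h n @[n --> \oo] --> 0^'.
  move=> A A0; have B : \forall n \near \oo, h n != 0 -> A (h n) by exact: (h0 _ A0).
  by near=> n; near: n; apply: filterS B => n; apply; exact: hn0.
have c := cvg_comp _ _ hd d.
suff -> : (fun n => (h n)^-1 * (f (x + h n *: e_ i) - f x)) =
  (fun h0 => h0^-1 *: ((f \o shift x) (h0 *: e_ i) - f x)) \o h by [].
by apply/funext => n /=; rewrite [_ *: _ + x]addrC.
Unshelve. all: by end_near. Qed.

End test_functions.

Section translation.
Context (R : realType) (N : nat).
Implicit Types (f g phi : 'rV[R]_N -> R) (Om : set 'rV[R]_N) (p : R).
Local Notation e_ i := (delta_mx ord0 i : 'rV[R]_N).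
Local Notation mu := (lebesgue_rV R N).

Lemma measurable_normr_powR d (T : measurableType d) (D : set T) (p : R)
    (f : T -> R) : measurable_fun D f ->
  measurable_fun D (fun x => (`|f x| `^ p)%:E).
Proof.
move=> mf; apply/measurable_EFinP.
apply: (measurableT_comp (measurable_powR p)).
exact: measurableT_comp.
Qed.

Lemma measurable_shift_diff f (y : 'rV[R]_N) : measurable_fun setT f ->
  measurable_fun setT (fun x : 'rV[R]_N => f (x + y) - f x).
Proof.
move=> mf; apply: measurable_funB => //.
by apply: measurableT_comp => //; exact: measurable_rV_shift.
Qed.

Definition shift_int p f (y : 'rV[R]_N) : \bar R :=
  (\int[mu]_x (`|f (x + y) - f x| `^ p)%:E)%E.

Lemma shift_int_ge0 p f y : (0 <= shift_int p f y)%E.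
Proof. by apply: integral_ge0 => x _; rewrite lee_fin powR_ge0. Qed.

Lemma shift_int0 p f : p != 0 -> shift_int p f 0 = 0%E.
Proof.
move=> p0; rewrite /shift_int integral0_eq// => x _.
by rewrite addr0 subrr normr0 powR0.
Qed.

Lemma integral_normr_shift p f (y : 'rV[R]_N) : measurable_fun setT f ->
  (\int[mu]_x (`|f (x + y)%R| `^ p)%:E = \int[mu]_x (`|f x| `^ p)%:E)%E.
Proof.
move=> mf; apply: (integral_rV_shift y (f := fun x => (`|f x| `^ p)%:E)).
  exact: measurable_normr_powR.
by move=> x; rewrite lee_fin powR_ge0.
Qed.

Lemma shift_intD p f y z : 1 <= p -> measurable_fun setT f ->
  (shift_int p f (y + z) <=
   (2 `^ p / 2)%:E * (shift_int p f y + shift_int p f z))%E.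
Proof.
move=> p1 mf; have p0 : 0 <= p by rewrite (le_trans _ p1).
have my := measurable_shift_diff y mf; have mz := measurable_shift_diff z mf.
have myz : measurable_fun setT (fun x : 'rV[R]_N => f (x + z + y) - f (x + z)).
  by apply: (measurableT_comp my (measurable_rV_shift z)).
have c0 : (0 <= (2 `^ p / 2 : R)) by rewrite divr_ge0 ?powR_ge0.
(* Translating the first integral by [z] makes the two increments share the intermediate point
   [x + z]. *)
rewrite /shift_int -[X in (X + _)%E](integral_rV_shift z); last 2 first.
- exact: measurable_normr_powR.
- by move=> x; rewrite lee_fin powR_ge0.
have mP := @measurable_normr_powR _ 'rV[R]_N setT p.
rewrite -ge0_integralD//; [|exact: mP|exact: mP].
rewrite -ge0_integralZl//;
  [|by apply: emeasurable_funD; exact: mP|by move=> x _; rewrite adde_ge0].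
apply: ge0_le_integral => //.
- by apply: mP; exact: measurable_shift_diff.
- by apply: measurable_funeM; apply: emeasurable_funD; exact: mP.
- move=> x _; rewrite -EFinD -EFinM lee_fin.
  apply: le_trans (powR_mean p1 _ _) => //.
  apply: powR_homo => //.
  rewrite -addrA [z + y]addrC addrA.
  by rewrite (_ : f _ - f x = (f (x + y + z) - f (x + z)) + (f (x + z) - f x));
    [exact: ler_normD|ring].
Qed.

(** Carries a bound from a test function [g] over to a Sobolev function [f]. The error [f - g]
    enters once at [x] and once at [x + y]; both occurrences have the same integral. *)
Lemma shift_int_close p f g y : 1 <= p ->
  measurable_fun setT f -> measurable_fun setT g ->
  (shift_int p f y <= (2 `^ p * 2 `^ p)%:E *
    (\int[mu]_x (`|f x - g x| `^ p)%:E + \int[mu]_x (`|f x - g x| `^ p)%:E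
     + shift_int p g y))%E.
Proof.
move=> p1 mf mg; have p0 : 0 <= p by rewrite (le_trans _ p1).
have mfg : measurable_fun setT (fun x : 'rV[R]_N => f x - g x) by exact: measurable_funB.
have mfgy : measurable_fun setT (fun x : 'rV[R]_N => f (x + y) - g (x + y)).
  exact: (measurableT_comp mfg (measurable_rV_shift y)).
have mgy := measurable_shift_diff y mg.
have P0 (h : 'rV[R]_N -> R) x : (0 <= (`|h x| `^ p)%:E)%E by rewrite lee_fin powR_ge0.
have mP := @measurable_normr_powR _ 'rV[R]_N setT p.
rewrite -[X in (X + _ + _)%E](integral_normr_shift p y mfg).
rewrite /shift_int -ge0_integralD//; [|exact: mP|exact: mP].
rewrite -ge0_integralD//;
  [|by move=> x _; rewrite adde_ge0|by apply: emeasurable_funD; apply: mP|exact: mP].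
rewrite -ge0_integralZl//; [
  |by apply: emeasurable_funD; [apply: emeasurable_funD|]; apply: mP
  |by move=> x _; rewrite !adde_ge0].
apply: ge0_le_integral => //.
- by apply: mP; exact: measurable_shift_diff.
- apply: measurable_funeM.
  by apply: emeasurable_funD; [apply: emeasurable_funD|]; apply: mP.
- move=> x _; rewrite -!EFinD -EFinM lee_fin.
  apply: le_trans (powR_add3_le p1 _ _ _) => //.
  apply: powR_homo => //.
  rewrite (_ : f _ - f x = (f (x + y) - g (x + y)) - (f x - g x) + (g (x + y) - g x)); last by ring.
  apply: le_trans (ler_normD _ _) _; rewrite lerD2r.
  by apply: le_trans (ler_normB _ _) _.
Qed.

Lemma integrable_cst_indic (c : R) (A : set 'rV[R]_N) : 0 <= c ->
  measurable A -> (mu A < +oo)%E -> mu.-integrable setT (fun x => (c * \1_A x)%:E).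
Proof.
move=> c0 mA Aoo; apply/integrableP; split.
  by apply/measurable_EFinP; apply: measurable_funM => //; exact: measurable_indic.
rewrite (eq_integral (fun x => c%:E * (\1_A x)%:E)%E); last first.
  by move=> x _; rewrite gee0_abs ?EFinM// lee_fin mulr_ge0// indicE ler0n.
rewrite ge0_integralZl//; last first.
  by apply/measurable_EFinP; exact: measurable_indic.
have := @integral_indic _ _ R mu setT measurableT _ mA; rewrite setIT => E.
rewrite (_ : integral _ _ _ = mu A); last exact: E.
by rewrite lte_mul_pinfty.
Qed.

(** Supplies the dominating function for difference quotients. The box is enlarged by [h0] because
    [x + h e_i] may lie in the support of [phi] when [x] does not. *)
Lemma quotient_bound Om phi (i : 'I_N) (h0 : R) : test_function Om phi -> 0 <= h0 ->
  exists (M : R) (A : set 'rV[R]_N), [/\ 0 <= M, measurable A, (mu A < +oo)%E &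
   forall (h : R) (x : 'rV[R]_N), 0 < h -> h <= h0 ->
     `|h^-1 * (phi (x + h *: e_ i) - phi x)| <= M * \1_A x].
Proof.
move=> tphi h00; have tdphi := test_function_partial i tphi.
have [M M0 dM] := test_function_bounded tdphi.
have [B B0 phiB] := test_function_box tphi.
have sphi : smooth phi by case: tphi.
exists M, (rV_box (fun _ => - (B + h0)) (fun _ => B + h0)); split => //.
- exact: measurable_rV_box.
- by rewrite lebesgue_rV_box ?ltry// => j; lra.
move=> h x hp hh0; rewrite indicE; case: (boolP (x \in _)) => [_|]; last first.
  rewrite notin_setE => xA /=.
  have out k : 0 <= k <= h0 -> phi (x + k *: e_ i) = 0.
    move=> /andP[k0 kh]; apply/eqP/negPn/negP => /phiB px; apply: xA => j.
    have := px j; rewrite !mxE eqxx/= ltr_norml => /andP[].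
    by case: (j == i) => /=; rewrite ?mulr1 ?mulr0 => a1 a2; apply/andP; split; lra.
  have -> : phi x = 0 by have := out 0; rewrite scale0r addr0; apply; rewrite lexx.
  by rewrite out ?subrr ?mulr0 ?normr0// (ltW hp) hh0.
rewrite /= mulr1 normrM gtr0_norm ?invr_gt0// ler_pdivrMl// mulrC.
by apply: le_line => //; exact: ltW.
Qed.

(** Halving the step [n] times costs [(2 ^ p) ^ n] by [shift_intD], which is what the factor
    [(h / 2 ^ n) ^ p] of the difference quotients gives back. Dominated convergence in [n] then
    yields the bound with constant 1, in place of Minkowski's inequality for integrals. *)
Lemma shift_int_test Om phi p (i : 'I_N) (h : R) :
  test_function Om phi -> 1 <= p -> 0 <= h ->
  (shift_int p phi (h *: e_ i) <=
   (h `^ p)%:E * \int[mu]_x (`|partial i phi x| `^ p)%:E)%E.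
Proof.
move=> tphi p1; rewrite le_eqVlt => /predU1P[<-|h0].
  rewrite scale0r shift_int0 ?gt_eqF ?(lt_le_trans _ p1)//.
  by rewrite mule_ge0 ?lee_fin ?powR_ge0// integral_ge0// => x _; rewrite lee_fin powR_ge0.
have p0 : 0 < p by rewrite (lt_le_trans _ p1).
have sphi : smooth phi by case: tphi.
have mphi := continuous_measurable_rV (smooth_continuous sphi).
have tdphi := test_function_partial i tphi.
have mdphi : measurable_fun setT (partial i phi).
  by apply: continuous_measurable_rV; apply: smooth_continuous; case: tdphi.
have [M [A [M0 mA Aoo MA]]] := quotient_bound i tphi (ltW h0).
pose hn n : R := h / 2 ^+ n.
have hn0 n : 0 < hn n by rewrite divr_gt0// exprn_gt0.
have hnh n : hn n <= h.
  rewrite ler_pdivrMr ?exprn_gt0// -[leLHS]mulr1 ler_wpM2l ?(ltW h0)//.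
  by apply: exprn_ege1; rewrite ler1n.
have hnc : hn n @[n --> \oo] --> 0.
  rewrite (_ : hn = geometric h 2^-1).
    by apply: cvg_geometric; rewrite ger0_norm ?invf_lt1 ?ltr1n.
  by apply/funext => n; rewrite /hn /= exprVn.
pose G n x := (hn n)^-1 * (phi (x + hn n *: e_ i) - phi x).
have mG n : measurable_fun setT (G n).
  by apply: measurable_funM => //; exact: measurable_shift_diff.
have halve n : (shift_int p phi (h *: e_ i) <=
    ((2 `^ p) ^+ n)%:E * shift_int p phi (hn n *: e_ i))%E.
  elim: n => [|n IH]; first by rewrite expr0 mul1e /hn expr0 divr1.
  apply: le_trans IH _; rewrite exprSr EFinM -muleA lee_wpmul2l ?lee_fin ?exprn_ge0 ?powR_ge0//.
  rewrite (_ : hn n *: e_ i = hn n.+1 *: e_ i + hn n.+1 *: e_ i); last first.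
    rewrite -scalerDl; congr (_ *: _); rewrite /hn exprS; field.
    by rewrite expf_neq0.
  apply: le_trans (shift_intD _ _ p1 mphi) _.
  rewrite ge0_muleDr ?shift_int_ge0// -ge0_muleDl ?lee_fin ?divr_ge0 ?powR_ge0//.
  by rewrite -EFinD -splitr.
have scale n : (((2 `^ p) ^+ n)%:E * shift_int p phi (hn n *: e_ i) =
    (h `^ p)%:E * \int[mu]_x (`|G n x| `^ p)%:E)%E.
  have mP := @measurable_normr_powR _ 'rV[R]_N setT p.
  rewrite /shift_int -!ge0_integralZl//; try exact: mP;
    try (by apply: mP; exact: measurable_shift_diff);
    try by rewrite lee_fin ?exprn_ge0 ?powR_ge0.
  apply: eq_integral => x _; rewrite -!EFinM; congr EFin.
  rewrite /G normrM powRM// mulrA; congr (_ * _).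
  rewrite gtr0_norm ?invr_gt0// -powRM ?invr_ge0 ?ltW//.
  rewrite /hn invf_div mulrCA divff ?gt_eqF// mulr1.
  by rewrite -[in RHS]powR_mulrn// -powRrM mulrC powRrM powR_mulrn ?powR_ge0.
have cG : (\int[mu]_x (`|G n x| `^ p)%:E @[n --> \oo] -->
           \int[mu]_x (`|partial i phi x| `^ p)%:E)%E.
  have [] := @dominated_convergence _ _ _ mu setT measurableT
    (fun n x => (`|G n x| `^ p)%:E) (fun x => (`|partial i phi x| `^ p)%:E)
    (fun x => (M `^ p * \1_A x)%:E).
  - by move=> n; exact: measurable_normr_powR.
  - exact: measurable_normr_powR.
  - apply: aeW => x _; apply: cvg_EFin; first exact: nearW.
    apply: (@cvg_comp _ _ _ (G ^~ x) (fun y => `|y| `^ p) _ (nbhs (partial i phi x))).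
      by apply: cvg_line => // n; rewrite gt_eqF.
    exact: continuous_normr_powR.
  - by apply: integrable_cst_indic => //; exact: powR_ge0.
  - apply: aeW => x n _ /=; rewrite lee_fin ger0_norm ?powR_ge0//.
    apply: le_trans (powR_homo (ltW p0) _ (MA _ _ (hn0 n) (hnh n))) _ => //.
    rewrite indicE; case: (x \in A); rewrite /= ?mulr1 ?mulr0//.
    by rewrite powR0 ?gt_eqF.
  - by [].
have c2 := cvgeZl (y := (h `^ p)%:E) isT cG.
by apply: (cvge_ge _ c2); apply: nearW => n; apply: le_trans (halve n) _; rewrite scale.
Qed.

End translation.

Lemma integral_powR_triangle d (T : measurableType d) (R : realType)
    (nu : {measure set T -> \bar R}) (D : set T) (p : R) (f g h : T -> R) :
  measurable D -> 1 <= p -> (forall x, 0 <= f x) -> (forall x, 0 <= g x) ->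
  (forall x, 0 <= h x <= f x + g x) ->
  measurable_fun D (fun x => (f x `^ p)%:E) ->
  measurable_fun D (fun x => (g x `^ p)%:E) ->
  measurable_fun D (fun x => (h x `^ p)%:E) ->
  (\int[nu]_(x in D) (h x `^ p)%:E <=
   (2 `^ p)%:E * (\int[nu]_(x in D) (f x `^ p)%:E + \int[nu]_(x in D) (g x `^ p)%:E))%E.
Proof.
move=> mD p1 f0 g0 hfg mf mg mh.
have P0 (k : T -> R) x : (0 <= (k x `^ p)%:E)%E by rewrite lee_fin powR_ge0.
rewrite -ge0_integralD// -ge0_integralZl//; last 2 first.
- exact: emeasurable_funD.
- by move=> x _; apply: adde_ge0; [exact: (P0 f)|exact: (P0 g)].
apply: ge0_le_integral => //.
- by apply: measurable_funeM; exact: emeasurable_funD.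
move=> x _; rewrite -EFinD -EFinM lee_fin.
apply: le_trans (powR_add_le p1 (f0 x) (g0 x)).
by have /andP[h0 hx] := hfg x; apply: powR_homo => //; rewrite (le_trans _ p1).
Qed.

(** * Extended-valued integrals of Sobolev functions *)

Section sobolev_estimates.
Context (R : realType) (N : nat).
Implicit Types (f g phi : 'rV[R]_N -> R) (Om : set 'rV[R]_N) (p : R)
  (w : sobolev_pair R N).
Local Notation mu := (lebesgue_rV R N).

(** [int_pow] is the [fine] of this integral and would read 0 if it were infinite; estimates are
    made on the extended value until finiteness is known. *)
Definition eint_pow Om p w : \bar R := (\int[mu]_(x in Om) (`|w.1 x| `^ p)%:E)%E.

Definition eint_grad Om p w : \bar R :=
  (\int[mu]_(x in Om) (enorm (w.2 x) `^ p)%:E)%E.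

Lemma eint_pow_ge0 Om p w : (0 <= eint_pow Om p w)%E.
Proof. by apply: integral_ge0 => x _; rewrite lee_fin powR_ge0. Qed.

Lemma eint_grad_ge0 Om p w : (0 <= eint_grad Om p w)%E.
Proof. by apply: integral_ge0 => x _; rewrite lee_fin powR_ge0. Qed.

Lemma enorm_ge0 (v : 'rV[R]_N) : 0 <= enorm v.
Proof. exact: sqrtr_ge0. Qed.

Lemma le_coord_enorm (v : 'rV[R]_N) i : `|v ord0 i| <= enorm v.
Proof.
rewrite -sqrtr_sqr; apply: ler_wsqrtr; rewrite (bigD1 i)//= lerDl.
by apply: sumr_ge0 => j _; exact: sqr_ge0.
Qed.

Lemma enormZ (t : R) (v : 'rV[R]_N) : enorm (t *: v) = `|t| * enorm v.
Proof.
rewrite /enorm -(sqrtr_sqr t) -sqrtrM ?sqr_ge0//; congr Num.sqrt.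
by rewrite mulr_sumr; apply: eq_bigr => i _; rewrite mxE exprMn.
Qed.

Lemma enorm_powR p (v : 'rV[R]_N) :
  enorm v `^ p = (\sum_(i < N) v ord0 i ^+ 2) `^ (2^-1 * p).
Proof.
rewrite powRrM powR12_sqrt//.
by apply: sumr_ge0 => j _; exact: sqr_ge0.
Qed.

Lemma measurable_enorm_powR (D : set 'rV[R]_N) p (G : 'rV[R]_N -> 'rV[R]_N) :
  (forall i, measurable_fun D (fun x => G x ord0 i)) ->
  measurable_fun D (fun x => (enorm (G x) `^ p)%:E).
Proof.
move=> mG; apply/measurable_EFinP; under eq_fun do rewrite enorm_powR.
apply: (measurableT_comp (measurable_powR (2^-1 * p))).
by apply: measurable_sum => i; apply: measurable_funX.
Qed.

(** Only the existence of a constant matters; it grows at each step of an induction over the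
    coordinates. The bound gives finiteness of the gradient integral from that of its components. *)
Lemma powR_sum_le p : 1 <= p -> exists2 c : R, 0 <= c &
  forall v : 'rV[R]_N, enorm v `^ p <= c * \sum_(i < N) `|v ord0 i| `^ p.
Proof.
move=> p1.
have [c c0 hc] : exists2 c : R, 0 <= c & forall v : 'I_N -> R,
    (\sum_(i <- index_enum 'I_N) `|v i|) `^ p <=
    c * \sum_(i <- index_enum 'I_N) `|v i| `^ p.
  elim: (index_enum _) => [|i s [c c0 IH]].
    by exists 0 => // v; rewrite !big_nil powR0 ?mulr0// gt_eqF// (lt_le_trans _ p1).
  exists (2 `^ p * (1 + c)); first by rewrite mulr_ge0 ?powR_ge0 ?addr_ge0.
  move=> v; rewrite !big_cons.
  apply: le_trans (powR_add_le p1 _ _) _ => //; first exact: sumr_ge0.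
  rewrite -mulrA ler_wpM2l ?powR_ge0//.
  have := IH v; set A := (_ `^ p); set B := \sum_(j <- s) _ => AB.
  have B0 : 0 <= B by apply: sumr_ge0 => j _; exact: powR_ge0.
  have v0 : 0 <= c * `|v i| `^ p by rewrite mulr_ge0 ?powR_ge0.
  by rewrite mulrDl mul1r mulrDr; lra.
exists c => // v; apply: le_trans (hc (v ord0)).
apply: powR_homo; rewrite ?enorm_ge0 ?(le_trans _ p1)//.
rewrite /enorm -[leRHS]ger0_norm ?sumr_ge0// -sqrtr_sqr; apply: ler_wsqrtr.
elim: (index_enum _) => [|i s IH]; first by rewrite !big_nil expr0n.
rewrite !big_cons sqrrD real_normK ?num_real// -addrA lerD2l.
apply: (le_trans IH); rewrite lerDr mulrn_wge0// mulr_ge0// sumr_ge0//.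
Qed.

Lemma eint_grad_lty Om p w : measurable Om -> 1 <= p -> W1p Om p w ->
  (eint_grad Om p w < +oo)%E.
Proof.
move=> mOm p1 [_ gLp _]; have [c c0 hc] := powR_sum_le p1.
apply: (@le_lt_trans _ _ (\int[mu]_(x in Om)
    (c%:E * \sum_(i < N) (`|w.2 x ord0 i| `^ p)%:E))%E).
  apply: ge0_le_integral => //.
  - by move=> x _; rewrite lee_fin powR_ge0.
  - by apply: measurable_enorm_powR => i; have [] := gLp i.
  - apply: measurable_funeM; apply: emeasurable_sum => i _.
    by apply: measurable_normr_powR; have [] := gLp i.
  - by move=> x _; rewrite sumEFin -EFinM lee_fin.
rewrite ge0_integralZl//; last 2 first.
- apply: emeasurable_sum => i _.
  by apply: measurable_normr_powR; have [] := gLp i.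
- by move=> x _; apply: sume_ge0 => i _; rewrite lee_fin powR_ge0.
rewrite ge0_integral_sum//; last first.
  by move=> i; apply: measurable_normr_powR; have [] := gLp i.
rewrite lte_mul_pinfty ?lee_fin//.
by apply: lte_sum_pinfty => i _; have [] := gLp i.
Qed.

Lemma zero_ext_in Om f x : Om x -> (f \_ Om) x = f x.
Proof. by move=> Ox; rewrite patchE mem_set. Qed.

Lemma zero_ext_out Om f x : ~ Om x -> (f \_ Om) x = 0.
Proof. by move=> Ox; rewrite patchE memNset. Qed.

Lemma integral_zero_ext Om p f : p != 0 ->
  (\int[mu]_(x in Om) (`|f x| `^ p)%:E = \int[mu]_x (`|(f \_ Om) x| `^ p)%:E)%E.
Proof.
move=> p0; rewrite integral_mkcond; apply: eq_integral => x _.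
have [Ox|Ox] := pselect (Om x).
  by rewrite zero_ext_in// patchE mem_set.
by rewrite zero_ext_out// patchE memNset// normr0 powR0.
Qed.

End sobolev_estimates.

Section sobolev_shift.
Context (R : realType) (N : nat) (Om : set 'rV[R]_N) (p : R).
Hypotheses (oOm : open Om) (p1 : 1 <= p).
Implicit Types (w : sobolev_pair R N).
Local Notation e_ i := (delta_mx ord0 i : 'rV[R]_N).
Local Notation mu := (lebesgue_rV R N).
Local Notation ext w := (w.1 \_ Om).

Let mOm : measurable Om := open_measurable_rV oOm.
Let p0 : 0 < p. Proof. by rewrite (lt_le_trans _ p1). Qed.

Lemma measurable_zero_ext w : W1p Om p w -> measurable_fun setT (ext w).
Proof. by move=> [[mw _] _ _]; exact: (measurable_restrictT _ mOm).1. Qed.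

Lemma W1p_shift_close w phi (i : 'I_N) (h : R) :
  W1p Om p w -> test_function Om phi -> 0 <= h ->
  (shift_int p (ext w) (h *: e_ i) <= (2 `^ p * 2 `^ p)%:E *
    (\int[mu]_(x in Om) (`|w.1 x - phi x| `^ p)%:E +
     \int[mu]_(x in Om) (`|w.1 x - phi x| `^ p)%:E +
     (h `^ p)%:E * ((2 `^ p)%:E * (eint_grad Om p w +
       \int[mu]_(x in Om) (enorm (w.2 x - gradient phi x) `^ p)%:E))))%E.
Proof.
move=> Ww tphi h0.
have mw := measurable_zero_ext Ww.
have sphi : smooth phi by case: tphi.
have mphi := continuous_measurable_rV (smooth_continuous sphi).
have mdphi j : measurable_fun setT (partial j phi).
  by apply: continuous_measurable_rV; apply: smooth_continuous; exact: smooth_partial.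
have pn0 : p != 0 by rewrite gt_eqF.
have E1 : (\int[mu]_x (`|ext w x - phi x| `^ p)%:E =
    \int[mu]_(x in Om) (`|w.1 x - phi x| `^ p)%:E)%E.
  rewrite [RHS](integral_zero_ext Om _ pn0); apply: eq_integral => x _.
  have [Ox|Ox] := pselect (Om x); first by rewrite !zero_ext_in.
  by rewrite !(zero_ext_out _ Ox) (test_function_out tphi Ox) subrr.
have E3 : (\int[mu]_x (`|partial i phi x| `^ p)%:E =
    \int[mu]_(x in Om) (`|partial i phi x| `^ p)%:E)%E.
  rewrite [RHS](integral_zero_ext Om _ pn0); apply: eq_integral => x _.
  have [Ox|Ox] := pselect (Om x); first by rewrite zero_ext_in.
  by rewrite (zero_ext_out _ Ox) (test_function_out (test_function_partial i tphi) Ox).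
rewrite -E1; apply: (le_trans (shift_int_close _ p1 mw mphi)).
apply: lee_wpmul2l; first by rewrite lee_fin mulr_ge0 ?powR_ge0.
apply: leeD2l; apply: (le_trans (shift_int_test i tphi p1 h0)).
apply: lee_wpmul2l; first by rewrite lee_fin powR_ge0.
rewrite E3; apply: (integral_powR_triangle mu mOm p1 (f := fun x => enorm (w.2 x))
    (g := fun x => enorm (w.2 x - gradient phi x)) (h := fun x => `|partial i phi x|)).
- by move=> x; exact: enorm_ge0.
- by move=> x; exact: enorm_ge0.
- move=> x; rewrite normr_ge0/=.
  rewrite (_ : partial i phi x =
    w.2 x ord0 i - (w.2 x - gradient phi x) ord0 i); last by rewrite !mxE; ring.
  exact: (le_trans (ler_normB _ _) (lerD (le_coord_enorm _ _) (le_coord_enorm _ _))).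
- by apply: measurable_enorm_powR => j; have [_ gLp _] := Ww; have [] := gLp j.
- apply: measurable_enorm_powR => j.
  under eq_fun do rewrite !mxE.
  apply: measurable_funB; first by have [_ gLp _] := Ww; have [] := gLp j.
  exact: measurable_funTS.
- by apply: measurable_normr_powR; exact: measurable_funTS.
Qed.

Let sum_lt (a b e : \bar R) : (0 <= a -> 0 <= b -> a + b < e -> a <= e /\ b <= e)%E.
Proof.
move=> a0 b0 /ltW abe; split; apply: le_trans abe; [exact: leeDl|exact: leeDr].
Qed.

(** The test-function bound passes to the closure: replacing [phi] by [w], both in the increment and
    in the gradient, costs only the approximation error. *)
Lemma W1p0_shift w (i : 'I_N) (h : R) : W1p0 Om p w -> 0 <= h ->
  (shift_int p (ext w) (h *: e_ i) <=
   (2 `^ p * 2 `^ p * 2 `^ p * h `^ p)%:E * eint_grad Om p w)%E.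
Proof.
move=> [Ww app] h0.
have Gfin : eint_grad Om p w \is a fin_num.
  by rewrite ge0_fin_numE ?eint_grad_ge0// eint_grad_lty.
apply/lee_addgt0Pr => e e0.
have : exists2 c : R, 0 < c & c = 2 `^ p by exists (2 `^ p) => //; rewrite powR_gt0.
move=> [c c0 cE].
(* [k] collects the coefficients of the approximation error, so that an error of [e / k] in each
   integral adds up to exactly [e]. *)
pose k := c * c * (2 + h `^ p * c).
have k0 : 0 < k by rewrite !mulr_gt0// ltr_wpDr// mulr_ge0 ?powR_ge0// ltW.
have ek0 : 0 < e / k by exact: divr_gt0.
have [phi tphi /sum_lt] := app _ ek0.
have I10 : (0 <= \int[mu]_(x in Om) (`|w.1 x - phi x| `^ p)%:E)%E.
  by apply: integral_ge0 => x _; rewrite lee_fin powR_ge0.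
have I20 : (0 <= \int[mu]_(x in Om) (enorm (w.2 x - gradient phi x) `^ p)%:E)%E.
  by apply: integral_ge0 => x _; rewrite lee_fin powR_ge0.
move=> /(_ I10 I20)[I1e I2e].
apply: (le_trans (W1p_shift_close i Ww tphi h0)); rewrite -cE.
apply: (@le_trans _ _ ((c * c)%:E * ((e / k)%:E + (e / k)%:E + (h `^ p)%:E *
    (c%:E * (eint_grad Om p w + (e / k)%:E))))%E).
  apply: lee_wpmul2l; first by rewrite lee_fin mulr_ge0 ?ltW.
  apply: (leeD (leeD I1e I1e)).
  apply: lee_wpmul2l; first by rewrite lee_fin powR_ge0.
  apply: lee_wpmul2l; first by rewrite lee_fin ltW.
  exact: leeD2l.
rewrite -(fineK Gfin); move: (fine _) => G.
rewrite -!(EFinM, EFinD) lee_fin.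
have kE : c * c * (2 + h `^ p * c) * (e / k) = e by rewrite -/k mulrCA divff ?mulr1 ?gt_eqF.
rewrite -[X in _ <= _ + X]kE [leRHS](_ : _ = c * c * (e / k + e / k + h `^ p *
  (c * (G + e / k))))//; ring.
Qed.

End sobolev_shift.

(** * Poincaré and Sobolev inequalities *)

Section poincare.
Context (R : realType) (N : nat) (Om : set 'rV[R]_N) (p : R).
Hypotheses (oOm : open Om) (bOm : bounded_set Om) (p1 : 1 <= p) (N0 : (0 < N)%N).
Implicit Types (w : sobolev_pair R N).
Local Notation e_ i := (delta_mx ord0 i : 'rV[R]_N).
Local Notation ext w := (w.1 \_ Om).

Let p0 : 0 < p. Proof. by rewrite (lt_le_trans _ p1). Qed.

(* Shifting by more than the diameter of [Om] separates the supports of [u] and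
   of its translate, so that the shift integral dominates [int |u|^p]. *)
Lemma W1p0_poincare : exists2 C : R, 0 <= C & forall w, W1p0 Om p w ->
  (eint_pow Om p w <= C%:E * eint_grad Om p w)%E.
Proof.
have [M M0 OmM] := bounded_set_box bOm.
exists (2 `^ p * 2 `^ p * 2 `^ p * (2 * M) `^ p).
  by rewrite !mulr_ge0 ?powR_ge0.
move=> w Ww; pose i := Ordinal N0.
have M20 : 0 <= 2 * M by rewrite mulr_ge0// ltW.
apply: le_trans (W1p0_shift oOm p1 i Ww M20).
have mw := measurable_zero_ext oOm Ww.1.
have pn0 : p != 0 by rewrite gt_eqF.
rewrite /eint_pow /shift_int [leLHS](integral_zero_ext Om _ pn0).
apply: ge0_le_integral => //.
- exact: measurable_normr_powR.
- by apply: measurable_normr_powR; exact: measurable_shift_diff.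
move=> x _; rewrite lee_fin; apply: powR_homo; rewrite ?(ltW p0)//.
have [Ox|Ox] := pselect (Om x); last by rewrite [in leLHS]zero_ext_out// normr0.
rewrite (@zero_ext_out _ _ _ _ (x + _)) ?sub0r ?normrN// => /OmM /(_ i).
have := OmM _ Ox i; rewrite !mxE !eqxx/= mulr1 !ltr_norml => /andP[? ?] /andP[? ?].
lra.
Qed.

(** The vector is reached along the axes, one coordinate at a time, with [shift_intD] at each
    corner. *)
Lemma shift_int_sum (s : seq 'I_N) : exists2 c : R, 0 <= c &
  forall (f : 'rV[R]_N -> R) (a : 'I_N -> R) (B : \bar R), (0 <= B)%E ->
  measurable_fun setT f -> (forall i, shift_int p f (a i *: e_ i) <= B)%E ->
  (shift_int p f (\sum_(i <- s) a i *: e_ i) <= c%:E * B)%E.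
Proof.
elim: s => [|i s [c c0 IH]].
  exists 0 => // f a B B0 mf _.
  by rewrite big_nil shift_int0 ?gt_eqF// mul0e.
exists (2 `^ p / 2 * (1 + c)).
  by rewrite mulr_ge0 ?divr_ge0 ?powR_ge0 ?addr_ge0.
move=> f a B B0 mf aB; rewrite big_cons.
apply: (le_trans (shift_intD _ _ p1 mf)).
rewrite (EFinM _ (1 + c)) -muleA.
rewrite lee_wpmul2l ?lee_fin ?divr_ge0 ?powR_ge0//.
by rewrite EFinD ge0_muleDl ?lee_fin// mul1e leeD//; exact: IH.
Qed.

Lemma W1p0_cube : exists2 C : R, 0 <= C & forall w (r : R) (y : 'rV[R]_N),
  W1p0 Om p w -> (forall i, 0 <= y ord0 i <= r) ->
  (shift_int p (ext w) y <= (C * r `^ p)%:E * eint_grad Om p w)%E.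
Proof.
have [c c0 hc] := shift_int_sum (index_enum 'I_N).
exists (c * (2 `^ p * 2 `^ p * 2 `^ p)); first by rewrite !mulr_ge0 ?powR_ge0.
move=> w r y Ww yr; rewrite {1}[y]row_sum_delta.
rewrite -mulrA (EFinM c) -muleA; apply: hc.
- by rewrite mule_ge0 ?lee_fin ?mulr_ge0 ?powR_ge0 ?eint_grad_ge0.
- exact: (measurable_zero_ext oOm Ww.1).
move=> i; have /andP[y0 yir] := yr i.
apply: le_trans (W1p0_shift oOm p1 i Ww y0) _.
rewrite lee_wpmul2r ?eint_grad_ge0// lee_fin ler_wpM2l ?mulr_ge0 ?powR_ge0//.
by apply: powR_homo => //; exact: ltW.
Qed.

End poincare.

(** * Self-improvement of integrability from level sets *)

Section level_sets.
Context (R : realType) (N : nat) (p : R).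
Hypothesis p1 : 1 <= p.
Implicit Types (f : 'rV[R]_N -> R).
Local Notation mu := (lebesgue_rV R N).
Local Notation cube r := (rV_box (fun _ : 'I_N => 0) (fun _ => r)).

Let p0 : 0 < p. Proof. by rewrite (lt_le_trans _ p1). Qed.

(** The restriction to the cube sits in the integrand, so that Tonelli applies on the whole product
    space. *)
Definition cube_osc f (r : R) (x : 'rV[R]_N) : \bar R :=
  (\int[mu]_y (`|f (x + y) - f x| `^ p * \1_(cube r) y)%:E)%E.

Lemma cube_osc_ge0 f r x : (0 <= cube_osc f r x)%E.
Proof. by apply: integral_ge0 => y _; rewrite lee_fin mulr_ge0 ?powR_ge0// indicE ler0n. Qed.

Lemma measure_cube (r : R) : 0 <= r -> mu (cube r) = (r ^+ N)%:E.
Proof.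
move=> r0; rewrite lebesgue_rV_box//.
by under eq_bigr do rewrite subr0; rewrite prodr_const card_ord.
Qed.

Lemma integral_cube (r : R) : 0 <= r ->
  (\int[mu]_y (\1_(cube r) y)%:E = (r ^+ N)%:E)%E.
Proof.
move=> r0; rewrite -measure_cube//.
have := @integral_indic _ _ R mu setT measurableT _
  (measurable_rV_box (fun _ : 'I_N => 0) (fun _ => r)).
by rewrite setIT.
Qed.

Let measurable_cube_integrand f r : measurable_fun setT f ->
  measurable_fun setT (fun z : 'rV[R]_N * 'rV[R]_N =>
    (`|f (z.1 + z.2) - f z.1| `^ p * \1_(cube r) z.2)%:E).
Proof.
move=> mf; apply/measurable_EFinP; apply: measurable_funM.
  apply: (measurableT_comp (measurable_powR p)).
  apply: measurableT_comp => //; apply: measurable_funB.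
    by apply: measurableT_comp => //; exact: measurable_rV_add.
  by apply: measurableT_comp => //; exact: measurable_fst.
have mi : measurable_fun setT (\1_(cube r) : 'rV[R]_N -> R).
  by apply: measurable_indic; exact: measurable_rV_box.
exact: (measurableT_comp mi measurable_snd).
Qed.

Lemma measurable_cube_osc f r : measurable_fun setT f ->
  measurable_fun setT (cube_osc f r).
Proof.
move=> mf.
apply: (@measurable_fun_fubini_tonelli_F _ _ _ _ R mu _ (measurable_cube_integrand r mf)).
by move=> z; rewrite lee_fin mulr_ge0 ?powR_ge0// indicE ler0n.
Qed.

Lemma integral_cube_osc f (r S : R) : measurable_fun setT f -> 0 <= r -> 0 <= S ->
  (forall y, cube r y -> shift_int p f y <= S%:E)%E ->
  (\int[mu]_x cube_osc f r x <= (S * r ^+ N)%:E)%E.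
Proof.
move=> mf r0 S0 fS; rewrite /cube_osc.
rewrite (@fubini_tonelli _ _ _ _ R mu mu _ (measurable_cube_integrand r mf)); last first.
  by move=> z; rewrite lee_fin mulr_ge0 ?powR_ge0// indicE ler0n.
rewrite EFinM -integral_cube// -ge0_integralZl//; last first.
  by apply/measurable_EFinP; apply: measurable_indic; exact: measurable_rV_box.
have mg := measurable_cube_integrand r mf.
apply: ge0_le_integral => //.
- by move=> y _; apply: integral_ge0 => x _; rewrite lee_fin mulr_ge0 ?powR_ge0// indicE ler0n.
- apply: (@measurable_fun_fubini_tonelli_G _ _ _ _ R mu _ mg).
  by move=> z; rewrite lee_fin mulr_ge0 ?powR_ge0// indicE ler0n.
- apply: measurable_funeM; apply/measurable_EFinP.
  by apply: measurable_indic; exact: measurable_rV_box.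
move=> y _ /=; rewrite indicE; case: (boolP (y \in _)) => [|_] /=; last first.
  by rewrite mule0 integral0_eq// => x _; rewrite mulr0.
rewrite inE mule1 => /fS; apply: le_trans.
rewrite [leLHS](_ : _ = shift_int p f y)//.
by apply: eq_integral => x _; rewrite mulr1.
Qed.

(* If [|f x| >= 2 t] then for every [y] either [|f (x + y)| >= t] or
   [|f (x + y) - f x| >= t]; integrate over the cube. *)
Lemma cube_osc_lb f (s r t K : R) x : measurable_fun setT f -> 0 < s -> 0 < t ->
  0 <= r -> (\int[mu]_y (`|f y| `^ s)%:E <= K%:E)%E -> K / t `^ s <= r ^+ N / 2 ->
  2 * t <= `|f x| -> ((t `^ p * (r ^+ N / 2))%:E <= cube_osc f r x)%E.
Proof.
move=> mf s0 t0 r0 fK Kr tx.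
have tp0 : 0 < t `^ p by exact: powR_gt0.
have ts0 : 0 < t `^ s by exact: powR_gt0.
have mfx : measurable_fun setT (fun y : 'rV[R]_N => f (x + y)).
  rewrite (_ : (fun _ => _) = f \o (fun y => y + x)).
    by apply: measurableT_comp => //; exact: measurable_rV_shift.
  by apply/funext => y /=; rewrite addrC.
have mfs : measurable_fun setT (fun y : 'rV[R]_N => (`|f (x + y)| `^ s)%:E).
  exact: measurable_normr_powR.
have mosc : measurable_fun setT (fun y : 'rV[R]_N =>
    (`|f (x + y) - f x| `^ p * \1_(cube r) y)%:E).
  apply/measurable_EFinP; apply: measurable_funM.
    apply/measurable_EFinP; apply: measurable_normr_powR.
    by apply: measurable_funB.
  by apply: measurable_indic; exact: measurable_rV_box.
have osc0 y : (0 <= (`|f (x + y) - f x| `^ p * \1_(cube r) y)%:E)%E.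
  by rewrite lee_fin mulr_ge0 ?powR_ge0// indicE ler0n.
have fs0 y : (0 <= (`|f (x + y)| `^ s)%:E)%E by rewrite lee_fin powR_ge0.
have K0 : 0 <= K by rewrite -lee_fin (le_trans _ fK)// integral_ge0.
(* Where [|f (x + y)| >= t], the first integrand on the right is at least [t ^ p]: this is
   Chebyshev's inequality at exponent [s]. By the hypothesis on [K] that term accounts for at most
   half of the left-hand side. *)
have : ((t `^ p * r ^+ N)%:E <= (t `^ p / t `^ s)%:E *
    \int[mu]_y (`|f (x + y)%R| `^ s)%:E + cube_osc f r x)%E.
  rewrite EFinM -integral_cube// -!ge0_integralZl//; last 3 first.
  - by rewrite lee_fin divr_ge0// ltW.
  - by apply/measurable_EFinP; apply: measurable_indic; exact: measurable_rV_box.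
  - by rewrite lee_fin ltW.
  rewrite /cube_osc -ge0_integralD//; last 2 first.
  - by move=> y _; rewrite mule_ge0// lee_fin divr_ge0// ltW.
  - exact: measurable_funeM.
  apply: ge0_le_integral => //.
  - by move=> y _; rewrite mule_ge0 ?lee_fin// ltW.
  - apply: measurable_funeM; apply/measurable_EFinP.
    by apply: measurable_indic; exact: measurable_rV_box.
  - by apply: emeasurable_funD => //; exact: measurable_funeM.
  move=> y _; rewrite -!EFinM -EFinD lee_fin indicE.
  case: (y \in _) => /=; rewrite ?mulr1 ?mulr0 ?addr0; last first.
    by rewrite mulr_ge0 ?powR_ge0// divr_ge0 ?powR_ge0.
  have [ft|ft] := leP t `|f (x + y)|.
    rewrite -[leLHS]addr0 lerD ?powR_ge0// -mulrA ler_peMr ?powR_ge0//.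
    by rewrite mulrC ler_pdivlMr// mul1r; apply: powR_homo => //; exact: ltW.
  rewrite -[leLHS]add0r lerD//; first by rewrite mulr_ge0 ?powR_ge0// divr_ge0 ?powR_ge0.
  apply: powR_homo; rewrite ?(ltW p0) ?(ltW t0)//.
  have := ler_normB (f (x + y)) (f (x + y) - f x).
  by rewrite opprB addrC subrK; lra.
rewrite (_ : integral mu setT _ = \int[mu]_y (`|f y| `^ s)%:E)%E; last first.
  rewrite -(integral_normr_shift s x mf); apply: eq_integral => y _.
  by rewrite addrC.
move=> h.
have {h} : ((t `^ p * r ^+ N)%:E <= (t `^ p * (r ^+ N / 2))%:E + cube_osc f r x)%E.
  apply: (le_trans h); rewrite leeD2r//.
  apply: (@le_trans _ _ ((t `^ p / t `^ s)%:E * K%:E)%E).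
    by rewrite lee_wpmul2l// lee_fin divr_ge0// ltW.
  by rewrite -EFinM lee_fin -mulrA ler_wpM2l ?(ltW tp0)// mulrC.
case: (cube_osc f r x) (cube_osc_ge0 f r x) => [g g0| _ _|//]; last by rewrite leey.
by rewrite -EFinD !lee_fin mulrA => ?; lra.
Qed.

End level_sets.

Section bootstrap.
Context (R : realType) (N : nat) (p : R).
Hypotheses (p1 : 1 <= p) (N0 : (0 < N)%N).
Implicit Types (f : 'rV[R]_N -> R).
Local Notation mu := (lebesgue_rV R N).

Let p0 : 0 < p. Proof. by rewrite (lt_le_trans _ p1). Qed.

Let Nr0 : 0 < N%:R :> R. Proof. by rewrite ltr0n. Qed.

Lemma powR_lt1 (a x : R) : 1 < a -> x < 0 -> a `^ x < 1.
Proof.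
move=> a1 x0; rewrite /powR gt_eqF ?(lt_trans _ a1)// expR_lt1.
by rewrite nmulr_rlt0// ln_gt0.
Qed.

Lemma dyadic_level (x : R) : 1 <= x -> exists j : nat, 2 ^+ j <= x <= 2 ^+ j.+1.
Proof.
move=> x1; have ex : exists n : nat, x <= 2 ^+ n.
  exists (Num.truncn x).+1; apply: ltW; apply: (lt_trans (truncnS_gt x)).
  by rewrite -natrX ltr_nat ltn_expl.
case: (ex_minnP ex) => -[|n] xn min.
  by exists 0%N; rewrite expr0 x1/= (le_trans xn)// expr0 expr1 ler1n.
exists n; rewrite xn andbT leNgt; apply/negP => /ltW /min.
by rewrite ltnn.
Qed.

Lemma geometric_sum_le (q : R) (b : nat -> R) (n : nat) : q < 1 ->
  (forall j, 0 <= b j) -> (forall j, b j.+1 = q * b j) ->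
  \sum_(0 <= j < n) b j <= b 0%N / (1 - q).
Proof.
move=> q1 b0 bS; rewrite ler_pdivlMr ?subr_gt0//.
suff -> : (\sum_(0 <= j < n) b j) * (1 - q) = b 0%N - b n by rewrite gerBl.
elim: n => [|n IH]; first by rewrite big_nil mul0r subrr.
by rewrite big_nat_recr//= mulrDl IH bS; ring.
Qed.

(** By [cube_osc_lb] and [integral_cube_osc] the level set where [|f|] lies between [2 ^ j] and
    [2 ^ (j + 1)] has measure at most [2 C r ^ p / t ^ p]. With [r] adapted to the level this decays
    like [2 ^ (- j (p + p s / N))], so that the contributions to the [s'] integral form a geometric
    series. [K'] is chosen before [f], as the iteration requires. *)
Lemma bootstrap_step (D : set 'rV[R]_N) (C K s s' : R) :
  measurable D -> (mu D < +oo)%E -> 0 <= C -> 0 < K -> 0 < s -> 0 < s' ->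
  s' < p + p * s / N%:R ->
  exists2 K' : R, 0 < K' & forall f, measurable_fun setT f ->
  (forall x, ~ D x -> f x = 0) ->
  (forall (r : R) (y : 'rV[R]_N), 0 <= r -> (forall i, 0 <= y ord0 i <= r) ->
     (shift_int p f y <= (C * r `^ p)%:E)%E) ->
  (\int[mu]_y (`|f y| `^ s)%:E <= K%:E)%E ->
  (\int[mu]_y (`|f y| `^ s')%:E <= K'%:E)%E.
Proof.
move=> mD Doo C0 K0 s0 s'0 ss'.
pose t j : R := 2 ^+ j / 2.
have t0 j : 0 < t j by rewrite divr_gt0 ?exprn_gt0.
have tS j : t j.+1 = 2 * t j by rewrite /t exprS mulrA.
(* The smallest side for which Chebyshev's inequality leaves [|f| >= t j] on at most half of the
   cube. *)
pose r j : R := (2 * K / t j `^ s) `^ N%:R^-1.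
have r0 j : 0 < r j by rewrite powR_gt0// divr_gt0 ?mulr_gt0 ?powR_gt0.
have rN j : r j ^+ N = 2 * K / t j `^ s.
  rewrite -powR_mulrn ?(ltW (r0 j))// /r -powRrM mulVf ?gt_eqF// powRr1//.
  by rewrite ltW// divr_gt0 ?mulr_gt0 ?powR_gt0.
have rS j : r j.+1 = r j * 2 `^ (- (s / N%:R)).
  rewrite /r tS (powRM s (ler0n R 2) (ltW (t0 j))).
  rewrite (_ : 2 * K / (2 `^ s * t j `^ s) = 2 * K / t j `^ s * (2 `^ s)^-1); last first.
    by field; rewrite !gt_eqF ?powR_gt0.
  have x0 : 0 <= 2 * K / t j `^ s by rewrite ltW// divr_gt0 ?mulr_gt0 ?powR_gt0.
  have y0 : 0 <= (2 `^ s : R)^-1 by rewrite invr_ge0 powR_ge0.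
  by rewrite (powRM _ x0 y0) -(powRN 2 s) -powRrM mulNr.
pose a j : R := t j `^ p * (r j ^+ N / 2).
have a0 j : 0 < a j by rewrite mulr_gt0 ?powR_gt0 ?divr_gt0 ?exprn_gt0.
pose M j : R := (2 ^+ j.+1) `^ s' / a j.
have M0 j : 0 < M j by rewrite divr_gt0 ?powR_gt0 ?exprn_gt0.
pose b j : R := M j * (C * r j `^ p * r j ^+ N).
have b0 j : 0 <= b j.
  apply: mulr_ge0; first exact: ltW.
  apply: mulr_ge0; last by apply: exprn_ge0; exact: ltW.
  by apply: mulr_ge0 => //; exact: powR_ge0.
(* The ratio of consecutive bounds, below 1 by the hypothesis on [s']. *)
pose q : R := 2 `^ (s' - p - p * s / N%:R).
have q1 : q < 1 by apply: powR_lt1; rewrite ?ltr1n//; lra.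
have bE j : b j = 2 * C * (2 ^+ j.+1) `^ s' * r j `^ p / t j `^ p.
  rewrite /b /M /a; field.
  by rewrite !gt_eqF ?powR_gt0 ?exprn_gt0.
have two (u v : R) : (u + v == 0) ==> (2 != 0 :> R) by rewrite pnatr_eq0 implybT.
have qE : q = 2 `^ s' * 2 `^ (- (s / N%:R) * p) / 2 `^ p.
  rewrite -powRN -!powRD//; congr (_ `^ _); ring.
have bS j : b j.+1 = q * b j.
  have e1 : (2 * t j) `^ p = 2 `^ p * t j `^ p by rewrite powRM// ltW.
  have e2 : (2 * 2 ^+ j.+1) `^ s' = 2 `^ s' * (2 ^+ j.+1) `^ s'.
    by rewrite powRM// exprn_ge0.
  have e3 : (r j * 2 `^ (- (s / N%:R))) `^ p = r j `^ p * 2 `^ (- (s / N%:R) * p).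
    by rewrite powRM ?powR_ge0 ?(ltW (r0 j))// -powRrM.
  rewrite !bE (exprS _ j.+1) tS rS e1 e2 e3 qE.
  by field; rewrite !gt_eqF ?powR_gt0.
have bsum n := geometric_sum_le n q1 b0 bS.
have Dfin : mu D \is a fin_num by rewrite ge0_fin_numE.
(* The measure of [D] accounts for [|f| <= 1] and the series for the rest; the final 1 only ensures
   positivity. *)
exists (fine (mu D) + b 0%N / (1 - q) + 1).
  by rewrite ltr_wpDl// addr_ge0 ?fine_ge0// divr_ge0// subr_ge0 ltW.
move=> f mf fD fshift fK.
pose g j x : \bar R := ((M j)%:E * cube_osc p f (r j) x)%E.
have g0 j x : (0 <= g j x)%E by rewrite mule_ge0 ?lee_fin ?cube_osc_ge0 ?ltW.
have mg j : measurable_fun setT (g j).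
  by apply: measurable_funeM; exact: measurable_cube_osc.
have gb j : (\int[mu]_x g j x <= (b j)%:E)%E.
  rewrite ge0_integralZl//; last 3 first.
  - exact: measurable_cube_osc.
  - by move=> x _; exact: cube_osc_ge0.
  - by rewrite lee_fin ltW.
  rewrite /b (EFinM (M j)); apply: lee_wpmul2l; first by rewrite lee_fin ltW.
  apply: integral_cube_osc => //; first exact: ltW.
    by rewrite mulr_ge0 ?powR_ge0.
  move=> y yr; apply: fshift; first exact: ltW.
  by move=> i; have /andP[/ltW -> ->] := yr i.
pose G x : \bar R := (\sum_(0 <= j <oo) g j x)%E.
have mG : measurable_fun setT G by exact: ge0_emeasurable_sum.
have G0 x : (0 <= G x)%E by apply: nneseries_ge0 => n _ _; exact: g0.
have m1 : measurable_fun setT (fun x => (\1_D x)%:E : \bar R).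
  by apply/measurable_EFinP; exact: measurable_indic.
have GI : (\int[mu]_x G x <= (b 0%N / (1 - q))%:E)%E.
  rewrite /G integral_nneseries//.
  apply: lime_le; first by apply: is_cvg_nneseries => n _ _; exact: integral_ge0.
  apply: nearW => n; apply: (@le_trans _ _ (\sum_(0 <= j < n) (b j)%:E)%E).
    by apply: lee_sum => j _.
  by rewrite sumEFin lee_fin.
apply: (@le_trans _ _ (\int[mu]_x ((\1_D x)%:E + G x))%E).
  apply: ge0_le_integral => //.
  - exact: measurable_normr_powR.
  - exact: emeasurable_funD.
  move=> x _; have [Dx|/fD ->] := pselect (D x); last first.
    by rewrite normr0 powR0 ?gt_eqF// adde_ge0// lee_fin.
  have [fx|fx] := leP `|f x| 1.
    rewrite indicE mem_set//= -[leLHS]adde0 leeD// lee_fin.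
    by have := powR_homo (ltW s'0) (normr_ge0 (f x)) fx; rewrite powR1.
  have [j /andP[jl ju]] := dyadic_level (ltW fx).
  rewrite -[leLHS]add0e leeD ?lee_fin//.
  apply: (@le_trans _ _ (g j x)).
    apply: (@le_trans _ _ (M j * a j)%:E).
      by rewrite lee_fin /M divfK ?gt_eqF//; apply: powR_homo => //; exact: ltW.
    rewrite (EFinM (M j)); apply: lee_wpmul2l; first by rewrite lee_fin ltW.
    apply: (cube_osc_lb p1 mf s0 (t0 j) (ltW (r0 j)) fK).
      by rewrite rN le_eqVlt; apply/orP; left; apply/eqP; field; rewrite gt_eqF ?powR_gt0.
    by rewrite /t mulrCA divff ?mulr1.
  apply: (@le_trans _ _ (\sum_(0 <= k < j.+1) g k x)%E).
    by rewrite big_nat_recr//= leeDr// sume_ge0.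
  by apply: nneseries_lim_ge => n _ _; exact: g0.
rewrite ge0_integralD//.
have -> : (\int[mu]_x (\1_D x)%:E = mu D)%E.
  by have := @integral_indic _ _ R mu setT measurableT _ mD; rewrite setIT.
rewrite EFinD EFinD fineK// -[leLHS]adde0; apply: leeD; last by rewrite lee_fin.
exact: leeD2l.
Qed.

(** One step leads from [s] to any exponent below [p + p s / N = s + (p - s c)] with
    [c = (N - p) / N]. Subcriticality is [gam c < p], so the gain stays bounded below all the way up
    to [gam]. *)
Lemma bootstrap_sobolev (D : set 'rV[R]_N) (C gam : R) (F : set ('rV[R]_N -> R)) :
  measurable D -> (mu D < +oo)%E -> 0 <= C -> p < gam ->
  gam * (N%:R - p) < p * N%:R ->
  (forall f, F f -> [/\ measurable_fun setT f, forall x, ~ D x -> f x = 0 &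
     forall (r : R) (y : 'rV[R]_N), 0 <= r -> (forall i, 0 <= y ord0 i <= r) ->
       (shift_int p f y <= (C * r `^ p)%:E)%E]) ->
  (exists2 K : R, 0 < K & forall f, F f -> (\int[mu]_y (`|f y| `^ p)%:E <= K%:E)%E) ->
  exists2 K : R, 0 < K & forall f, F f -> (\int[mu]_y (`|f y| `^ gam)%:E <= K%:E)%E.
Proof.
move=> mD Doo C0 pg gN HF P0.
have [c cE] : exists c : R, c = (N%:R - p) / N%:R by eexists.
have gc : gam * c < p by rewrite cE mulrA ltr_pdivrMr.
(* A gain valid for every [s] up to [gam]: the first entry serves [c <= 0], that is [N <= p], the
   second [c > 0]. *)
have [g gE] : exists g : R, g = Num.min (p / 2) ((p - gam * c) / 2) by eexists.
have g0 : 0 < g by rewrite gE lt_min !divr_gt0 ?subr_gt0.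
have gs (s : R) : 0 < s -> s <= gam -> s + g < p + p * s / N%:R.
  move=> s0 sg; rewrite (_ : p + p * s / N%:R = p + s - s * c); last first.
    by rewrite cE; field; rewrite gt_eqF.
  suff : s * c < p - g by lra.
  have g1 : g <= p / 2 by rewrite gE ge_min lexx.
  have g2 : g <= (p - gam * c) / 2 by rewrite gE ge_min lexx orbT.
  have [c0|c0] := leP c 0.
    have : s * c <= 0 by rewrite pmulr_rle0.
    by lra.
  have : s * c <= gam * c by rewrite ler_pM2r.
  by lra.
pose sn (n : nat) : R := Num.min gam (p + n%:R * g).
have sn0 n : 0 < sn n.
  by rewrite lt_min (lt_trans p0 pg) ltr_wpDr// mulr_ge0// ltW.
have P n : exists2 K : R, 0 < K &
    forall f, F f -> (\int[mu]_y (`|f y| `^ sn n)%:E <= K%:E)%E.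
  elim: n => [|n [K K0 IH]].
    by rewrite (_ : sn 0%N = p)// /sn mul0r addr0; apply/min_idPr; exact: ltW.
  have sng : sn n <= gam by rewrite ge_min lexx.
  have ss' : sn n.+1 < p + p * sn n / N%:R.
    apply: le_lt_trans (gs _ (sn0 n) sng).
    rewrite /sn -natr1 mulrDl mul1r addrA.
    case: (leP gam (p + n%:R * g)) => h; first by rewrite ge_min lerDl ltW.
    by rewrite ge_min lexx orbT.
  have [K' K'0 hK'] := bootstrap_step mD Doo C0 K0 (sn0 n) (sn0 n.+1) ss'.
  exists K' => // f Ff; have [mf fD fs] := HF f Ff.
  by apply: hK' => //; exact: IH.
have := P (Num.truncn ((gam - p) / g)).+1.
rewrite (_ : sn _ = gam)//; apply/min_idPl; rewrite -lerBlDl -ler_pdivrMr//.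
by apply: ltW; exact: truncnS_gt.
Qed.

End bootstrap.

(** * Scaling in the Sobolev space *)

Section sobolev_scaling.
Context (R : realType) (N : nat) (Om : set 'rV[R]_N) (p : R).
Hypotheses (oOm : open Om) (bOm : bounded_set Om) (p1 : 1 < p).
Implicit Types (w : sobolev_pair R N).
Local Notation mu := (lebesgue_rV R N).

Let mOm : measurable Om := open_measurable_rV oOm.

Lemma lebesgue_Om_lty : (mu Om < +oo)%E.
Proof. exact: bounded_set_lty. Qed.

Lemma powR_le1D (a r s : R) : 0 <= a -> 0 <= r -> r <= s -> a `^ r <= 1 + a `^ s.
Proof.
move=> a0 r0 rs; have [a1|a1] := leP a 1.
  have := powR_homo r0 a0 a1; rewrite powR1 => h.
  by rewrite (le_trans h)// lerDl powR_ge0.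
by rewrite (le_trans (ler_powR (ltW a1) rs))// lerDr.
Qed.

(** The real-valued integral is linear on integrable functions only; this lets a scalar leave the
    two integrals that define a weak gradient. *)
Lemma integrable_Lp_bounded (r M : R) (f g : 'rV[R]_N -> R) : 1 <= r ->
  is_Lp Om r f -> measurable_fun Om g -> (forall x, `|g x| <= M) ->
  mu.-integrable Om (EFin \o (fun x => f x * g x)).
Proof.
move=> r1 [mf fr] mg gM; have M0 : 0 <= M by rewrite (le_trans _ (gM 0)).
have m1 : measurable_fun Om (fun x => (1 + `|f x| `^ r)%:E : \bar R).
  under eq_fun do rewrite EFinD.
  by apply: emeasurable_funD => //; exact: measurable_normr_powR.
apply: (@le_integrable _ _ _ mu Om mOm (EFin \o (fun x => f x * g x))
    (fun x => M%:E * (1 + `|f x| `^ r)%:E)%E).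
- by apply/measurable_EFinP; exact: measurable_funM.
- move=> x Ox; rewrite lee_fin /= normrM.
  rewrite [leRHS]ger0_norm ?mulr_ge0 ?addr_ge0 ?powR_ge0//.
  rewrite mulrC ler_pM//.
  by have := powR_le1D (normr_ge0 (f x)) ler01 r1; rewrite powRr1.
apply: integrableZl => //; apply/integrableP; split => //.
rewrite (eq_integral (fun x => (1%:E + (`|f x| `^ r)%:E)%E)); last first.
  by move=> x _; rewrite gee0_abs ?lee_fin ?addr_ge0 ?powR_ge0.
rewrite ge0_integralD//; last exact: measurable_normr_powR.
by rewrite lte_add_pinfty// integral_cst// mul1e lebesgue_Om_lty.
Qed.

Lemma is_LpZ (t : R) (f : 'rV[R]_N -> R) : is_Lp Om p f -> is_Lp Om p (fun x => t * f x).
Proof.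
move=> [mf fp]; split; first exact: measurable_funM.
under eq_integral do rewrite normrM powRM// EFinM.
rewrite ge0_integralZl//;
  try (by move=> *; rewrite lee_fin powR_ge0); try exact: measurable_normr_powR.
by rewrite lte_mul_pinfty// lee_fin powR_ge0.
Qed.

Lemma eint_powZ (r t : R) w : measurable_fun Om w.1 ->
  eint_pow Om r (t *: w) = ((`|t| `^ r)%:E * eint_pow Om r w)%E.
Proof.
move=> mw; rewrite /eint_pow -ge0_integralZl//;
  try (by move=> *; rewrite lee_fin powR_ge0); try exact: measurable_normr_powR.
by apply: eq_integral => x _; rewrite -EFinM -powRM// -normrM.
Qed.

Lemma integral_enormZ (t : R) (G : 'rV[R]_N -> 'rV[R]_N) :
  (forall i, measurable_fun Om (fun x => G x ord0 i)) ->
  (\int[mu]_(x in Om) (enorm (t *: G x) `^ p)%:E =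
   (`|t| `^ p)%:E * \int[mu]_(x in Om) (enorm (G x) `^ p)%:E)%E.
Proof.
move=> mG; rewrite -ge0_integralZl//;
  try (by move=> *; rewrite lee_fin powR_ge0); try exact: measurable_enorm_powR.
by apply: eq_integral => x _; rewrite -EFinM -powRM ?enorm_ge0// -enormZ.
Qed.

Lemma eint_gradZ (t : R) w : (forall i, measurable_fun Om (fun x => w.2 x ord0 i)) ->
  eint_grad Om p (t *: w) = ((`|t| `^ p)%:E * eint_grad Om p w)%E.
Proof. exact: integral_enormZ. Qed.

Lemma foldr_partialZ (t : R) (f : 'rV[R]_N -> R) (s : seq 'I_N) : smooth f ->
  foldr (@partial R N) (fun x => t * f x) s = (fun x => t * foldr (@partial R N) f s x).
Proof.
move=> sf; elim: s => [//|i s IH] /=; rewrite IH; apply/funext => x.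
have [_ /(_ i x) d] := sf s.
rewrite /partial (_ : (fun _ => _) = t *: foldr (@partial R N) f s)//.
by rewrite deriveZ.
Qed.

Lemma partialZ (t : R) (f : 'rV[R]_N -> R) i x : smooth f ->
  partial i (fun y => t * f y) x = t * partial i f x.
Proof. by move=> sf; have := foldr_partialZ t [:: i] sf => /= ->. Qed.

Lemma test_functionZ (t : R) (f : 'rV[R]_N -> R) : t != 0 ->
  test_function Om f -> test_function Om (fun x => t * f x).
Proof.
move=> t0 [sf cf fOm].
have E : [set x | t * f x != 0] = [set x | f x != 0].
  by apply/seteqP; split=> x /=; rewrite mulf_eq0 negb_or t0.
split; [move=> s|by rewrite E|by rewrite E].
rewrite (foldr_partialZ t s sf); have [cs ds] := sf s; split.
  move=> x; have := @continuousM _ _ (cst t) (foldr (@partial R N) f s) x.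
  by apply; [exact: cst_continuous|exact: cs].
move=> i x; rewrite (_ : (fun _ => _) = t *: foldr (@partial R N) f s)//.
by apply: derivableZ; exact: ds.
Qed.

Lemma W1p0Z (t : R) w : t != 0 -> W1p0 Om p w -> W1p0 Om p (t *: w).
Proof.
move=> t0 [[uLp gLp wg] app].
have Lp' i : is_Lp Om p (fun x => (t *: w).2 x ord0 i).
  suff -> : (fun x => (t *: w).2 x ord0 i) = (fun x => t * w.2 x ord0 i).
    exact: (is_LpZ t (gLp i)).
  by apply/funext => x; rewrite mxE.
split; first (split; [exact: (is_LpZ t uLp)|exact: Lp'|]).
- move=> phi tphi i.
  have [M M0 phiM] := test_function_bounded tphi.
  have [M' M'0 dphiM] := test_function_bounded (test_function_partial i tphi).
  have mphi : measurable_fun Om phi.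
    apply: measurable_funTS; apply: continuous_measurable_rV.
    by apply: smooth_continuous; case: tphi.
  have mdphi : measurable_fun Om (partial i phi).
    apply: measurable_funTS; apply: continuous_measurable_rV; apply: smooth_continuous.
    by apply: smooth_partial; case: tphi.
  under eq_Rintegral do rewrite -mulrA.
  rewrite RintegralZl//; last exact: (integrable_Lp_bounded (ltW p1) uLp mdphi dphiM).
  rewrite (wg phi tphi i) mulrN; congr (- _).
  under [RHS]eq_Rintegral do rewrite mxE -mulrA.
  by rewrite RintegralZl//; exact: (integrable_Lp_bounded (ltW p1) (gLp i) mphi phiM).
move=> e e0; have tp0 : 0 < `|t| `^ p by rewrite powR_gt0 ?normr_gt0.
have [phi tphi] := app _ (divr_gt0 e0 tp0).
move=> h; exists (fun x => t * phi x); first exact: test_functionZ.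
have sphi : smooth phi by case: tphi.
have mu1 : measurable_fun Om (fun x => w.1 x - phi x).
  apply: measurable_funB; first by case: uLp.
  by apply: measurable_funTS; apply: continuous_measurable_rV; exact: smooth_continuous.
have E1 : (\int[mu]_(x in Om) (`|(t *: w).1 x - t * phi x| `^ p)%:E =
    (`|t| `^ p)%:E * \int[mu]_(x in Om) (`|w.1 x - phi x| `^ p)%:E)%E.
  rewrite -ge0_integralZl//;
    try (by move=> *; rewrite lee_fin powR_ge0); try exact: measurable_normr_powR.
  by apply: eq_integral => x _; rewrite -EFinM -powRM// -normrM mulrBr.
have E2 : (\int[mu]_(x in Om) (enorm ((t *: w).2 x - gradient (fun x => (t * phi x)%R) x) `^ p)%:E =
    (`|t| `^ p)%:E * \int[mu]_(x in Om) (enorm (w.2 x - gradient phi x) `^ p)%:E)%E.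
  rewrite -integral_enormZ.
    apply: eq_integral => x _; congr ((enorm _ `^ _)%:E).
    by apply/rowP => i; rewrite !mxE partialZ// mulrBr.
  move=> i; under eq_fun do rewrite !mxE.
  apply: measurable_funB; first by have [] := gLp i.
  apply: measurable_funTS; apply: continuous_measurable_rV; apply: smooth_continuous.
  exact: smooth_partial.
rewrite E1 E2 -ge0_muleDr;
  try (by apply: integral_ge0 => x _; rewrite lee_fin powR_ge0).
rewrite (_ : e%:E = (`|t| `^ p)%:E * (e / `|t| `^ p)%:E)%E; last first.
  by rewrite -EFinM mulrCA divff ?mulr1 ?gt_eqF.
by rewrite lte_pmul2l.
Qed.

Lemma W1p0_nzZ (t : R) w : t != 0 -> W1p0_nz Om p w -> W1p0_nz Om p (t *: w).
Proof.
move=> t0 [Ww nz]; split; first exact: W1p0Z.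
apply: contra_not nz; apply: filterS => x h Ox.
by move/eqP: (h Ox); rewrite mulf_eq0 (negbTE t0) => /eqP.
Qed.

End sobolev_scaling.

(** * Sobolev inequalities up to the exponent [gam] *)

Section sobolev_inequalities.
Context (R : realType) (N : nat) (Om : set 'rV[R]_N) (p gam : R).
Hypotheses (oOm : open Om) (bOm : bounded_set Om) (p1 : 1 < p) (N0 : (0 < N)%N).
Hypotheses (pg : p < gam) (gN : gam * (N%:R - p) < p * N%:R).
Implicit Types (w : sobolev_pair R N).
Local Notation mu := (lebesgue_rV R N).
Local Notation ext w := (w.1 \_ Om).
Local Notation G := (int_grad_pow Om p).
Local Notation I := (int_pow Om).

Let mOm : measurable Om := open_measurable_rV oOm.
Let p0 : 0 < p. Proof. by rewrite (lt_trans _ p1). Qed.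

Lemma W1p0_measurable w : W1p0 Om p w -> measurable_fun Om w.1.
Proof. by move=> [[[mw _] _ _] _]. Qed.

Lemma eint_grad_fin w : W1p0 Om p w -> eint_grad Om p w = (G w)%:E.
Proof.
move=> Ww; rewrite /int_grad_pow /Rintegral -/(eint_grad Om p w) fineK//.
by rewrite ge0_fin_numE ?eint_grad_ge0//; exact: (eint_grad_lty mOm (ltW p1) Ww.1).
Qed.

(** The bootstrap asks for bounds uniform over a family, so it is run on the functions with gradient
    integral at most 1, extended by zero; Poincaré's inequality supplies the initial exponent
    [p]. *)
Lemma sobolev_unit : exists2 K : R, 0 < K & forall w, W1p0 Om p w ->
  (eint_grad Om p w <= 1)%E -> (eint_pow Om gam w <= K%:E)%E.
Proof.
have [C C0 hC] := W1p0_cube oOm (ltW p1).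
have [P P0 hP] := W1p0_poincare oOm bOm (ltW p1) N0.
pose F := [set f : 'rV[R]_N -> R | exists w, [/\ W1p0 Om p w,
  (eint_grad Om p w <= 1)%E & f = ext w]].
have pn0 : p != 0 by rewrite gt_eqF.
have gn0 : gam != 0 by rewrite gt_eqF// (lt_trans p0).
have [||K K0 hK] := @bootstrap_sobolev R N p (ltW p1) N0 Om C gam F mOm
  (lebesgue_Om_lty oOm bOm) C0 pg gN.
- move=> f [w [Ww Gw ->]]; split.
  + exact: (measurable_zero_ext oOm Ww.1).
  + by move=> x; exact: zero_ext_out.
  + move=> r y r0 yr; apply: (le_trans (hC w r y Ww yr)).
    rewrite -[leRHS]mule1; apply: lee_wpmul2l => //.
    by rewrite lee_fin mulr_ge0 ?powR_ge0.
- exists (P + 1); first by rewrite ltr_wpDl.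
  move=> f [w [Ww Gw ->]]; rewrite -(integral_zero_ext Om _ pn0).
  apply: (le_trans (hP w Ww)); apply: (@le_trans _ _ (P%:E * 1)%E).
    by apply: lee_wpmul2l => //; rewrite lee_fin.
  by rewrite mule1 lee_fin lerDl.
exists K => // w Ww Gw; rewrite /eint_pow (integral_zero_ext Om _ gn0).
by apply: hK; exists w.
Qed.

Lemma sobolev_unit_le (r : R) : 0 < r -> r <= gam ->
  exists2 K : R, 0 < K & forall w, W1p0 Om p w ->
  (eint_grad Om p w <= 1)%E -> (eint_pow Om r w <= K%:E)%E.
Proof.
move=> r0 rg; have [K K0 hK] := sobolev_unit.
have Ofin : mu Om \is a fin_num by rewrite ge0_fin_numE// lebesgue_Om_lty.
exists (fine (mu Om) + K); first by rewrite ltr_wpDl// fine_ge0.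
move=> w Ww Gw; have mw := W1p0_measurable Ww.
apply: (@le_trans _ _ (\int[mu]_(x in Om) (1%:E + (`|w.1 x| `^ gam)%:E))%E).
  apply: ge0_le_integral => //.
  - exact: measurable_normr_powR.
  - by apply: emeasurable_funD => //; exact: measurable_normr_powR.
  - by move=> x _; rewrite -EFinD lee_fin powR_le1D// ltW.
rewrite ge0_integralD//; last exact: measurable_normr_powR.
rewrite integral_cst// mul1e EFinD fineK//.
by apply: leeD2l; exact: hK.
Qed.

(** Finiteness is obtained by scaling [w] into the unit ball of the gradient norm. From here on the
    real-valued integrals obey the expected algebra. *)
Lemma eint_pow_fin (r : R) w : 0 < r -> r <= gam -> W1p0 Om p w ->
  eint_pow Om r w = (I r w)%:E.
Proof.
move=> r0 rg Ww; rewrite /int_pow /Rintegral -/(eint_pow Om r w) fineK//.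
rewrite ge0_fin_numE ?eint_pow_ge0//.
have [K K0 hK] := sobolev_unit_le r0 rg.
have G0 : 0 <= G w by have := eint_grad_ge0 Om p w; rewrite (eint_grad_fin Ww) lee_fin.
(* The added 1 avoids dividing by a gradient integral that may be zero. *)
pose t := ((G w + 1) `^ p^-1)^-1.
have t0 : 0 < t by rewrite invr_gt0 powR_gt0// ltr_wpDl.
have tn0 : t != 0 by rewrite gt_eqF.
have Wt := W1p0Z oOm bOm p1 tn0 Ww.
have mg i : measurable_fun Om (fun x => w.2 x ord0 i).
  by have [[_ gLp _] _] := Ww; have [] := gLp i.
have := hK _ Wt; rewrite (eint_gradZ _ oOm _ mg) (eint_grad_fin Ww).
rewrite (eint_powZ oOm _ _ (W1p0_measurable Ww)).
rewrite gtr0_norm// -EFinM lee_fin => h.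
have {}h : (eint_pow Om r w <= (t `^ r)^-1%:E * K%:E)%E.
  rewrite lee_pdivlMl ?powR_gt0//; apply: h.
  have x0 : 0 <= G w + 1 by rewrite addr_ge0.
  rewrite /t -powRN -powRrM mulNr mulVf ?gt_eqF// powRN powRr1//.
  by rewrite mulrC ler_pdivrMr ?ltr_wpDl// mul1r lerDl.
by apply: (le_lt_trans h); rewrite -EFinM ltry.
Qed.

Lemma int_pow_ge0 (r : R) w : 0 <= I r w.
Proof. by apply: Rintegral_ge0 => x _; exact: powR_ge0. Qed.

Lemma int_grad_ge0 w : 0 <= G w.
Proof. by apply: Rintegral_ge0 => x _; exact: powR_ge0. Qed.

Lemma int_powZ (r t : R) w : 0 < r -> r <= gam -> 0 < t -> W1p0 Om p w ->
  I r (t *: w) = t `^ r * I r w.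
Proof.
move=> r0 rg t0 Ww; have tn0 : t != 0 by rewrite gt_eqF.
have := eint_powZ oOm r t (W1p0_measurable Ww).
rewrite (eint_pow_fin r0 rg (W1p0Z oOm bOm p1 tn0 Ww)) (eint_pow_fin r0 rg Ww).
by rewrite gtr0_norm// -EFinM => -[->].
Qed.

Lemma int_gradZ (t : R) w : 0 < t -> W1p0 Om p w -> G (t *: w) = t `^ p * G w.
Proof.
move=> t0 Ww; have tn0 : t != 0 by rewrite gt_eqF.
have mg i : measurable_fun Om (fun x => w.2 x ord0 i).
  by have [[_ gLp _] _] := Ww; have [] := gLp i.
have := eint_gradZ p oOm t mg.
rewrite (eint_grad_fin (W1p0Z oOm bOm p1 tn0 Ww)) (eint_grad_fin Ww).
by rewrite gtr0_norm// -EFinM => -[->].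
Qed.

Lemma int_pow_gt0 (r : R) w : 0 < r -> r <= gam -> W1p0_nz Om p w -> 0 < I r w.
Proof.
move=> r0 rg [Ww nz]; rewrite lt_neqAle int_pow_ge0 andbT eq_sym.
apply/negP => /eqP I0; apply: nz.
have mw := W1p0_measurable Ww.
have := @ae_eq_integral_abs _ _ _ mu Om mOm (fun x => (`|w.1 x| `^ r)%:E)
  (measurable_normr_powR r mw).
move=> [] + _ => /(_ _) h.
have : ae_eq mu Om (fun x => (`|w.1 x| `^ r)%:E) (cst 0%E).
  apply: h; have := eint_pow_fin r0 rg Ww; rewrite I0 => E; rewrite -[RHS]E.
  by apply: eq_integral => x _; rewrite gee0_abs// lee_fin powR_ge0.
apply: filterS => x hx Ox; have /eqP := hx Ox.
by rewrite eqe powR_eq0 normr_eq0 => /andP[/eqP].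
Qed.

Lemma poincare : exists2 C : R, 0 < C & forall w, W1p0_nz Om p w -> I p w <= C * G w.
Proof.
have [P P0 hP] := W1p0_poincare oOm bOm (ltW p1) N0.
exists (P + 1); first by rewrite ltr_wpDl.
move=> w [Ww nz]; have := hP w Ww.
rewrite (eint_grad_fin Ww) (eint_pow_fin p0 (ltW pg) Ww) -EFinM lee_fin => h.
by rewrite mulrDl mul1r (le_trans h)// lerDl int_grad_ge0.
Qed.

Lemma int_grad_gt0 w : W1p0_nz Om p w -> 0 < G w.
Proof.
move=> Ww; have [C C0 hC] := poincare.
have := int_pow_gt0 p0 (ltW pg) Ww; move=> /lt_le_trans /(_ (hC w Ww)).
by rewrite pmulr_rgt0.
Qed.

Lemma sobolev_ineq (r : R) : 0 < r -> r <= gam -> exists2 K : R, 0 < K &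
  forall w, W1p0_nz Om p w -> I r w <= K * G w `^ (r / p).
Proof.
move=> r0 rg; have [K K0 hK] := sobolev_unit_le r0 rg.
exists K => // w Ww; have G0 := int_grad_gt0 Ww.
pose t := G w `^ (- p^-1).
have t0 : 0 < t by rewrite powR_gt0.
have tn0 : t != 0 by rewrite gt_eqF.
have Wt := W1p0Z oOm bOm p1 tn0 Ww.1.
have := hK _ Wt; rewrite (eint_grad_fin Wt) (eint_pow_fin r0 rg Wt).
rewrite (int_gradZ t0 Ww.1) (int_powZ r0 rg t0 Ww.1).
have E1 : t `^ p * G w = 1.
  by rewrite /t -powRrM mulNr mulVf ?gt_eqF// powRN powRr1 ?(ltW G0)// mulVf ?gt_eqF.
have E2 : t `^ r = (G w `^ (r / p))^-1 by rewrite /t -powRrM mulNr powRN mulrC.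
rewrite E1 E2 lexx lee_fin => /(_ isT).
by rewrite mulrC ler_pdivrMr ?powR_gt0.
Qed.

(** Pointwise, [|u| ^ alpha] is at most [|u| ^ q] or [|u| ^ p], according to whether [|u| <= 1].
    With Poincaré's inequality this will keep the n-quotient away from zero. *)
Lemma int_pow_interp (q alpha : R) w : 0 < q -> q <= alpha -> alpha <= p ->
  W1p0 Om p w -> I alpha w <= I q w + I p w.
Proof.
move=> q0 qa ap Ww; have mw := W1p0_measurable Ww.
have a0 : 0 < alpha by rewrite (lt_le_trans q0).
have pg' := ltW pg.
have ag : alpha <= gam by rewrite (le_trans ap).
have qg : q <= gam by rewrite (le_trans qa).
suff : (eint_pow Om alpha w <= eint_pow Om q w + eint_pow Om p w)%E.
  by rewrite (eint_pow_fin a0 ag Ww) (eint_pow_fin q0 qg Ww) (eint_pow_fin p0 pg' Ww).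
rewrite /eint_pow -ge0_integralD//;
  try exact: measurable_normr_powR.
apply: ge0_le_integral => //; try exact: measurable_normr_powR.
  by apply: emeasurable_funD; exact: measurable_normr_powR.
move=> x _; rewrite -EFinD lee_fin.
have [u1|u1] := leP `|w.1 x| 1.
  have [->|u0] := eqVneq (w.1 x) 0.
    by rewrite normr0 !powR0 ?gt_eqF ?addr0.
  rewrite -[leLHS]addr0 lerD ?powR_ge0//.
  by apply: ger_powR => //; rewrite normr_gt0 u0.
rewrite -[leLHS]add0r lerD ?powR_ge0//.
by apply: ler_powR => //; exact: ltW.
Qed.

End sobolev_inequalities.

(** * Test functions that do not vanish *)

Section flat_function.
Context (R : realType).
Implicit Types (P : {poly R}) (x y : R).

(** Multiplying by the variable turns the bound for [k + 1] into the bound for [k], hence the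
    induction on the polynomial treats all [k] at once; the leftover constant is handled by
    [y ^ k / k! <= expR y]. *)
Lemma horner_expRN_le P k : exists2 C : R, 0 <= C &
  forall y, 0 < y -> `|P.[y]| * expR (- y) <= C / y ^+ k.
Proof.
elim/poly_ind: P k => [|P c IH] k.
  by exists 0 => // y y0; rewrite horner0 normr0 !mul0r.
have [C C0 hC] := IH k.+1.
have k0 : 0 < k.+1`!%:R :> R by rewrite ltr0n fact_gt0.
have [D D0 hD] : exists2 D : R, 0 <= D & forall y, 0 < y -> expR (- y) <= D / y ^+ k.
  exists k`!%:R => // y y0; rewrite expRN ler_pdivlMr ?exprn_gt0// mulrC ler_pdivrMr ?expR_gt0//.
  case: k {IH hC k0} => [|k].
    by rewrite expr0 fact0 mul1r (le_trans _ (expR_ge1Dx y))// lerDl ltW.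
  have k0 : 0 < k.+1`!%:R :> R by rewrite ltr0n fact_gt0.
  rewrite mulrC -ler_pdivrMr//; apply: le_trans (expR_ge1Dxn k (ltW y0)).
  by rewrite lerDr.
exists (C + `|c| * D); first by rewrite addr_ge0// mulr_ge0.
move=> y y0; rewrite !hornerE.
apply: (@le_trans _ _ ((`|P.[y]| * y + `|c|) * expR (- y))).
  rewrite ler_wpM2r ?expR_ge0// (le_trans (ler_normD _ _))//.
  by rewrite normrM (gtr0_norm y0).
rewrite [leLHS]mulrDl [leRHS]mulrDl lerD//.
  rewrite mulrAC (_ : C / y ^+ k = C / y ^+ k.+1 * y).
    by rewrite ler_pM2r//; exact: hC.
  by rewrite exprS invfM mulrA mulrAC mulfVK ?gt_eqF // mulrAC.
by rewrite -mulrA ler_wpM2l//; exact: hD.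
Qed.

(* Closed under differentiation: the derivative of [flat P] is
   [flat ('X^2 * (P - P^`()))]. *)
Definition flat P x : R := if 0 < x then P.[x^-1] * expR (- x^-1) else 0.

Lemma flat_le_sqr P : exists2 C : R, 0 <= C & forall x, `|flat P x| <= C * x ^+ 2.
Proof.
have [C C0 hC] := horner_expRN_le P 2; exists C => // x.
rewrite /flat; case: ifPn => [x0|_]; last by rewrite normr0 mulr_ge0// sqr_ge0.
have := hC x^-1; rewrite invr_gt0 => /(_ x0).
by rewrite normrM (ger0_norm (expR_ge0 _)) exprVn invrK.
Qed.

Lemma is_derive_flat P x : is_derive x 1 (flat P) (flat ('X^2 * (P - P^`())) x).
Proof.
have [x0|x0|->] := ltgtP x 0.
- rewrite {2}/flat ltNge (ltW x0)/=.
  apply: (@near_eq_is_derive R R R (cst 0) _ x 1 0).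
  near=> y; rewrite /flat ltNge (_ : y <= 0)//.
  by apply: ltW; near: y; exact: lt_nbhsl.
- rewrite {2}/flat x0.
  apply: (@near_eq_is_derive R R R (fun y => P.[y^-1] * expR (- y^-1)) _ x 1).
    near=> y; rewrite /flat (_ : 0 < y)//.
    by near: y; exact: lt_nbhsr.
  have xn0 : x != 0 by rewrite gt_eqF.
  have dV : is_derive x 1 (fun y : R => y^-1) (- x ^- 2).
    by have := @is_deriveV _ id x 1 1 xn0 (is_derive_id _ _); rewrite /= [_ *: 1]mulr1.
  have dP : is_derive x 1 (fun y : R => P.[y^-1]) (P^`().[x^-1] * - x ^- 2).
    exact: (@is_derive1_comp _ (horner P) _ x _ _ (is_derive_poly P x^-1) dV).
  have dN : is_derive x 1 (fun y : R => - y^-1) (x ^- 2).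
    by have := is_deriveN dV; rewrite opprK.
  have dE : is_derive x 1 (fun y : R => expR (- y^-1)) (expR (- x^-1) * x ^- 2).
    exact: (@is_derive1_comp _ expR _ x _ _ (is_derive_expR (- x^-1)) dN).
  apply: is_derive_eq (is_deriveM dP dE) _.
  by rewrite !hornerE /GRing.scale /=; field.
- rewrite {2}/flat ltxx.
  (* The quadratic bound makes the difference quotient at 0 tend to 0. *)
  have [C C0 hC] := flat_le_sqr P.
  have f0 : flat P 0 = 0 by rewrite /flat ltxx.
  have c : h^-1 *: ((flat P \o shift 0) (h *: 1) - flat P 0) @[h --> 0^'] --> (0 : R).
    apply/cvgrPdist_lt => e e0; near=> h.
    rewrite sub0r normrN f0 subr0 /= addr0 [h *: 1]mulr1 normrM normfV.
    have hn0 : h != 0 by near: h; exact: nbhs_dnbhs_neq.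
    rewrite mulrC ltr_pdivrMr ?normr_gt0//; apply: (le_lt_trans (hC h)).
    rewrite -real_normK ?num_real// expr2 mulrA ltr_pM2r ?normr_gt0//.
    apply: (@le_lt_trans _ _ ((C + 1) * `|h|)).
      by rewrite ler_wpM2r// lerDl.
    rewrite mulrC -ltr_pdivlMr ?ltr_wpDl//.
    by near: h; apply: dnbhs0_lt; rewrite divr_gt0// ltr_wpDl.
  by split; [apply/cvg_ex; exists 0|exact: cvg_lim c].
Unshelve. all: by end_near. Qed.

Lemma flat1_gt0 x : (0 < flat 1 x) = (0 < x).
Proof.
by rewrite /flat; case: ifPn; rewrite ?ltxx// hornerC mul1r expR_gt0.
Qed.

Lemma flat1_ge0 x : 0 <= flat 1 x.
Proof. by rewrite /flat; case: ifPn => // _; rewrite hornerC mul1r expR_ge0. Qed.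

End flat_function.

Section smooth_closure.
Context (R : realType) (N : nat).
Implicit Types (F G : 'rV[R]_N -> R) (f : R -> R).
Local Notation e_ i := (delta_mx ord0 i : 'rV[R]_N).

(** [smooth] speaks of words of partial derivatives of one function, which offers no induction for
    products. Here the order is the recursion variable, and an induction hypothesis covers all
    functions of lower order. *)
Fixpoint Ck (n : nat) F : Prop :=
  if n is m.+1 then continuous F /\ forall i, (forall x, derivable F x (e_ i)) /\ Ck m (partial i F)
  else continuous F.

Lemma Ck_continuous n F : Ck n F -> continuous F.
Proof. by case: n => [//|n []]. Qed.

Lemma CkW n F : Ck n.+1 F -> Ck n F.
Proof.
elim: n F => [|n IH] F [cF dF]; first by [].
split => // i; have [d /IH] := dF i; by [].
Qed.

Lemma smoothP F : smooth F <-> forall n, Ck n F.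
Proof.
split=> [sF n|CF].
  elim: n F sF => [|n IH] F sF; first exact: smooth_continuous.
  split; first exact: smooth_continuous.
  move=> i; split; first by move=> x; exact: smooth_derivable.
  by apply: IH; exact: smooth_partial.
(* [foldr] applies the last index of the word first, so the word is consumed from its end. *)
move=> s; have := CF (size s).+1; elim/last_ind: s F {CF} => [|s i IH] F.
  by move=> [cF dF]; split => // i; have [] := dF i.
by rewrite size_rcons foldr_rcons => -[_ /(_ i)[_ /IH]].
Qed.

Lemma CkD n F G : Ck n F -> Ck n G -> Ck n (fun x => F x + G x).
Proof.
elim: n F G => [|n IH] F G.
  by move=> cF cG x; apply: (@continuousD _ _ _ F G x); [exact: cF|exact: cG].
move=> [cF dF] [cG dG]; split.
  by move=> x; apply: (@continuousD _ _ _ F G x); [exact: cF|exact: cG].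
move=> i; have [dFi CF] := dF i; have [dGi CG] := dG i; split.
  by move=> x; apply: (@derivableD _ _ _ F G x); [exact: dFi|exact: dGi].
rewrite (_ : partial i _ = (fun x => partial i F x + partial i G x)); first exact: IH.
by apply/funext => x; rewrite /partial (_ : (fun _ => _) = F + G)// deriveD.
Qed.

Lemma partialM F G i x : derivable F x (e_ i) -> derivable G x (e_ i) ->
  partial i (fun y => F y * G y) x = F x * partial i G x + G x * partial i F x.
Proof. by move=> dF dG; rewrite /partial (_ : (fun _ => _) = F * G)// deriveM. Qed.

Lemma CkM n F G : Ck n F -> Ck n G -> Ck n (fun x => F x * G x).
Proof.
elim: n F G => [|n IH] F G.
  by move=> cF cG x; apply: (@continuousM _ _ F G x); [exact: cF|exact: cG].
move=> CF CG; have [cF dF] := CF; have [cG dG] := CG; split.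
  by move=> x; apply: (@continuousM _ _ F G x); [exact: cF|exact: cG].
move=> i; have [dFi CFi] := dF i; have [dGi CGi] := dG i; split.
  by move=> x; apply: (@derivableM _ _ F G x); [exact: dFi|exact: dGi].
rewrite (_ : partial i _ = (fun x => F x * partial i G x + G x * partial i F x)).
  by apply: CkD; apply: IH => //; exact: CkW.
by apply/funext => x; rewrite partialM.
Qed.

Lemma Ck_cst n (c : R) : Ck n (fun=> c).
Proof.
elim: n c => [|n IH] c; first by move=> x; exact: cst_continuous.
split; first by move=> x; exact: cst_continuous.
move=> i; split; first by move=> x; exact: derivable_cst.
rewrite (_ : partial i _ = fun=> 0); first exact: IH.
by apply/funext => x; rewrite /partial derive_cst.
Qed.

Lemma smoothM F G : smooth F -> smooth G -> smooth (fun x => F x * G x).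
Proof. by move=> /smoothP cF /smoothP cG; apply/smoothP => n; exact: CkM. Qed.

Lemma smooth_cst (c : R) : smooth (fun _ : 'rV[R]_N => c).
Proof. by apply/smoothP => n; exact: Ck_cst. Qed.

Lemma smooth_prod (I : eqType) (s : seq I) (F : I -> 'rV[R]_N -> R) :
  (forall i, smooth (F i)) -> smooth (fun x => \prod_(i <- s) F i x).
Proof.
move=> sF; elim: s => [|i s IH].
  by under eq_fun do rewrite big_nil; exact: smooth_cst.
by under eq_fun do rewrite big_cons; exact: smoothM.
Qed.

Lemma is_derive_coord (f f' : R -> R) (c d : R) (j i : 'I_N) (x : 'rV[R]_N) :
  (forall y : R, is_derive y 1 f (f' y)) ->
  is_derive x (e_ i) (fun v : 'rV[R]_N => f (c * v ord0 j + d))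
    ((c * (j == i)%:R) * f' (c * x ord0 j + d)).
Proof.
move=> df; set k := c * (j == i)%:R.
pose g t := f (k * t + (c * x ord0 j + d)).
have dg : is_derive (0 : R) 1 g (k * f' (c * x ord0 j + d)).
  have da : is_derive (0 : R) 1 (fun t : R => k * t + (c * x ord0 j + d)) k.
    rewrite (_ : (fun _ => _) = k *: (id : R -> R) + cst (c * x ord0 j + d))//.
    by apply: is_derive_eq; rewrite addr0 [_ *: _]mulr1.
  have := @is_derive1_comp _ f (fun t : R => k * t + (c * x ord0 j + d)) 0 _ k _ da.
  by rewrite mulr0 add0r [k * f' _]mulrC; apply; exact: df.
have E : (fun h => h^-1 *: (((fun v : 'rV[R]_N => f (c * v ord0 j + d)) \o shift x) (h *: e_ i)
      - f (c * x ord0 j + d))) =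
   (fun h => h^-1 *: ((g \o shift 0) (h *: 1) - g 0)).
  apply/funext => h /=; rewrite /g !mxE eqxx/= mulr0 add0r addr0; congr (_ *: (f _ - _)).
  by rewrite [h *: 1]mulr1 /k; ring.
have [d1 d2] := dg.
by split; [rewrite /derivable E | rewrite /derive E].
Qed.

(** The induction closes because a derivative of [flat P] is again some [flat], up to a constant
    factor. *)
Lemma Ck_flat n P (c d : R) (j : 'I_N) :
  Ck n (fun v : 'rV[R]_N => flat P (c * v ord0 j + d)).
Proof.
elim: n P => [|n IH] P.
  move=> x; have cf : {for c * x ord0 j + d, continuous (flat P)}.
    apply: differentiable_continuous; apply/derivable1_diffP.
    by have [] := is_derive_flat P (c * x ord0 j + d).
  apply: (@continuous_comp _ _ _ (fun v : 'rV[R]_N => c * v ord0 j + d) (flat P)) => //.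
  apply: (@continuousD _ _ _ (fun v : 'rV[R]_N => c * v ord0 j) (cst d)).
    apply: (@continuousM _ _ (cst c) (fun v : 'rV[R]_N => v ord0 j)).
      exact: cst_continuous.
    exact: coord_continuous.
  exact: cst_continuous.
split; first exact: Ck_continuous (IH P).
move=> i; have D x := is_derive_coord c d j i x (is_derive_flat P); split.
  by move=> x; have [] := D x.
rewrite (_ : partial i _ = fun x => (c * (j == i)%:R) *
    flat ('X^2 * (P - P^`())) (c * x ord0 j + d)).
  by apply: CkM; [exact: Ck_cst|exact: IH].
by apply/funext => x; have [_] := D x.
Qed.

Lemma smooth_flat P (c d : R) (j : 'I_N) :
  smooth (fun v : 'rV[R]_N => flat P (c * v ord0 j + d)).
Proof. by apply/smoothP => n; exact: Ck_flat. Qed.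

End smooth_closure.

(** * Integration by parts and a nonzero test function *)

Section bump.
Context (R : realType) (N : nat) (Om : set 'rV[R]_N) (p : R).
Hypotheses (oOm : open Om) (bOm : bounded_set Om) (p1 : 1 < p).
Implicit Types (phi psi : 'rV[R]_N -> R).
Local Notation e_ i := (delta_mx ord0 i : 'rV[R]_N).
Local Notation mu := (lebesgue_rV R N).

Let mOm : measurable Om := open_measurable_rV oOm.
Let p0 : 0 < p. Proof. by rewrite (lt_trans _ p1). Qed.

Lemma test_function_measurable phi : test_function Om phi -> measurable_fun setT phi.
Proof. by case=> sphi _ _; apply: continuous_measurable_rV; exact: smooth_continuous. Qed.

Lemma test_function_integrable phi : test_function Om phi ->
  mu.-integrable setT (EFin \o phi).
Proof.
move=> tphi; have [M M0 hM] := test_function_bounded tphi.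
have Ooo : (mu Om < +oo)%E by exact: bounded_set_lty.
apply: (@le_integrable _ _ _ mu setT measurableT (EFin \o phi)
  (fun x => (M * \1_Om x)%:E)); last exact: integrable_cst_indic.
  by apply/measurable_EFinP; exact: test_function_measurable.
move=> x _; rewrite lee_fin /= [leRHS]ger0_norm ?mulr_ge0//.
rewrite indicE; case: (boolP (x \in Om)) => [_|]; first by rewrite mulr1.
by rewrite notin_setE => /(test_function_out tphi) ->; rewrite normr0 mulr0.
Qed.

Lemma integral_shift_signed (f : 'rV[R]_N -> \bar R) (y : 'rV[R]_N) :
  measurable_fun setT f ->
  (\int[mu]_x f (x + y)%R = \int[mu]_x f x)%E.
Proof.
move=> mf; rewrite integralE [RHS]integralE; congr (_ - _)%E.
  rewrite -(integral_rV_shift y (measurable_funepos mf))//.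
  by apply: eq_integral => x _; rewrite !funeposE.
rewrite -(integral_rV_shift y (measurable_funeneg mf))//.
by apply: eq_integral => x _; rewrite !funenegE.
Qed.

(** Every difference quotient has integral zero by translation invariance; dominated convergence
    passes to the derivative. *)
Lemma integral_partial_eq0 phi (i : 'I_N) : test_function Om phi ->
  (\int[mu]_x (partial i phi x)%:E = 0)%E.
Proof.
move=> tphi; have [M [A [M0 mA Aoo MA]]] := quotient_bound i tphi ler01.
have sphi : smooth phi by case: tphi.
have mphi := test_function_measurable tphi.
have mEphi : measurable_fun setT (EFin \o phi) by exact/measurable_EFinP.
have iphi := test_function_integrable tphi.
pose hn n : R := n.+1%:R^-1.
have hn0 n : 0 < hn n by rewrite invr_gt0.
have hn1 n : hn n <= 1 by rewrite invf_le1// ler1n.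
have hnc : hn n @[n --> \oo] --> 0 by exact: cvg_harmonic.
pose G n x := (hn n)^-1 * (phi (x + hn n *: e_ i) - phi x).
have mG n : measurable_fun setT (G n).
  by apply: measurable_funM => //; exact: measurable_shift_diff.
have G0 n : (\int[mu]_x (G n x)%:E = 0)%E.
  have ishift : mu.-integrable setT (EFin \o (fun x => phi (x + hn n *: e_ i))).
    apply/integrableP; split.
      apply/measurable_EFinP.
      by apply: (measurableT_comp mphi); exact: measurable_rV_shift.
    have := iphi => /integrableP[_]; apply: le_lt_trans.
    rewrite (integral_rV_shift (hn n *: e_ i) (f := fun x => `|(phi x)%:E|%E))//.
    exact: measurableT_comp.
  rewrite (eq_integral (fun x => ((hn n)^-1)%:E *
      ((EFin \o (fun x => phi (x + hn n *: e_ i)%R)) x - (EFin \o phi) x))%E); last first.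
    by move=> x _; rewrite /= -EFinB -EFinM.
  rewrite integralZl//; last exact: integrableB.
  rewrite integralB// (integral_shift_signed _ mEphi) subee ?mule0//.
  exact: integrable_fin_num.
have [] := @dominated_convergence _ _ _ mu setT measurableT
    (fun n x => (G n x)%:E) (fun x => (partial i phi x)%:E)
    (fun x => (M * \1_A x)%:E).
- by move=> n; exact/measurable_EFinP.
- apply/measurable_EFinP; apply: test_function_measurable.
  exact: test_function_partial.
- apply: aeW => x _; apply: cvg_EFin; first exact: nearW.
  by apply: cvg_line => // n; rewrite gt_eqF.
- exact: integrable_cst_indic.
- by apply: aeW => x n _ /=; rewrite lee_fin; exact: MA.
move=> _ _ c; apply: cvg_unique c _; first exact: ereal_hausdorff.
by rewrite /= (_ : (fun n => _) = cst 0%E); [exact: cvg_cst|exact/funext/G0].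
Qed.

Lemma test_functionM phi psi : test_function Om phi -> test_function Om psi ->
  test_function Om (fun x => phi x * psi x).
Proof.
move=> [sphi cphi Ophi] [spsi _ _].
have sub : closure [set x | phi x * psi x != 0] `<=` closure [set x | phi x != 0].
  by apply: closure_subset => x /=; rewrite mulf_eq0 negb_or => /andP[].
split; first exact: smoothM.
- by apply: subclosed_compact cphi sub; exact: closed_closure.
- exact: subset_trans Ophi.
Qed.

(** The product [phi psi] is again a test function, so the integral of its partial derivative
    vanishes. *)
Lemma integration_by_parts phi psi (i : 'I_N) :
  test_function Om phi -> test_function Om psi ->
  \int[mu]_(x in Om) (phi x * partial i psi x) =
  - \int[mu]_(x in Om) (partial i phi x * psi x).
Proof.
move=> tphi tpsi; have tdphi := test_function_partial i tphi.
have tdpsi := test_function_partial i tpsi.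
have i1 : mu.-integrable Om (EFin \o (fun x => phi x * partial i psi x)).
  by apply: integrableS (test_function_integrable (test_functionM tphi tdpsi)).
have i2 : mu.-integrable Om (EFin \o (fun x => partial i phi x * psi x)).
  by apply: integrableS (test_function_integrable (test_functionM tdphi tpsi)).
apply/eqP; rewrite -addr_eq0 -RintegralD//; apply/eqP.
rewrite /Rintegral integral_mkcond.
rewrite (eq_integral (fun x => (partial i (fun y => phi y * psi y) x)%:E)); last first.
  move=> x _; rewrite patchE; case: (boolP (x \in Om)) => [_|].
    rewrite partialM; first by rewrite [psi x * _]mulrC.
      by apply: smooth_derivable; case: tphi.
    by apply: smooth_derivable; case: tpsi.
  rewrite notin_setE => Ox.
  have tM := test_function_partial i (test_functionM tphi tpsi).
  by rewrite (test_function_out tM Ox).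
by rewrite (integral_partial_eq0 i (test_functionM tphi tpsi)).
Qed.

Lemma test_function_Lp phi : test_function Om phi -> is_Lp Om p phi.
Proof.
move=> tphi.
have mphi : measurable_fun Om phi.
  by apply: measurable_funTS; exact: test_function_measurable.
have [M M0 hM] := test_function_bounded tphi.
split => //.
apply: (@le_lt_trans _ _ (\int[mu]_(x in Om) (M `^ p)%:E)%E).
  apply: ge0_le_integral => //.
    exact: measurable_normr_powR.
  by move=> x _; rewrite lee_fin; apply: powR_homo => //; exact: ltW.
by rewrite integral_cst// lte_mul_pinfty ?lee_fin ?powR_ge0//; exact: bounded_set_lty.
Qed.

Lemma test_function_W1p0 phi : test_function Om phi ->
  W1p0 Om p ((phi, gradient phi) : sobolev_pair R N).
Proof.
move=> tphi; split; first split => /=.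
- exact: test_function_Lp.
- move=> i; suff -> : (fun x => gradient phi x ord0 i) = partial i phi.
    by apply: test_function_Lp; exact: test_function_partial.
  by apply/funext => x; rewrite mxE.
- move=> psi tpsi i; under [in RHS]eq_Rintegral do rewrite mxE.
  exact: integration_by_parts.
move=> e e0; exists phi => //=.
rewrite integral0_eq ?add0e; last by move=> x _; rewrite subrr normr0 powR0// gt_eqF.
rewrite integral0_eq ?lte_fin// => x _.
by rewrite subrr -(scale0r 0) enormZ normr0 mul0r powR0// gt_eqF.
Qed.

(** Over an empty set the infima would be [+oo]. The witness is a product of one-dimensional bumps,
    positive exactly on an open cube. *)
Lemma W1p0_nz_nonempty : Om !=set0 -> W1p0_nz Om p !=set0.
Proof.
move=> [z Oz]; have /nbhs_ballP[e /= e0 eO] : nbhs z Om by exact: open_nbhs_nbhs.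
(* Half the radius, so that the closed cube still lies in [Om]. *)
pose r := e / 2; have r0 : 0 < r by rewrite divr_gt0.
have re : r < e by rewrite /r ltr_pdivrMr// ltr_pMr// ltr1n.
pose phi (x : 'rV[R]_N) : R := \prod_(j <- index_enum 'I_N)
  (flat 1 (1 * x ord0 j + (r - z ord0 j)) * flat 1 (-1 * x ord0 j + (z ord0 j + r))).
have phin0 x : phi x != 0 -> forall j, `|z ord0 j - x ord0 j| < r.
  move=> px j; move: px; rewrite /phi prodf_seq_neq0 => /allP /(_ j).
  rewrite mem_index_enum => /(_ isT) /=; rewrite mulf_eq0 negb_or => /andP.
  have F u : flat 1 u != 0 -> 0 < u.
    by rewrite -flat1_gt0 lt0r flat1_ge0 => ->.
  by move=> [/F ? /F ?]; rewrite ltr_norml; apply/andP; split; lra.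
have phigt0 (x : 'rV[R]_N) : (forall j, `|z ord0 j - x ord0 j| < r) -> 0 < phi x.
  move=> xz; apply: prodr_gt0 => j _; rewrite mulr_gt0// flat1_gt0.
    by have := xz j; rewrite ltr_norml => /andP[? ?]; lra.
  by have := xz j; rewrite ltr_norml => /andP[? ?]; lra.
have tphi : test_function Om phi.
  pose K := [set x : 'rV[R]_N | forall i, `[z ord0 i - r, z ord0 i + r]%classic (x ord0 i)].
  have cK : compact K.
    apply: (rV_compact (A := fun i => `[z ord0 i - r, z ord0 i + r]%classic)) => i.
    exact: segment_compact.
  have sK : closure [set x | phi x != 0] `<=` K.
    rewrite [K](closure_id _).1; last by apply: compact_closed => //; exact: norm_hausdorff.
    apply: closure_subset => x /= /phin0 h i /=; have := h i.
    by rewrite in_itv/= ltr_norml => /andP[? ?]; apply/andP; split; lra.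
  have KO : K `<=` Om.
    move=> x Kx; apply: eO; rewrite -ball_normE /= /ball_.
    rewrite [ltLHS]/Num.norm/= mx_normrE; apply/bigmax_ltP; split=> // -[u i] _ /=.
    rewrite (ord1 u) !mxE; apply: le_lt_trans re.
    have := Kx i; rewrite /= in_itv/= => /andP[? ?].
    by rewrite ler_norml; apply/andP; split; lra.
  split.
  - by apply: smooth_prod => j; apply: smoothM; exact: smooth_flat.
  - by apply: subclosed_compact cK sK; exact: closed_closure.
  - exact: subset_trans KO.
exists ((phi, gradient phi) : sobolev_pair R N); split; first exact: test_function_W1p0.
move=> [A [mA A0 sA]].
(* A box of positive volume on which [phi > 0]; the exceptional set [A] must contain it,
   contradicting its measure zero. *)
pose B : set 'rV[R]_N := rV_box (fun i => z ord0 i - r / 2) (fun i => z ord0 i + r / 2).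
have BA : B `<=` A.
  move=> x Bx; apply: sA => /= h.
  have px : 0 < phi x.
    apply: phigt0 => j; have := Bx j => /andP[? ?].
    by rewrite ltr_norml; apply/andP; split; lra.
  have Ox : Om x.
    by apply: contrapT => /(test_function_out tphi) E; move: px; rewrite E ltxx.
  by have := h Ox; move: px => /[swap] /= ->; rewrite ltxx.
have : (mu B <= 0)%E by rewrite -A0; apply: le_measure; rewrite ?inE//; exact: measurable_rV_box.
rewrite lebesgue_rV_box; last by move=> i; lra.
rewrite lee_fin leNgt => /negP; apply; apply: prodr_gt0 => i _.
by rewrite opprB addrA; lra.
Qed.

End bump.

(** * Fibres *)

Section concave.
Context (R : realType) (g g' : R -> R).
Hypothesis dg : forall s : R, is_derive s 1 g (g' s).

Lemma is_derive_continuous : continuous g.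
Proof.
move=> s; apply: differentiable_continuous; apply/derivable1_diffP.
by apply: ex_derive; exact: dg.
Qed.

Lemma is_derive_MVT x y : x < y ->
  exists2 c, x < c < y & g y - g x = g' c * (y - x).
Proof.
move=> xy; have [|c] := MVT xy (fun s _ => dg s).
  exact/continuous_subspaceT/is_derive_continuous.
by rewrite in_itv /= => xcy E; exists c.
Qed.

Lemma derive_lb x y d : x <= y -> (forall s, x <= s <= y -> d <= g' s) ->
  d * (y - x) <= g y - g x.
Proof.
rewrite le_eqVlt => /predU1P[->|xy] dg'; first by rewrite !subrr mulr0.
have [c /andP[xc cy] ->] := is_derive_MVT xy.
by rewrite ler_pM2r ?subr_gt0//; apply: dg'; rewrite !ltW.
Qed.

Lemma derive_ub x y d : x <= y -> (forall s, x <= s <= y -> g' s <= d) ->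
  g y - g x <= d * (y - x).
Proof.
rewrite le_eqVlt => /predU1P[->|xy] dg'; first by rewrite !subrr mulr0.
have [c /andP[xc cy] ->] := is_derive_MVT xy.
by rewrite ler_pM2r ?subr_gt0//; apply: dg'; rewrite !ltW.
Qed.

Lemma IVT_sign x y : x <= y -> g x * g y <= 0 -> exists2 c, x <= c <= y & g c = 0.
Proof.
move=> xy gxy; have [||c] := @IVT R g x y 0 xy.
- exact/continuous_subspaceT/is_derive_continuous.
- rewrite ge_min le_max; case: (lerP (g x) 0) => gx /=.
    by case: (lerP 0 (g y)) => gy; rewrite ?orbT //=; nra.
  by case: (lerP (g y) 0) => gy; rewrite ?orbT //=; nra.
- by rewrite in_itv /= => xcy E; exists c.
Qed.

Hypothesis g'_decr : forall x y, x < y -> g' y < g' x.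

Lemma concave_tangent_lt x y : x < y -> g y - g x < g' x * (y - x).
Proof.
move=> xy; have [c /andP[xc cy] ->] := is_derive_MVT xy.
by rewrite ltr_pM2r ?subr_gt0//; exact: g'_decr.
Qed.

Lemma concave_tangent_gt x y : x < y -> g' y * (y - x) < g y - g x.
Proof.
move=> xy; have [c /andP[xc cy] ->] := is_derive_MVT xy.
by rewrite ltr_pM2r ?subr_gt0//; exact: g'_decr.
Qed.

(** Intermediate values give the zeros. Between two points the graph stays strictly below its
    tangents, so a zero at [s1] followed by a positive value at [s0] forces [g' s1 > 0], and
    symmetrically at [s2]. *)
Lemma concave_zeros s0 l r : l < s0 < r -> g l < 0 -> 0 < g s0 -> g r < 0 ->
  exists s1 s2, [/\ s1 < s0 < s2, g s1 = 0 /\ 0 < g' s1, g s2 = 0 /\ g' s2 < 0 &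
    forall s, s1 <= s <= s0 -> 0 <= g s].
Proof.
move=> /andP[ls sr] gl gs gr.
have [|s1 /andP[ls1 s1s] g1] := IVT_sign (ltW ls); first by nra.
have [|s2 /andP[ss2 s2r] g2] := IVT_sign (ltW sr); first by nra.
have s10 : s1 < s0 by rewrite lt_neqAle s1s andbT; apply/eqP => E; rewrite E in g1; lra.
have s02 : s0 < s2 by rewrite lt_neqAle ss2 andbT; apply/eqP => E; rewrite -E in g2; lra.
have g'1 : 0 < g' s1.
  have := concave_tangent_lt s10; rewrite g1 subr0 => H.
  by rewrite -(pmulr_lgt0 _ (_ : 0 < s0 - s1)) ?subr_gt0//; lra.
exists s1, s2; split; first by rewrite s10.
- by split.
- split=> //; have := concave_tangent_gt s02; rewrite g2 sub0r => H.
  by rewrite -(pmulr_llt0 _ (_ : 0 < s2 - s0)) ?subr_gt0//; lra.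
- move=> s /andP[]; rewrite le_eqVlt => /predU1P[<-|s1s']; first by rewrite g1.
  rewrite le_eqVlt => /predU1P[->|ss0]; first exact: ltW.
  rewrite leNgt; apply/negP => gs0.
  have := concave_tangent_gt s1s'; rewrite g1 subr0.
  have := concave_tangent_lt ss0.
  have : 0 < s0 - s by rewrite subr_gt0.
  have : 0 < s - s1 by rewrite subr_gt0.
  case: (lerP 0 (g' s)); nra.
Qed.

End concave.

(** * Sums of three exponentials *)

Section trinomial.
Context (R : realType) (m1 m2 m3 : R).
Hypotheses (m10 : 0 < m1) (m20 : 0 < m2) (m13 : m1 < m3).

(** The shape of both fibres in the variable [s], with exponents counted from [alpha].
    Differentiation preserves it, multiplying the coefficients and flipping the sign of [b]. *)
Definition tri (a b c s : R) : R :=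
  a * expR (m1 * s) + b * expR (- m2 * s) - c * expR (m3 * s).

Lemma tri0 a b c : tri a b c 0 = a + b - c.
Proof. by rewrite /tri !mulr0 expR0 !mulr1. Qed.

Lemma is_derive_expRM (k x : R) :
  is_derive x 1 (fun y : R => expR (k * y)) (k * expR (k * x)).
Proof.
have dk : is_derive x 1 (fun y : R => k * y) k.
  rewrite (_ : (fun _ => _) = k *: (id : R -> R))//.
  by apply: is_derive_eq; rewrite [_ *: _]mulr1.
rewrite mulrC; exact: (@is_derive1_comp _ expR _ x _ _ (is_derive_expR (k * x)) dk).
Qed.

Lemma is_derive_tri (a b c x : R) :
  is_derive x 1 (tri a b c) (tri (m1 * a) (- (m2 * b)) (m3 * c) x).
Proof.
have h1 := is_deriveZ a (is_derive_expRM m1 x).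
have h2 := is_deriveZ b (is_derive_expRM (- m2) x).
have h3 := is_deriveZ c (is_derive_expRM m3 x).
apply: is_derive_eq (is_deriveB (is_deriveD h1 h2) h3) _.
rewrite /tri /GRing.scale /=; ring.
Qed.

Let cn (a b c s : R) := a - b * expR (- (m1 + m2) * s) - c * expR ((m3 - m1) * s).

Let cn' (b c s : R) :=
  (m1 + m2) * b * expR (- (m1 + m2) * s) - (m3 - m1) * c * expR ((m3 - m1) * s).

Let dcn (a b c x : R) : is_derive x 1 (cn a b c) (cn' b c x).
Proof.
have h1 := is_deriveZ b (is_derive_expRM (- (m1 + m2)) x).
have h2 := is_deriveZ c (is_derive_expRM (m3 - m1) x).
apply: is_derive_eq (is_deriveB (is_deriveB (is_derive_cst a x 1) h1) h2) _.
rewrite /cn' /GRing.scale /=; ring.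
Qed.

Let cn'_decr (b c x y : R) : 0 < b -> 0 < c -> x < y -> cn' b c y < cn' b c x.
Proof.
move=> b0 c0 xy; rewrite /cn' ltrB//; rewrite ltr_pM2l ?mulr_gt0 ?subr_gt0 ?addr_gt0//.
- by rewrite ltr_expR !mulNr ltrN2 ltr_pM2l ?addr_gt0.
- by rewrite ltr_expR ltr_pM2l ?subr_gt0.
Qed.

Let tri_cn (a b c s : R) : tri a (- b) c s = expR (m1 * s) * cn a b c s.
Proof.
rewrite /tri /cn !mulrBr [_ * (b * _)]mulrCA [_ * (c * _)]mulrCA -!expRD.
by rewrite [_ * a]mulrC mulNr; congr (_ - _ * expR _ - _ * expR _); ring.
Qed.

(** At a zero of [cn] the first summand drops out, so there the derivative of [tri a (- b) c] has
    the sign of [cn']. *)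
Let dtri_cn (a b c s : R) : tri (m1 * a) (m2 * b) (m3 * c) s =
  m1 * (expR (m1 * s) * cn a b c s) + expR (m1 * s) * cn' b c s.
Proof.
have e2 : expR (- m2 * s) = expR (m1 * s) * expR (- (m1 + m2) * s).
  by rewrite -expRD; congr expR; ring.
have e3 : expR (m3 * s) = expR (m1 * s) * expR ((m3 - m1) * s).
  by rewrite -expRD; congr expR; ring.
by rewrite /tri /cn /cn' e2 e3; ring.
Qed.

Lemma tri_zeros (a b c s0 : R) : 0 < a -> 0 < b -> 0 < c -> 0 < tri a (- b) c s0 ->
  exists s1 s2, [/\ s1 < s0 < s2,
    tri a (- b) c s1 = 0 /\ 0 < tri (m1 * a) (m2 * b) (m3 * c) s1,
    tri a (- b) c s2 = 0 /\ tri (m1 * a) (m2 * b) (m3 * c) s2 < 0 &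
    forall s, s1 <= s <= s0 -> 0 <= tri a (- b) c s].
Proof.
move=> a0 b0 c0; rewrite tri_cn pmulr_rgt0 ?expR_gt0// => g0.
have [sg ta] : 0 < m1 + m2 /\ 0 < m3 - m1 by split; [rewrite addr_gt0|rewrite subr_gt0].
have [l ls gl] : exists2 l, l < s0 & cn a b c l < 0.
  (* By [1 + x <= expR x], this [w] makes [b * expR ((m1 + m2) * (|s0| + w))] exceed [a]. *)
  have [w wE] : exists w, w = a / (b * (m1 + m2)) by eexists.
  have w0 : 0 < w by rewrite wE divr_gt0 ?mulr_gt0.
  have aE : a = w * (b * (m1 + m2)) by rewrite wE divfK// gt_eqF ?mulr_gt0.
  exists (- (`|s0| + w)); first by have := ler_norm (- s0); rewrite normrN; lra.
  rewrite /cn mulrNN -addrA -opprD subr_lt0.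
  have := mulr_gt0 c0 (expR_gt0 ((m3 - m1) * (- (`|s0| + w)))).
  have := ler_wpM2l (ltW b0) (expR_ge1Dx ((m1 + m2) * (`|s0| + w))).
  have := mulr_ge0 (mulr_ge0 (ltW b0) (ltW sg)) (normr_ge0 s0); lra.
have [r rs gr] : exists2 r, s0 < r & cn a b c r < 0.
  have [w wE] : exists w, w = a / (c * (m3 - m1)) by eexists.
  have w0 : 0 < w by rewrite wE divr_gt0 ?mulr_gt0.
  have aE : a = w * (c * (m3 - m1)) by rewrite wE divfK// gt_eqF ?mulr_gt0.
  exists (`|s0| + w); first by have := ler_norm s0; lra.
  rewrite /cn -addrA -opprD subr_lt0.
  have := mulr_gt0 b0 (expR_gt0 (- (m1 + m2) * (`|s0| + w))).
  have := ler_wpM2l (ltW c0) (expR_ge1Dx ((m3 - m1) * (`|s0| + w))).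
  have := mulr_ge0 (mulr_ge0 (ltW c0) (ltW ta)) (normr_ge0 s0); lra.
have [s1 [s2 [s102 [z1 d1] [z2 d2] pos]]] := concave_zeros (dcn a b c)
  (fun x y => @cn'_decr b c x y b0 c0) (introT andP (conj ls rs)) gl g0 gr.
exists s1, s2; rewrite !tri_cn !dtri_cn z1 z2 !mulr0 !add0r; split => //.
- by rewrite mulr_gt0// expR_gt0.
- by rewrite pmulr_rlt0// expR_gt0.
- by move=> s /pos ?; rewrite tri_cn pmulr_rge0// expR_gt0.
Qed.

(** Past a point where [cn] is negative with negative slope, concavity keeps it decreasing, so no
    zero lies there. *)
Lemma tri_zero_order (a b c s t : R) : 0 < b -> 0 < c ->
  tri a (- b) c s < 0 -> (m1 + m2) * b * expR (- (m1 + m2) * s) <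
     (m3 - m1) * c * expR ((m3 - m1) * s) ->
  tri a (- b) c t = 0 -> t < s.
Proof.
move=> b0 c0; rewrite !tri_cn pmulr_rlt0 ?expR_gt0// => gs lt0 /eqP.
rewrite mulf_eq0 gt_eqF ?expR_gt0//= => /eqP gt.
rewrite ltNge le_eqVlt; apply/negP => /predU1P[E|st]; first by rewrite E gt ltxx in gs.
have := concave_tangent_lt (dcn a b c) (fun x y => @cn'_decr b c x y b0 c0) st.
rewrite gt sub0r; have : cn' b c s < 0 by rewrite subr_lt0.
have : 0 < t - s by rewrite subr_gt0.
nra.
Qed.

Lemma tri_le0_after (a b c s t : R) : 0 < b -> 0 < c ->
  tri a (- b) c t = 0 -> tri (m1 * a) (m2 * b) (m3 * c) t < 0 -> t <= s ->
  tri a (- b) c s <= 0.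
Proof.
move=> b0 c0; rewrite tri_cn dtri_cn => /eqP.
rewrite mulf_eq0 gt_eqF ?expR_gt0//= => /eqP gt; rewrite gt !mulr0 add0r.
rewrite pmulr_rlt0 ?expR_gt0// => g't.
rewrite le_eqVlt => /predU1P[<-|ts]; first by rewrite tri_cn gt mulr0.
have := concave_tangent_lt (dcn a b c) (fun x y => @cn'_decr b c x y b0 c0) ts.
rewrite gt subr0 tri_cn pmulr_rle0 ?expR_gt0//.
have : 0 < s - t by rewrite subr_gt0.
nra.
Qed.

(** On this window only the middle exponential can exceed 1, and it stays below [expR m2]. *)
Lemma tri_bound (a b c s : R) : -1 <= s <= 0 ->
  `|tri a b c s| <= `|a| + `|b| * expR m2 + `|c|.
Proof.
have m30 : 0 < m3 by exact: lt_trans m13.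
move=> /andP[s1 s0]; rewrite /tri (le_trans (ler_normB _ _))// lerD//.
  rewrite (le_trans (ler_normD _ _))// lerD//.
    by rewrite normrM [`|expR _|]ger0_norm ?expR_ge0// ler_piMr// expR_le1 pmulr_rle0.
  rewrite normrM [`|expR _|]ger0_norm ?expR_ge0//; apply: ler_wpM2l => //.
  by rewrite ler_expR mulNr -mulrN ger_pMr//; lra.
by rewrite normrM [`|expR _|]ger0_norm ?expR_ge0// ler_piMr// expR_le1 pmulr_rle0.
Qed.

(** First and second derivatives of [tri a b c]; in the second one the sign of [b] is restored. *)
Definition tri1 (a b c : R) : R -> R := tri (m1 * a) (- (m2 * b)) (m3 * c).
Definition tri2 (a b c : R) : R -> R := tri1 (m1 * a) (- (m2 * b)) (m3 * c).

Lemma tri1_zeros (a b c s0 : R) : 0 < a -> 0 < b -> 0 < c -> 0 < tri1 a b c s0 ->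
  exists s1 s2, [/\ s1 < s0 < s2,
    tri1 a b c s1 = 0 /\ 0 < tri2 a b c s1,
    tri1 a b c s2 = 0 /\ tri2 a b c s2 < 0 &
    forall s, s1 <= s <= s0 -> 0 <= tri1 a b c s].
Proof.
move=> a0 b0 c0; rewrite /tri2 /tri1 mulrN opprK => t0.
by apply: tri_zeros; rewrite ?mulr_gt0// (lt_trans m10).
Qed.

Lemma tri1_zero_order (a b c t : R) : 0 < b -> 0 < c ->
  tri1 a b c 0 < 0 -> (m1 + m2) * (m2 * b) < (m3 - m1) * (m3 * c) ->
  tri1 a b c t = 0 -> t < 0.
Proof.
move=> b0 c0 t0 lt tt.
apply: tri_zero_order t0 _ tt; rewrite ?mulr_gt0// ?(lt_trans m10)//.
by rewrite !mulr0 expR0 !mulr1.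
Qed.

Lemma tri1_le0_after (a b c s t : R) : 0 < b -> 0 < c ->
  tri1 a b c t = 0 -> tri2 a b c t < 0 -> t <= s -> tri1 a b c s <= 0.
Proof.
move=> b0 c0; rewrite /tri2 /tri1 mulrN opprK.
by apply: tri_le0_after; rewrite ?mulr_gt0// (lt_trans m10).
Qed.

Lemma tri2_bound (K : R) : 0 < K -> exists2 L, 0 < L & forall a b c d s,
  `|a| <= K * d -> `|b| <= K * d -> `|c| <= K * d -> -1 <= s <= 0 ->
  `|tri2 a b c s| <= L * d.
Proof.
move=> K0; have m30 : 0 < m3 by exact: lt_trans m13.
exists (m1 * m1 * K + m2 * m2 * K * expR m2 + m3 * m3 * K).
  by rewrite !addr_gt0 ?mulr_gt0 ?expR_gt0.
move=> a b c d s ad bd cd /tri_bound H; apply: (le_trans (H _ _ _)).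
have N u x : 0 < u -> `|u * (u * x)| = u * u * `|x|.
  by move=> u0; rewrite mulrA normrM [`|u * u|]ger0_norm// ltW// mulr_gt0.
rewrite mulrN opprK !N// !(mulrDl _ _ d); apply: lerD; first apply: lerD.
- by rewrite -[leRHS]mulrA ler_pM2l// mulr_gt0.
- by rewrite [leRHS]mulrAC ler_pM2r ?expR_gt0// -[leRHS]mulrA ler_pM2l// mulr_gt0.
- by rewrite -[leRHS]mulrA ler_pM2l// mulr_gt0.
Qed.

End trinomial.

(** * Uniform nondegeneracy and gaps on one ray *)

Section fibre.
Context (R : realType) (p q al gam : R).
Hypotheses (q0 : 0 < q) (q_al : q < al) (al_p : al < p) (p_gam : p < gam).
Local Notation m1 := (p - al).
Local Notation m2 := (al - q).
Local Notation m3 := (gam - al).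

Lemma exponent_gt0 :
  [/\ 0 < al, 0 < p & 0 < gam] /\ [/\ 0 < m1, 0 < m2, m1 < m3 & 0 < m3].
Proof.
by move: q0 q_al al_p p_gam => ? ? ? ?; split; split; lra.
Qed.

(** R^e is R^n with the three integrals of the numerator reweighted by [al / p], [al / q],
    [al / gam]. *)
Definition fib_e (f : R -> R -> R -> R -> R) (a b c : R) :=
  f (al / p * a) (al / q * b) (al / gam * c).

Local Notation h := (tri m1 m2 m3).
Local Notation h1 := (tri1 m1 m2 m3).
Local Notation h2 := (tri2 m1 m2 m3).
(* With [a], [b], [c] the quotients by [int |u|^alpha] of [int |grad u|^p],
   [lambda int |u|^q] and [int |u|^gamma], the fibres of R^n and R^e through [u] are
   [h a b c] and [k a b c], in the variable [s = ln t]. *)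
Local Notation k := (fib_e h).
Local Notation k1 := (fib_e h1).
Local Notation k2 := (fib_e h2).

Lemma fib_e1E a b c s : k1 a b c s = al * (h a b c s - k a b c s).
Proof. by have [[? ? ?] _] := exponent_gt0; rewrite /fib_e /tri1 /tri; field; rewrite !gt_eqF. Qed.

Lemma fib_e2E a b c s : k2 a b c s = al * (h1 a b c s - k1 a b c s).
Proof.
have [[? ? ?] _] := exponent_gt0.
by rewrite /fib_e /tri2 /tri1 /tri; field; rewrite !gt_eqF.
Qed.

(* The right-hand side is the maximum over [s] of [x e^{(p-q)s} - z e^{(gam-q)s}],
   where [x] and [z] are the outer coefficients of [k1 a b c]. With
   [kap = lambda^e / lambda] this says that [lambda^e] bounds the value
   [sup_t Lambda^e(t u)] from below. *)
Definition nondeg_fibre (kap a b c : R) : Prop :=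
  kap * (m2 * (al / q * b)) <= m1 * (al / p * a) *
  (((p - q) * (m1 * (al / p * a))) / ((gam - q) * (m3 * (al / gam * c))))
    `^ ((p - q) / (gam - p)) * (1 - (p - q) / (gam - q)).

(** The sign of [sig * x - tau * z] tells whether the ratio [sig * x / (tau * z)] exceeds 1. If it
    does, [y = x - z] is at least [(1 - sig / tau) * x], and the hypothesis pushes the ratio up to
    [rho]. If not, the power of the ratio is at most 1, and the hypothesis pushes [y] down by the
    factor [kap], hence [z] up. *)
Lemma nondeg_fibre_gap kap : 1 < kap -> exists2 eta, 0 < eta &
  forall x y z : R, 0 < x -> 0 < y -> 0 < z -> x = y + z ->
  kap * y <= x * (((p - q) * x) / ((gam - q) * z)) `^ ((p - q) / (gam - p)) *
    (1 - (p - q) / (gam - q)) ->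
  (0 < (p - q) * x - (gam - q) * z -> eta * x <= (p - q) * x - (gam - q) * z) /\
  ((p - q) * x - (gam - q) * z < 0 -> (p - q) * x - (gam - q) * z <= - (eta * x)).
Proof.
move: q_al al_p p_gam => qal alp pgam kap1.
have [sig sigE] : exists sig, sig = p - q by eexists.
have [tau tauE] : exists tau, tau = gam - q by eexists.
have [th thE] : exists th, th = sig / (tau - sig) by eexists.
have -> : (p - q) / (gam - p) = th by rewrite thE sigE tauE; congr (_ / _); ring.
rewrite -sigE -tauE.
have sig0 : 0 < sig by rewrite sigE; lra.
have st : sig < tau by rewrite sigE tauE; lra.
have tau0 : 0 < tau by lra.
have th0 : 0 < th by rewrite thE divr_gt0// subr_gt0.
have kap0 : 0 < kap by lra.
have [rho rhoE] : exists rho, rho = kap `^ th^-1 by eexists.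
have rho1 : 1 < rho.
  by rewrite rhoE /powR gt_eqF// expR_gt1 mulr_gt0 ?invr_gt0 ?ln_gt0.
have e0 : 0 < 1 - sig / tau by rewrite subr_gt0 ltr_pdivrMr// mul1r.
(* The first entry serves the positive case, the second the negative one. *)
exists (Num.min (sig * (1 - rho^-1)) ((tau - sig) * (1 - kap^-1))).
  rewrite lt_min !mulr_gt0// ?subr_gt0// invf_lt1//; lra.
move=> x y z x0 y0 z0 xE H.
have r0 : 0 <= sig * x / (tau * z) by rewrite ltW// divr_gt0// mulr_gt0.
split=> hs.
- have r1 : 1 < sig * x / (tau * z) by rewrite ltr_pdivlMr ?mulr_gt0//; lra.
  have : kap <= (sig * x / (tau * z)) `^ th.
    have : kap * ((1 - sig / tau) * x) <= kap * y.
      rewrite ler_pM2l// mulrBl mul1r lerBlDr xE lerD2l.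
      by rewrite -xE mulrAC ler_pdivlMr//; lra.
    move/le_trans => /(_ _ H); rewrite mulrCA [leRHS]mulrC ler_pM2l//.
    by rewrite mulrC ler_pM2l.
  move=> kr; have : rho <= sig * x / (tau * z).
    rewrite rhoE; have := @ge0_ler_powR R th^-1 _ kap _ _ _ kr.
    rewrite -powRrM mulfV ?gt_eqF// powRr1//.
    by apply; rewrite ?nnegrE ?invr_ge0 ?powR_ge0 ?ltW.
  rewrite ler_pdivlMr ?mulr_gt0// => Hr.
  apply: (@le_trans _ _ (sig * (1 - rho^-1) * x)).
    by rewrite ler_pM2r// ge_min lexx.
  have : tau * z <= sig * x / rho by rewrite ler_pdivlMr ?(lt_trans ltr01)// mulrC.
  by rewrite (_ : sig * (1 - rho^-1) * x = sig * x - sig * x / rho); [lra|ring].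
- have r1 : sig * x / (tau * z) <= 1 by rewrite ler_pdivrMr ?mulr_gt0//; lra.
  have : (sig * x / (tau * z)) `^ th <= 1.
    have := @ge0_ler_powR R th (ltW th0) (sig * x / (tau * z)) 1.
    by rewrite powR1; apply; rewrite ?nnegrE ?ler01.
  move=> pr; have {}H : kap * y <= x * (1 - sig / tau).
    apply: (le_trans H); rewrite ler_pM2r//.
    by rewrite ger_pMr.
  apply: (@le_trans _ _ (- ((tau - sig) * (1 - kap^-1) * x))); last first.
    by rewrite lerN2 ler_pM2r// ge_min lexx orbT.
  have : y <= x * (1 - sig / tau) / kap by rewrite ler_pdivlMr// mulrC.
  have -> : x * (1 - sig / tau) / kap = x * (tau - sig) / kap / tau by field; rewrite !gt_eqF.
  rewrite ler_pdivlMr// => Hy.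
  by have -> : z = x - y by [rewrite xE; ring]; lra.
Qed.

(** The critical equation [u * a = v * b + w * c] bounds [b] and [c] and turns the second derivative
    into the expression treated by [nondeg_fibre_gap]. Both constants are chosen before the ray. *)
Lemma e_crit kap : 1 < kap -> exists eta K, [/\ 0 < eta, 0 < K &
  forall a b c, 0 < a -> 0 < b -> 0 < c -> nondeg_fibre kap a b c ->
  k1 a b c 0 = 0 ->
  [/\ b <= K * a, c <= K * a,
      0 < k2 a b c 0 -> eta * a <= k2 a b c 0 &
      k2 a b c 0 < 0 -> k2 a b c 0 <= - (eta * a)]].
Proof.
have [[al0 p0 gam0] [m10 m20 m13 m30]] := exponent_gt0.
move=> /nondeg_fibre_gap[eta eta0 H].
have [u uE] : exists u, u = m1 * (al / p) by eexists.
have [v vE] : exists v, v = m2 * (al / q) by eexists.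
have [w wE] : exists w, w = m3 * (al / gam) by eexists.
have u0 : 0 < u by rewrite uE mulr_gt0// divr_gt0.
have v0 : 0 < v by rewrite vE mulr_gt0// divr_gt0.
have w0 : 0 < w by rewrite wE mulr_gt0// divr_gt0.
have uv0 : 0 < u / v by rewrite divr_gt0.
have uw0 : 0 < u / w by rewrite divr_gt0.
exists (eta * u), (u / v + u / w); split; [by rewrite mulr_gt0|by rewrite addr_gt0|].
move=> a b c a0 b0 c0.
have ua : m1 * (al / p * a) = u * a by rewrite uE; ring.
have vb : m2 * (al / q * b) = v * b by rewrite vE; ring.
have wc : m3 * (al / gam * c) = w * c by rewrite wE; ring.
rewrite /nondeg_fibre /fib_e /tri2 /tri1 !tri0 ua vb wc => nd crit.
have xE : u * a = v * b + w * c by lra.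
have [x0 y0 z0] : [/\ 0 < u * a, 0 < v * b & 0 < w * c] by split; rewrite mulr_gt0.
have k2E : m1 * (u * a) - m2 * - (v * b) - m3 * (w * c) =
    (p - q) * (u * a) - (gam - q) * (w * c).
  by have -> : v * b = u * a - w * c; [lra|ring].
rewrite k2E.
have [H1 H2] := H _ _ _ x0 y0 z0 xE nd.
rewrite -mulrA; split => //.
- apply: (@le_trans _ _ (u / v * a)); last by rewrite ler_pM2r//; lra.
  by rewrite mulrAC ler_pdivlMr// mulrC; lra.
- apply: (@le_trans _ _ (u / w * a)); last by rewrite ler_pM2r//; lra.
  by rewrite mulrAC ler_pdivlMr// mulrC; lra.
Qed.

(** A gain proportional to [a] is also one proportional to [w], as [w <= K * a]. *)
Lemma le_gap (d K a v w : R) : 0 < d -> 0 < K -> w <= K * a -> w <= v - d * a ->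
  (1 + d / K) * w <= v.
Proof.
move=> d0 K0 wK wv; rewrite mulrDl mul1r.
have : d / K * w <= d * a.
  by rewrite mulrAC ler_pdivrMr// -mulrA ler_pM2l// mulrC.
by lra.
Qed.

Lemma le_gap_chain (d K a v w x : R) : 0 < d -> 0 < K -> 0 < a -> v <= K * a ->
  w <= x -> d * a <= v - x -> (1 + d / K) * w <= v.
Proof.
move=> d0 K0 a0 vK wx dx; have da : 0 < d * a by rewrite mulr_gt0.
by apply: (@le_gap _ _ a) => //; lra.
Qed.

(** The order of the quantifiers is the point: [e] is fixed before [f] and [a], hence serves all
    rays. It is capped at 1 because the derivative is bounded on [[-1, 0]] only. *)
Lemma slope_window (t L : R) : 0 < t -> 0 < L -> exists e, [/\ 0 < e, e <= 1 &
  forall (f f' : R -> R) (a : R), 0 < a ->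
  (forall y : R, is_derive y 1 f (f' y)) ->
  (forall y, -1 <= y <= 0 -> `|f' y| <= L * a) ->
  forall s, - e <= s <= 0 -> `|f s - f 0| <= t / 2 * a].
Proof.
move=> t0 L0; have [e eE] : exists e, e = Num.min 1 (t / 2 / L) by eexists.
have e1 : e <= 1 by rewrite eE ge_min lexx.
exists e; split => //; first by rewrite eE lt_min ltr01 !divr_gt0.
have eL : L * e <= t / 2.
  by rewrite mulrC -ler_pdivlMr// eE ge_min lexx orbT.
move=> f f' a a0 df f'L s /andP[es s0].
have Las : L * a * (0 - s) <= t / 2 * a.
  apply: (@le_trans _ _ (L * e * a)); last by rewrite ler_pM2r.
  by rewrite mulrAC ler_pM2r// ler_pM2l// sub0r lerNl.
have B y : s <= y <= 0 -> - (L * a) <= f' y <= L * a.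
  by move=> /andP[sy y0]; rewrite -ler_norml; apply: f'L; apply/andP; split; lra.
have := derive_ub df s0 (fun y H => proj2 (andP (B y H))).
have := derive_lb df s0 (fun y H => proj1 (andP (B y H))).
by move=> H1 H2; rewrite ler_norml; apply/andP; split; lra.
Qed.

Let dh a b c (x : R) : is_derive x 1 (h a b c) (h1 a b c x).
Proof. exact: is_derive_tri. Qed.

Let dh1 a b c (x : R) : is_derive x 1 (h1 a b c) (h2 a b c x).
Proof. exact: is_derive_tri. Qed.

Lemma tri_le0 (K a b c : R) : 0 < c -> b <= K * a -> h a b c 0 <= (1 + K) * a.
Proof. by rewrite tri0 => ? ?; lra. Qed.

Let dk a b c (x : R) : is_derive x 1 (k a b c) (k1 a b c x).
Proof. exact: is_derive_tri. Qed.

Let dk1 a b c (x : R) : is_derive x 1 (k1 a b c) (k2 a b c x).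
Proof. exact: is_derive_tri. Qed.

Let dk2 a b c (x : R) : is_derive x 1 (k2 a b c)
  (h2 (m1 * (al / p * a)) (- (m2 * (al / q * b))) (m3 * (al / gam * c)) x).
Proof. exact: is_derive_tri. Qed.

(** With the weights [al / q] and [al / gam] this is [k2 < 0] rewritten by the critical equation;
    removing them keeps the inequality since [q < gam]. It says that the concave function governing
    [h1] has negative slope at 0. *)
Lemma e_neg_slope a b c : 0 < c -> k1 a b c 0 = 0 -> k2 a b c 0 < 0 ->
  (m1 + m2) * (m2 * b) < (m3 - m1) * (m3 * c).
Proof.
have [[al0 p0 gam0] [m10 m20 m13 m30]] := exponent_gt0 => c0.
rewrite /fib_e /tri2 /tri1 !tri0.
have [x xE] : exists x, x = m1 * (al / p * a) by eexists.
have [y yE] : exists y, y = m2 * (al / q * b) by eexists.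
have [z zE] : exists z, z = m3 * (al / gam * c) by eexists.
rewrite -xE -yE -zE => crit.
have -> : x = y + z by apply/eqP; rewrite -subr_eq0 opprD addrA crit.
rewrite (_ : _ - _ = (m1 + m2) * y - (m3 - m1) * z); last by ring.
rewrite subr_lt0 yE zE => H.
have alq : 0 < al / q by rewrite divr_gt0.
rewrite -(ltr_pM2l alq); apply: (@le_lt_trans _ _ ((m1 + m2) * (m2 * (al / q * b)))).
  by rewrite le_eqVlt (_ : _ == _)//; apply/eqP; ring.
apply: (lt_le_trans H).
rewrite (_ : _ * (m3 * _) = al / gam * ((m3 - m1) * (m3 * c))); last by ring.
have m310 : 0 < m3 - m1 by rewrite subr_gt0.
rewrite ler_pM2r; last by rewrite !mulr_gt0.
rewrite ler_pM2l// lef_pV2 ?posrE//.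
by rewrite ltW// (lt_trans q_al)// (lt_trans al_p).
Qed.

Lemma e_crit_eq a b c s : k1 a b c s = 0 -> k a b c s = h a b c s.
Proof.
have [[al0 _ _] _] := exponent_gt0.
by move/eqP; rewrite fib_e1E mulf_eq0 gt_eqF//= subr_eq0 => /eqP.
Qed.

Lemma e_crit_eq1 a b c s : k1 a b c s = 0 -> h1 a b c s = k2 a b c s / al.
Proof.
have [[al0 _ _] _] := exponent_gt0.
by move=> k10; rewrite fib_e2E k10 subr0 [al * _]mulrC mulfK// gt_eqF.
Qed.

(** The n-fibre has slope [k2 / al], at least [eta / al * a], at the e+ point, and keeps half of it
    on [[-e, 0]]. Further left [h1 >= 0] down to the n+ point, so the gain made on the window is not
    lost. *)
Lemma gap_n_pos kap : 1 < kap -> exists2 d, 0 < d &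
  forall a b c, 0 < a -> 0 < b -> 0 < c -> nondeg_fibre kap a b c ->
  k1 a b c 0 = 0 -> 0 < k2 a b c 0 ->
  exists s, [/\ h1 a b c s = 0, 0 < h2 a b c s & (1 + d) * h a b c s <= k a b c 0].
Proof.
have [[al0 p0 gam0] [m10 m20 m13 m30]] := exponent_gt0.
move=> /e_crit[eta [K [eta0 K0 H]]].
have K1 : 0 < 1 + K by rewrite addr_gt0.
have [L L0 HL] := tri2_bound m10 m20 m13 K1.
have t0 : 0 < eta / al by rewrite divr_gt0.
have [e [e0 e1 He]] := slope_window t0 L0.
have d0 : 0 < eta / al / 2 * e by rewrite !mulr_gt0// invr_gt0.
exists (eta / al / 2 * e / (1 + K)); first by rewrite divr_gt0.
move=> a b c a0 b0 c0 nd crit k20.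
have [bK cK /(_ k20) ka _] := H _ _ _ a0 b0 c0 nd crit.
have h10 : eta / al * a <= h1 a b c 0.
  by rewrite (e_crit_eq1 crit) mulrAC ler_pM2r// invr_gt0.
have ta : 0 < eta / al * a by rewrite mulr_gt0.
have [s1 [s2 [/andP[s10 _] [z1 d1] _ pos]]] :=
  tri1_zeros m10 m20 m13 a0 b0 c0 (lt_le_trans ta h10).
exists s1; split => //; rewrite (e_crit_eq crit).
have close s : - e <= s <= 0 -> eta / al / 2 * a <= h1 a b c s.
  move=> se; have := He (h1 a b c) (h2 a b c) a a0 (dh1 a b c) _ s se.
  rewrite ler_norml => /(_ _)/andP[].
    by move=> y; apply: HL; rewrite ger0_norm ?mulrDl ?mul1r; lra.
  by move=> *; lra.
have s1e : s1 <= - e.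
  rewrite leNgt; apply/negP => es1; have := close s1.
  rewrite z1 (ltW es1) (ltW s10) => /(_ isT).
  by rewrite leNgt !mulr_gt0// invr_gt0.
have e_neg : - e <= 0 by rewrite oppr_le0 ltW.
have h0K : h a b c 0 <= (1 + K) * a by exact: tri_le0.
have H2 := derive_lb (dh a b c) e_neg close.
have H1 : 0 * (- e - s1) <= h a b c (- e) - h a b c s1.
  apply: (derive_lb (dh a b c)) => // s /andP[s1s se]; apply: pos.
  by rewrite s1s (le_trans se).
apply: (le_gap_chain d0 K1 a0 h0K (x := h a b c (- e))).
  by rewrite -subr_ge0 -[X in X <= _](mul0r (- e - s1)).
by rewrite mulrAC; rewrite sub0r opprK in H2.
Qed.

Lemma k2_bound K : 0 < K -> exists2 L, 0 < L & forall a b c, 0 < a -> 0 < b -> 0 < c ->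
  b <= K * a -> c <= K * a ->
  forall s, -1 <= s <= 0 ->
  `|h2 (m1 * (al / p * a)) (- (m2 * (al / q * b))) (m3 * (al / gam * c)) s| <= L * a.
Proof.
have [[al0 p0 gam0] [m10 m20 m13 m30]] := exponent_gt0 => K0.
have [u uE] : exists u, u = m1 * (al / p) by eexists.
have [v vE] : exists v, v = m2 * (al / q) by eexists.
have [w wE] : exists w, w = m3 * (al / gam) by eexists.
have u0 : 0 < u by rewrite uE mulr_gt0// divr_gt0.
have v0 : 0 < v by rewrite vE mulr_gt0// divr_gt0.
have w0 : 0 < w by rewrite wE mulr_gt0// divr_gt0.
have M0 : 0 < u + v * K + w * K by rewrite !addr_gt0// mulr_gt0.
have [L L0 HL] := tri2_bound m10 m20 m13 M0.
exists L => // a b c a0 b0 c0 bK cK s; apply: HL.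
- rewrite mulrA -uE gtr0_norm ?mulr_gt0// ler_pM2r// -addrA lerDl.
  by rewrite addr_ge0// mulr_ge0// ltW.
- rewrite normrN mulrA -vE gtr0_norm ?mulr_gt0//.
  apply: (@le_trans _ _ (v * K * a)); first by rewrite -mulrA ler_pM2l.
  by rewrite ler_pM2r// addrAC lerDr addr_ge0// ?mulr_ge0// ltW.
- rewrite mulrA -wE gtr0_norm ?mulr_gt0//.
  apply: (@le_trans _ _ (w * K * a)); first by rewrite -mulrA ler_pM2l.
  by rewrite ler_pM2r// lerDr addr_ge0// ?mulr_ge0// ltW.
Qed.

(** The slope vanishes at an e- point, so the gain is of second order: [k2] is negative of size [a]
    on the window, whence [k1] grows linearly to the left. *)
Lemma gap_e_pos kap : 1 < kap -> exists2 d, 0 < d &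
  forall a b c, 0 < a -> 0 < b -> 0 < c -> nondeg_fibre kap a b c ->
  k1 a b c 0 = 0 -> k2 a b c 0 < 0 ->
  exists s, [/\ k1 a b c s = 0, 0 < k2 a b c s & (1 + d) * k a b c s <= k a b c 0].
Proof.
have [[al0 p0 gam0] [m10 m20 m13 m30]] := exponent_gt0.
move=> /e_crit[eta [K [eta0 K0 H]]].
have K1 : 0 < 1 + K by rewrite addr_gt0.
have [L L0 HL] := k2_bound K0.
have [e [e0 e1 He]] := slope_window eta0 L0.
(* On [[-e, -e/2]], of length [e / 2], the slope [k1] is at least [eta / 2 * (e / 2) * a]; on the
   other half [k1 >= 0] is enough. *)
have d0 : 0 < eta / 2 * (e / 2) * (e / 2) by rewrite !mulr_gt0// invr_gt0.
exists (eta / 2 * (e / 2) * (e / 2) / (1 + K)); first by rewrite divr_gt0.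
move=> a b c a0 b0 c0 nd crit k20.
have [bK cK _ /(_ k20) ka] := H _ _ _ a0 b0 c0 nd crit.
have ea : 0 < eta / 2 * a by rewrite !mulr_gt0// invr_gt0.
have close s : - e <= s <= 0 -> k2 a b c s <= - (eta / 2 * a).
  move=> se; have := He (k2 a b c) _ a a0 (dk2 a b c) (HL a b c a0 b0 c0 bK cK) s se.
  by rewrite ler_norml => /andP[_ A]; lra.
have k1_lb s : - e <= s <= 0 -> eta / 2 * a * - s <= k1 a b c s.
  move=> /andP[es s0].
  have := derive_ub (dk1 a b c) s0 (d := - (eta / 2 * a)).
  rewrite crit !sub0r mulNr lerN2; apply => y /andP[sy y0]; apply: close.
  by rewrite (le_trans es sy).
have k1e : 0 < k1 a b c (- e).
  apply: (lt_le_trans _ (k1_lb _ _)); rewrite ?opprK ?mulr_gt0// lexx oppr_le0.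
  exact: ltW.
have wa : 0 < al / p * a by rewrite !mulr_gt0// invr_gt0.
have wb : 0 < al / q * b by rewrite !mulr_gt0// invr_gt0.
have wc : 0 < al / gam * c by rewrite !mulr_gt0// invr_gt0.
have [s1 [s2 [/andP[s1e _] [z1 d1] _ pos]]] := tri1_zeros m10 m20 m13 wa wb wc k1e.
exists s1; split => //.
have k0K : k a b c 0 <= (1 + K) * a by rewrite e_crit_eq//; exact: tri_le0.
have e2 : - e <= - (e / 2) by lra.
have e20 : - (e / 2) <= 0 by lra.
apply: (le_gap_chain d0 K1 a0 k0K (x := k a b c (- e))).
  rewrite -subr_ge0 -[X in X <= _](mul0r (- e - s1)).
  apply: (derive_lb (dk a b c)); first exact: ltW.
  by move=> s; exact: pos.
have A1 : eta / 2 * (e / 2) * a * (- (e / 2) - - e) <= k a b c (- (e / 2)) - k a b c (- e).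
  apply: (derive_lb (dk a b c)) => // s /andP[es se].
  apply: le_trans (k1_lb s _); last by rewrite es (le_trans se).
  by rewrite mulrAC ler_pM2l// lerNr.
have A2 : 0 * (0 - - (e / 2)) <= k a b c 0 - k a b c (- (e / 2)).
  apply: (derive_lb (dk a b c)) => // s /andP[es s0].
  apply: le_trans (k1_lb s _); last by rewrite s0 (le_trans e2).
  by rewrite mulr_ge0 ?oppr_ge0// ltW.
have eE : - (e / 2) - - e = e / 2 by field.
rewrite eE in A1; rewrite mul0r subr_ge0 in A2.
rewrite [X in X <= _]mulrAC; apply: (le_trans A1).
by rewrite lerD2r.
Qed.

(** Here the n- point [t] is given instead of constructed, and [e_neg_slope] locates it to the left
    of 0. The n-fibre decreases from [t] on, with definite slope on the window. It is now the
    smaller value that is bounded by [(1 + K) * a], hence [le_gap] applies directly. *)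
Lemma gap_e_neg kap : 1 < kap -> exists2 d, 0 < d &
  forall a b c t, 0 < a -> 0 < b -> 0 < c -> nondeg_fibre kap a b c ->
  k1 a b c 0 = 0 -> k2 a b c 0 < 0 -> h1 a b c t = 0 -> h2 a b c t < 0 ->
  (1 + d) * k a b c 0 <= h a b c t.
Proof.
have [[al0 p0 gam0] [m10 m20 m13 m30]] := exponent_gt0.
move=> /e_crit[eta [K [eta0 K0 H]]].
have K1 : 0 < 1 + K by rewrite addr_gt0.
have [L L0 HL] := tri2_bound m10 m20 m13 K1.
have t0 : 0 < eta / al by rewrite divr_gt0.
have [e [e0 e1 He]] := slope_window t0 L0.
have d0 : 0 < eta / al / 2 * e by rewrite !mulr_gt0// invr_gt0.
exists (eta / al / 2 * e / (1 + K)); first by rewrite divr_gt0.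
move=> a b c t a0 b0 c0 nd crit k20 ht h2t.
have [bK cK _ /(_ k20) ka] := H _ _ _ a0 b0 c0 nd crit.
have h10 : h1 a b c 0 <= - (eta / al * a).
  by rewrite (e_crit_eq1 crit) mulrAC -mulNr ler_pM2r// invr_gt0.
have ta : 0 < eta / al * a by rewrite mulr_gt0.
have slope : (m1 + m2) * (m2 * b) < (m3 - m1) * (m3 * c) by exact: (e_neg_slope c0 crit k20).
have tneg : t < 0.
  apply: (tri1_zero_order m10 m20 m13 b0 c0 _ slope ht).
  by rewrite (le_lt_trans h10)// oppr_lt0.
rewrite (e_crit_eq crit).
have close s : - e <= s <= 0 -> h1 a b c s <= - (eta / al / 2 * a).
  move=> se; have := He (h1 a b c) (h2 a b c) a a0 (dh1 a b c) _ s se.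
  rewrite ler_norml => /(_ _)/andP[].
    by move=> y; apply: HL; rewrite ger0_norm ?mulrDl ?mul1r; lra.
  by move=> *; lra.
have te : t <= - e.
  rewrite leNgt; apply/negP => es1; have := close t.
  rewrite ht (ltW es1) (ltW tneg) => /(_ isT).
  by rewrite oppr_ge0 leNgt !mulr_gt0// invr_gt0.
have e_neg : - e <= 0 by rewrite oppr_le0 ltW.
have h0K : h a b c 0 <= (1 + K) * a by exact: tri_le0.
have H2 := derive_ub (dh a b c) e_neg close.
have H1 : h a b c (- e) - h a b c t <= 0 * (- e - t).
  apply: (derive_ub (dh a b c)) => // s /andP[ts se].
  exact: (tri1_le0_after m10 m20 m13 b0 c0 ht h2t).
rewrite mul0r subr_le0 in H1; rewrite sub0r opprK mulNr in H2.
apply: (@le_gap _ _ a) => //; rewrite lerBrDr.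
rewrite [X in _ + X]mulrAC; apply: le_trans H1.
by rewrite -lerBrDl -lerN2 opprB.
Qed.

Lemma e_exists kap a b c : 1 < kap -> 0 < a -> 0 < b -> 0 < c ->
  nondeg_fibre kap a b c -> exists s1 s2,
  (k1 a b c s1 = 0 /\ 0 < k2 a b c s1) /\ (k1 a b c s2 = 0 /\ k2 a b c s2 < 0).
Proof.
have [[al0 p0 gam0] [m10 m20 m13 m30]] := exponent_gt0.
move=> kap1 a0 b0 c0.
have wa : 0 < al / p * a by rewrite !mulr_gt0// invr_gt0.
have wb : 0 < al / q * b by rewrite !mulr_gt0// invr_gt0.
have wc : 0 < al / gam * c by rewrite !mulr_gt0// invr_gt0.
have [x xE] : exists x, x = m1 * (al / p * a) by eexists.
have [y yE] : exists y, y = m2 * (al / q * b) by eexists.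
have [z zE] : exists z, z = m3 * (al / gam * c) by eexists.
have [x0 y0 z0] : [/\ 0 < x, 0 < y & 0 < z] by rewrite xE yE zE; split; exact: mulr_gt0.
have sig0 : 0 < p - q by rewrite subr_gt0 (lt_trans q_al).
have tau0 : 0 < gam - q by rewrite subr_gt0 (lt_trans q_al)// (lt_trans al_p).
have gp0 : 0 < gam - p by rewrite subr_gt0.
rewrite /nondeg_fibre -xE -yE -zE => nd.
have [rho rhoE] : exists rho, rho = (p - q) * x / ((gam - q) * z) by eexists.
have rho0 : 0 < rho by rewrite rhoE divr_gt0// mulr_gt0.
(* The maximiser of [x e^{(p-q)s} - z e^{(gam-q)s}]. The maximum is at least [kap * y] by
   [nondeg_fibre], hence above [y]. *)
have [s sE] : exists s, s = ln rho / (gam - p) by eexists.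
have e1 : expR ((p - q) * s) = rho `^ ((p - q) / (gam - p)).
  by rewrite /powR gt_eqF// sE; congr expR; ring.
have e2 : expR ((gam - q) * s) = expR ((p - q) * s) * rho.
  rewrite -[rho in RHS](@lnK R)// -expRD; congr expR.
  have -> : ln rho = s * (gam - p) by rewrite sE divfK// gt_eqF.
  by ring.
have k1s : 0 < k1 a b c s.
  have -> : k1 a b c s = expR (- m2 * s) *
      (x * expR ((p - q) * s) - y - z * expR ((gam - q) * s)).
    rewrite /fib_e /tri1 /tri -xE -yE -zE.
    have -> : expR (m1 * s) = expR (- m2 * s) * expR ((p - q) * s).
      by rewrite -expRD; congr expR; ring.
    have -> : expR (m3 * s) = expR (- m2 * s) * expR ((gam - q) * s).
      by rewrite -expRD; congr expR; ring.
    by ring.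
  rewrite pmulr_rgt0 ?expR_gt0// addrAC subr_gt0.
  have -> : x * expR ((p - q) * s) - z * expR ((gam - q) * s) =
      x * rho `^ ((p - q) / (gam - p)) * (1 - (p - q) / (gam - q)).
    have zr : z * rho = x * ((p - q) / (gam - q)).
      by rewrite rhoE; field; rewrite !gt_eqF.
    by rewrite e2 e1 mulrCA zr; ring.
  by rewrite -rhoE in nd; apply: lt_le_trans nd; rewrite ltr_pMl.
have [s1 [s2 [_ H1 H2 _]]] := tri1_zeros m10 m20 m13 wa wb wc k1s.
by exists s1, s2.
Qed.

(** At the e+ point the n-fibre has positive slope, and a derivative that is positive somewhere has
    a descending zero. *)
Lemma n_neg_exists kap a b c : 1 < kap -> 0 < a -> 0 < b -> 0 < c ->
  nondeg_fibre kap a b c -> exists s, h1 a b c s = 0 /\ h2 a b c s < 0.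
Proof.
have [[al0 p0 gam0] [m10 m20 m13 m30]] := exponent_gt0.
move=> kap1 a0 b0 c0 nd; have [s [_ [[k10 k20] _]]] := e_exists kap1 a0 b0 c0 nd.
have h1s : 0 < h1 a b c s by rewrite (e_crit_eq1 k10) divr_gt0.
by have [s1 [s2 [_ _ H2 _]]] := tri1_zeros m10 m20 m13 a0 b0 c0 h1s; exists s2.
Qed.

Lemma powR_div (x y t : R) : 0 < x -> 0 < y -> (x / y) `^ t = x `^ t / y `^ t.
Proof.
move=> x0 y0; apply: (mulIf (_ : y `^ t != 0)); first by rewrite gt_eqF// powR_gt0.
rewrite divfK ?gt_eqF ?powR_gt0// -powRM ?(ltW y0)// ?divr_ge0 ?ltW//.
by rewrite divfK// gt_eqF.
Qed.

Lemma powR1D (x t : R) : 0 < x -> x `^ (1 + t) = x * x `^ t.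
Proof. by move=> x0; rewrite powRD ?(gt_eqF x0) ?implybT// powRr1// ltW. Qed.

Let thE : (gam - q) / (gam - p) = 1 + (p - q) / (gam - p).
Proof. by field; rewrite subr_eq0 gt_eqF. Qed.

Lemma c_e_gt0 : 0 < c_e p q al gam.
Proof.
have [[al0 p0 gam0] [m10 m20 m13 m30]] := exponent_gt0.
have sig0 : 0 < p - q by rewrite subr_gt0 (lt_trans q_al).
have tau0 : 0 < gam - q by rewrite subr_gt0 (lt_trans q_al)// (lt_trans al_p).
have gp0 : 0 < gam - p by rewrite subr_gt0.
by rewrite /c_e /c_n !(divr_gt0, mulr_gt0, powR_gt0).
Qed.

(** [c_e] is made for this: multiplying the hypothesis by [m2 * (al / q)] gives [nondeg_fibre] with
    the same right-hand side. *)
Lemma nondeg_fibreI kap a b c : 0 < a -> 0 < b -> 0 < c ->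
  kap * b <= c_e p q al gam * (a * (a / c) `^ ((p - q) / (gam - p))) ->
  nondeg_fibre kap a b c.
Proof.
have [[al0 p0 gam0] [m10 m20 m13 m30]] := exponent_gt0.
have sig0 : 0 < p - q by rewrite subr_gt0 (lt_trans q_al).
have tau0 : 0 < gam - q by rewrite subr_gt0 (lt_trans q_al)// (lt_trans al_p).
have gp0 : 0 < gam - p by rewrite subr_gt0.
move=> a0 b0 c0; rewrite /nondeg_fibre /c_e /c_n thE.
have [t tE] : exists t, t = (p - q) / (gam - p) by eexists.
rewrite -tE.
have -> : (p - q) * (m1 * (al / p * a)) / ((gam - q) * (m3 * (al / gam * c))) =
    (((p - q) * m1) * gam / ((gam - q) * m3 * p)) * (a / c).
  by field; rewrite !gt_eqF.
have R0 : 0 < (p - q) * m1 * gam / ((gam - q) * m3 * p) by rewrite divr_gt0// !mulr_gt0.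
have ac0 : 0 < a / c by rewrite divr_gt0.
have [w wE] : exists w, w = a / c by eexists.
rewrite -wE; rewrite -wE in ac0.
have -> : ((p - q) * m1 * gam / ((gam - q) * m3 * p) * w) `^ t =
    (p - q) `^ t * m1 `^ t * gam `^ t / ((gam - q) `^ t * m3 `^ t * p `^ t) * w `^ t.
  rewrite powRM ?(ltW R0) ?(ltW ac0)// powR_div ?mulr_gt0//.
  by congr (_ / _ * _); rewrite !powRM// ?mulr_ge0// ltW.
rewrite !powR1D//.
(* With the real powers generalised to variables, what remains is an identity of rational
   functions. *)
have := powR_gt0 t p0; have := powR_gt0 t tau0; have := powR_gt0 t m30.
move: (p `^ t) ((gam - q) `^ t) (m3 `^ t) => P T M M0 T0 P0.
move: (gam `^ t) ((p - q) `^ t) (m1 `^ t) (w `^ t) => u v x z H.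
have y0 : 0 < m2 * (al / q) by rewrite mulr_gt0// divr_gt0.
have -> : kap * (m2 * (al / q * b)) = m2 * (al / q) * (kap * b) by ring.
move: H; rewrite -(ler_pM2l y0) => /le_trans; apply.
rewrite le_eqVlt (_ : _ == _)//; apply/eqP; field.
by rewrite !gt_eqF.
Qed.

(** The ratio is [(q / p) (gam / p) ^ t] with [t = (p - q) / (gam - p)]. Bounding each base by
    [y < expR (y - 1)], valid for [y != 1], leaves exponents that add up to zero. *)
Lemma c_e_lt_c_n : c_e p q al gam < c_n p q al gam.
Proof.
have [[al0 p0 gam0] [m10 m20 m13 m30]] := exponent_gt0.
have sig0 : 0 < p - q by rewrite subr_gt0 (lt_trans q_al).
have gp0 : 0 < gam - p by rewrite subr_gt0.
have := c_e_gt0; rewrite /c_e thE => ce0.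
rewrite gtr_pMl.
  have t0 : 0 < (p - q) / (gam - p) by rewrite divr_gt0.
  rewrite powR1D//.
  have -> : q * gam `^ ((p - q) / (gam - p)) / (p * p `^ ((p - q) / (gam - p))) =
      q / p * (gam / p) `^ ((p - q) / (gam - p)).
    by rewrite powR_div//; field; rewrite !gt_eqF ?powR_gt0.
  have qp : q / p < expR (q / p - 1).
    rewrite -[X in X < _](subrK 1) addrC; apply: expR_gt1Dx.
    by rewrite subr_eq0 lt_eqF// ltr_pdivrMr// mul1r (lt_trans q_al).
  have gp : (gam / p) `^ ((p - q) / (gam - p)) <
      expR ((gam / p - 1) * ((p - q) / (gam - p))).
    rewrite expRM; apply: gt0_ltr_powR; rewrite ?nnegrE ?divr_ge0 ?expR_ge0 ?ltW//.
    rewrite -[X in X < _](subrK 1) addrC; apply: expR_gt1Dx.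
    by rewrite subr_eq0 gt_eqF// ltr_pdivlMr// mul1r.
  rewrite -[X in _ < X](@expR0 R).
  have -> : 0 = (q / p - 1) + (gam / p - 1) * ((p - q) / (gam - p)).
    by field; rewrite !gt_eqF.
  by rewrite expRD ltr_pM ?divr_ge0 ?powR_ge0 ?ltW.
move: ce0; rewrite pmulr_rgt0// !(divr_gt0, mulr_gt0, powR_gt0)//.
Qed.

End fibre.

(** * Infima over the critical sets *)

(** Pointwise strictness would give only a weak inequality of infima. A uniform factor gives a
    strict one when the smaller infimum is positive and finite; finiteness comes from a point of [Q]
    and its companion in [P]. *)
Lemma ereal_inf_gap (R : realType) (U : Type) (f g : U -> R) (P Q : set U) (d : R) :
  0 < d -> (0 < ereal_inf [set (f u)%:E | u in P])%E -> Q !=set0 ->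
  (forall u, Q u -> exists2 v, P v & (1 + d) * f v <= g u) ->
  (ereal_inf [set (f u)%:E | u in P] < ereal_inf [set (g u)%:E | u in Q])%E.
Proof.
move=> d0 fP0 [u0 Qu0] H.
have lb v : P v -> (ereal_inf [set (f u)%:E | u in P] <= (f v)%:E)%E.
  by move=> Pv; apply: ereal_inf_lbound; exists v.
have [v0 Pv0 _] := H _ Qu0; have := lb v0 Pv0.
move: fP0 lb; case: (ereal_inf _) => [r| |] // r0 lb _.
rewrite lte_fin in r0; apply: (@lt_le_trans _ _ ((1 + d) * r)%:E).
  by rewrite lte_fin ltr_pMl// ltrDl.
apply/ereal_infP => _ [u Qu <-]; have [v Pv /(le_trans _) fg] := H u Qu.
by rewrite lee_fin; apply: fg; rewrite ler_pM2l -?lee_fin ?lb// addr_gt0.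
Qed.

(** Near [t = 1] the fibre is [f (ln t + s)], with derivative [f1 (ln t + s) / t]. At a critical
    point the correction [- f1 s] vanishes, so the second derivatives in [t] and in [s] agree
    there. *)
Lemma fiber_derive_ray (R : realType) (V : lmodType R) (F : V -> R) (u : V)
    (f f1 f2 : R -> R) :
  (forall s, F (expR s *: u) = f s) ->
  (forall s : R, is_derive s 1 f (f1 s)) -> (forall s : R, is_derive s 1 f1 (f2 s)) ->
  forall s, fiber_derive1 F (expR s *: u) = f1 s /\
            fiber_derive2 F (expR s *: u) = f2 s - f1 s.
Proof.
move=> Ff df df1 s; pose phi (t : R) := F (t *: (expR s *: u)).
have phiE (t : R) : 0 < t -> phi t = f (ln t + s).
  by move=> t0; rewrite /phi scalerA -{1}[t]lnK// -expRD Ff.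
have dlns (t : R) : 0 < t -> is_derive t 1 (fun t => ln t + s) t^-1.
  move=> t0; have dl := is_derive1_ln t0.
  by apply: is_derive_eq (is_deriveD dl (is_derive_cst s t 1)) _; rewrite addr0.
have dphi (t : R) : 0 < t -> is_derive t 1 phi (f1 (ln t + s) * t^-1).
  move=> t0; apply: (@near_eq_is_derive R R R (fun t => f (ln t + s)) _ t 1).
    by near=> y; rewrite phiE//; near: y; exact: lt_nbhsr.
  exact: (@is_derive1_comp _ f _ t _ _ (df _) (dlns t t0)).
rewrite /fiber_derive1 /fiber_derive2 derive1nS derive1n1 -/phi !derive1E; split.
  by have [_ ->] := dphi 1 ltr01; rewrite ln1 add0r invr1 mulr1.
have dV : is_derive (1 : R) 1 (fun y : R => y^-1) (- 1).
  have := @is_deriveV _ id (1 : R) 1 1 (oner_neq0 _) (is_derive_id _ _).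
  by rewrite /= expr1n invr1 [_ *: 1]mulr1.
have := @is_derive1_comp _ f1 (fun t => ln t + s) 1 _ _ (df1 _) (dlns 1 ltr01).
move=> d1; have := is_deriveM d1 dV; rewrite /= ln1 add0r invr1 mulr1 => d2.
have -> : f2 s - f1 s = f1 s *: -1 + 1 *: f2 s.
  by rewrite /GRing.scale /=; ring.
case: d2 => _ <-; apply: near_eq_derive; near=> y.
rewrite derive1E; have [_ ->] // : is_derive y 1 phi (f1 (ln y + s) * y^-1).
by apply: dphi; near: y; exact: lt_nbhsr ltr01.
Unshelve. all: by end_near. Qed.

(** * The chain of infima; [A], [B], [C], [D] stand for the gradient, [q], [gamma] and [alpha]
    integrals *)

Section rayleigh_quotients.
Context (R : realType) (V : lmodType R) (nz : set V) (A B C D : V -> R).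
Context (p q al gam lam kap L K : R).
Hypotheses (q1 : 1 < q) (q_al : q < al) (al_p : al < p) (p_gam : p < gam).
Hypotheses (lam0 : 0 < lam) (kap1 : 1 < kap) (K0 : 0 < K) (nz0 : nz !=set0).
Hypothesis nzZ : forall s w, nz w -> nz (expR s *: w).
Hypothesis A_gt0 : forall w, nz w -> 0 < A w.
Hypothesis B_gt0 : forall w, nz w -> 0 < B w.
Hypothesis C_gt0 : forall w, nz w -> 0 < C w.
Hypothesis D_gt0 : forall w, nz w -> 0 < D w.
Hypothesis AZ : forall s w, nz w -> A (expR s *: w) = expR (p * s) * A w.
Hypothesis BZ : forall s w, nz w -> B (expR s *: w) = expR (q * s) * B w.
Hypothesis CZ : forall s w, nz w -> C (expR s *: w) = expR (gam * s) * C w.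
Hypothesis DZ : forall s w, nz w -> D (expR s *: w) = expR (al * s) * D w.
Hypothesis D_le : forall w, nz w -> D w <= B w + K * A w.
Hypothesis kapE : kap * lam = c_e p q al gam * L.
Hypothesis L_le : forall w, nz w ->
  L <= A w `^ ((gam - q) / (gam - p)) / (B w * C w `^ ((p - q) / (gam - p))).

Local Notation m1 := (p - al).
Local Notation m2 := (al - q).
Local Notation m3 := (gam - al).
Local Notation h := (tri m1 m2 m3).
Local Notation h1 := (tri1 m1 m2 m3).
Local Notation h2 := (tri2 m1 m2 m3).
Local Notation fe := (fib_e p q al gam).
Local Notation a_ w := (A w / D w).
Local Notation b_ w := (lam * B w / D w).
Local Notation c_ w := (C w / D w).

Definition quot_n (w : V) : R := (A w + lam * B w - C w) / D w.

Definition quot_e (w : V) : R :=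
  (p^-1 * A w + lam / q * B w - gam^-1 * C w) / (al^-1 * D w).

Let q0 : 0 < q. Proof. exact: lt_trans q1. Qed.
Let al0 : 0 < al. Proof. exact: lt_trans q_al. Qed.
Let p0 : 0 < p. Proof. exact: lt_trans al_p. Qed.
Let gam0 : 0 < gam. Proof. exact: lt_trans p_gam. Qed.

Let expR_exponent (r s : R) : expR (r * s) = expR (al * s) * expR ((r - al) * s).
Proof. by rewrite -expRD; congr expR; ring. Qed.

Lemma quot_n_ray w : nz w -> forall s, quot_n (expR s *: w) = h (a_ w) (b_ w) (c_ w) s.
Proof.
move=> nw s; have dn := gt_eqF (D_gt0 nw); have en := gt_eqF (expR_gt0 (al * s)).
rewrite /quot_n AZ// BZ// CZ// DZ// /tri opprB.
rewrite (expR_exponent p) (expR_exponent q) (expR_exponent gam).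
by field; rewrite dn en.
Qed.

Lemma quot_e_ray w : nz w -> forall s, quot_e (expR s *: w) = fe h (a_ w) (b_ w) (c_ w) s.
Proof.
move=> nw s; have dn := gt_eqF (D_gt0 nw); have en := gt_eqF (expR_gt0 (al * s)).
rewrite /quot_e AZ// BZ// CZ// DZ// /fib_e /tri opprB.
rewrite (expR_exponent p) (expR_exponent q) (expR_exponent gam).
by field; rewrite dn en !gt_eqF.
Qed.

Lemma fiber_derive_n w s : nz w ->
  fiber_derive1 quot_n (expR s *: w) = h1 (a_ w) (b_ w) (c_ w) s /\
  fiber_derive2 quot_n (expR s *: w) =
    h2 (a_ w) (b_ w) (c_ w) s - h1 (a_ w) (b_ w) (c_ w) s.
Proof.
by move=> nw; apply: (fiber_derive_ray (quot_n_ray nw)) => t; exact: is_derive_tri.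
Qed.

Lemma fiber_derive_e w s : nz w ->
  fiber_derive1 quot_e (expR s *: w) = fe h1 (a_ w) (b_ w) (c_ w) s /\
  fiber_derive2 quot_e (expR s *: w) =
    fe h2 (a_ w) (b_ w) (c_ w) s - fe h1 (a_ w) (b_ w) (c_ w) s.
Proof.
by move=> nw; apply: (fiber_derive_ray (quot_e_ray nw)) => t; exact: is_derive_tri.
Qed.

Let abc_gt0 w : nz w -> [/\ 0 < a_ w, 0 < b_ w & 0 < c_ w].
Proof.
move=> nw; have D0 := D_gt0 nw.
by split; rewrite divr_gt0 ?mulr_gt0 ?A_gt0 ?B_gt0 ?C_gt0.
Qed.

(** The variational definition of [lambda_bar] enters here, through [L_le]; dividing by [D w] gives
    the hypothesis of [nondeg_fibreI]. *)
Lemma ray_nondeg w : nz w -> nondeg_fibre p q al gam kap (a_ w) (b_ w) (c_ w).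
Proof.
move=> nw; have [a0 b0 c0] := abc_gt0 nw.
apply: nondeg_fibreI => //.
have D0 := D_gt0 nw; have B0 := B_gt0 nw; have C0 := C_gt0 nw; have A0 := A_gt0 nw.
have -> : kap * b_ w = c_e p q al gam * (L * B w / D w).
  by rewrite !mulrA -kapE.
rewrite ler_pM2l; last exact: c_e_gt0.
have -> : a_ w / c_ w = A w / C w by field; rewrite !gt_eqF.
have [t tE] : exists t, t = (p - q) / (gam - p) by eexists.
have thE : (gam - q) / (gam - p) = 1 + t.
  by rewrite tE; field; rewrite subr_eq0 gt_eqF.
have Ct : 0 < C w `^ t by rewrite powR_gt0.
have := L_le nw; rewrite thE -tE powR1D// powR_div// ler_pdivlMr ?mulr_gt0// => LQ.
have -> : A w / D w * (A w `^ t / C w `^ t) = (A w * A w `^ t / C w `^ t) / D w.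
  by field; rewrite !gt_eqF.
by rewrite ler_pM2r ?invr_gt0// ler_pdivlMr// -mulrA.
Qed.

Lemma crit_n w : nz w -> fiber_derive1 quot_n w = 0 ->
  h1 (a_ w) (b_ w) (c_ w) 0 = 0 /\
  fiber_derive2 quot_n w = h2 (a_ w) (b_ w) (c_ w) 0.
Proof.
move=> nw; have [] := fiber_derive_n 0 nw; rewrite expR0 scale1r => -> -> z.
by rewrite z subr0.
Qed.

Lemma crit_e w : nz w -> fiber_derive1 quot_e w = 0 ->
  fe h1 (a_ w) (b_ w) (c_ w) 0 = 0 /\
  fiber_derive2 quot_e w = fe h2 (a_ w) (b_ w) (c_ w) 0.
Proof.
move=> nw; have [] := fiber_derive_e 0 nw; rewrite expR0 scale1r => -> -> z.
by rewrite z subr0.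
Qed.

Lemma quot_n0 w : nz w -> quot_n w = h (a_ w) (b_ w) (c_ w) 0.
Proof. by move=> nw; rewrite -quot_n_ray// expR0 scale1r. Qed.

Lemma quot_e0 w : nz w -> quot_e w = fe h (a_ w) (b_ w) (c_ w) 0.
Proof. by move=> nw; rewrite -quot_e_ray// expR0 scale1r. Qed.

(** At an n-critical point [c_ w <= m1 / m3 * a_ w], so the quotient is at least
    [b_ w + (gam - p) / m3 * a_ w], and [D_le] bounds such a combination from below. *)
Lemma inf_n_pos_gt0 : (0 < inf_fiber_pos quot_n nz)%E.
Proof.
have [m10 m30 gp0] : [/\ 0 < m1, 0 < m3 & 0 < gam - p].
  by rewrite !subr_gt0; split => //; exact: lt_trans p_gam.
have g0 : 0 < (gam - p) / m3 by rewrite divr_gt0.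
(* The largest [r] with [r * (B + K * A) <= lam * B + (gam - p) / m3 * A] for all positive [A] and
   [B]. *)
have [r rE] : exists r, r = Num.min lam ((gam - p) / m3 / K) by eexists.
have r0 : 0 < r by rewrite rE lt_min lam0 divr_gt0.
apply: (@lt_le_trans _ _ r%:E); first by rewrite lte_fin.
apply/ereal_infP => _ [w [nw d1 _] <-]; rewrite lee_fin.
have [z _] := crit_n nw d1; rewrite (quot_n0 nw) tri0.
have [a0 b0 c0] := abc_gt0 nw; have D0 := D_gt0 nw.
have B0 := B_gt0 nw; have A0 := A_gt0 nw.
have HD := D_le nw.
have rlam : r <= lam by rewrite rE ge_min lexx.
have rC : r * K <= (gam - p) / m3 by rewrite -ler_pdivlMr// rE ge_min lexx orbT.
have cle : c_ w <= m1 / m3 * a_ w.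
  move: z; rewrite /tri1 tri0 => z; rewrite mulrAC ler_pdivlMr// mulrC.
  have : 0 < m2 * b_ w by rewrite mulr_gt0// subr_gt0.
  by move: z; move: (m1 * _) (m2 * _) (m3 * _) => x y u z y0; lra.
have rv : r <= b_ w + (gam - p) / m3 * a_ w.
  rewrite [X in _ <= _ + X]mulrA -mulrDl ler_pdivlMr//.
  apply: (@le_trans _ _ (r * (B w + K * A w))); first by rewrite ler_pM2l.
  by rewrite mulrDr; apply: lerD; rewrite ?mulrA ler_pM2r.
apply: (le_trans rv).
have -> : (gam - p) / m3 = 1 - m1 / m3 by field; rewrite gt_eqF.
have lin (x y u v : R) : v <= x -> u + (y - x) <= y + u - v by move=> ?; lra.
by rewrite [(1 - _) * _]mulrBl mul1r; exact: lin.
Qed.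

Lemma inf_n_pos_lt : (inf_fiber_pos quot_n nz < inf_fiber_pos quot_e nz)%E.
Proof.
have [d d0 H] := gap_n_pos q0 q_al al_p p_gam kap1.
apply: (ereal_inf_gap d0 inf_n_pos_gt0).
  have [w nw] := nz0; have [a0 b0 c0] := abc_gt0 nw.
  have [s [_ [[z1 d1] _]]] := e_exists q0 q_al al_p p_gam kap1 a0 b0 c0 (ray_nondeg nw).
  exists (expR s *: w); have [E1 E2] := fiber_derive_e s nw.
  by rewrite /= E1 E2 z1 subr0; split => //; exact: nzZ.
move=> w [nw d1 d2]; have [z1 z2] := crit_e nw d1; rewrite z2 in d2.
have [a0 b0 c0] := abc_gt0 nw.
have [s [y1 y2 y3]] := H _ _ _ a0 b0 c0 (ray_nondeg nw) z1 d2.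
exists (expR s *: w); last by rewrite quot_n_ray// quot_e0.
have [E1 E2] := fiber_derive_n s nw.
by rewrite /= E1 E2 y1 subr0; split => //; exact: nzZ.
Qed.

Lemma inf_e_pos_lt : (inf_fiber_pos quot_e nz < inf_fiber_neg quot_e nz)%E.
Proof.
have [d d0 H] := gap_e_pos q0 q_al al_p p_gam kap1.
apply: (ereal_inf_gap d0 (lt_trans inf_n_pos_gt0 inf_n_pos_lt)).
  have [w nw] := nz0; have [a0 b0 c0] := abc_gt0 nw.
  have [_ [s [_ [z1 d1]]]] := e_exists q0 q_al al_p p_gam kap1 a0 b0 c0 (ray_nondeg nw).
  exists (expR s *: w); have [E1 E2] := fiber_derive_e s nw.
  by rewrite /= E1 E2 z1 subr0; split => //; exact: nzZ.
move=> w [nw d1 d2]; have [z1 z2] := crit_e nw d1; rewrite z2 in d2.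
have [a0 b0 c0] := abc_gt0 nw.
have [s [y1 y2 y3]] := H _ _ _ a0 b0 c0 (ray_nondeg nw) z1 d2.
exists (expR s *: w); last by rewrite quot_e_ray// quot_e0.
have [E1 E2] := fiber_derive_e s nw.
by rewrite /= E1 E2 y1 subr0; split => //; exact: nzZ.
Qed.

Lemma n_neg_nonempty : [set u | [/\ nz u,
  fiber_derive1 (quot_n) u = 0 &
  fiber_derive2 (quot_n) u < 0]] !=set0.
Proof.
have [w nw] := nz0; have [a0 b0 c0] := abc_gt0 nw.
have [s [z1 d1]] := n_neg_exists q0 q_al al_p p_gam kap1 a0 b0 c0 (ray_nondeg nw).
exists (expR s *: w); have [E1 E2] := fiber_derive_n s nw.
by rewrite /= E1 E2 z1 subr0; split => //; exact: nzZ.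
Qed.

(** [gap_e_neg] has its e- point at parameter 0, whereas here an n- point [w] is given. The ray is
    based anew at its e- point, with [w] at parameter [- s]. *)
Lemma inf_e_neg_lt : (inf_fiber_neg quot_e nz < inf_fiber_neg quot_n nz)%E.
Proof.
have [d d0 H] := gap_e_neg q0 q_al al_p p_gam kap1.
apply: (ereal_inf_gap d0 (lt_trans inf_n_pos_gt0 (lt_trans inf_n_pos_lt inf_e_pos_lt))).
  exact: n_neg_nonempty.
move=> w [nw d1 d2].
have [a0 b0 c0] := abc_gt0 nw.
have [_ [s [_ [z1 z2]]]] := e_exists q0 q_al al_p p_gam kap1 a0 b0 c0 (ray_nondeg nw).
have nv := nzZ s nw.
have wE : w = expR (- s) *: (expR s *: w).
  by rewrite scalerA -expRD addNr expR0 scale1r.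
have [F1 F2] := fiber_derive_n (- s) nv; rewrite -wE d1 in F1 F2.
have [E1 E2] := fiber_derive_e s nw; rewrite z1 in E1; rewrite z1 subr0 in E2.
have [y1 y2] := crit_e nv E1.
have [a1 b1 c1] := abc_gt0 nv.
exists (expR s *: w); first by split; [exact: nv|exact: E1|rewrite E2].
rewrite [quot_n w](_ : _ =
  h (a_ (expR s *: w)) (b_ (expR s *: w)) (c_ (expR s *: w)) (- s)); last first.
  by rewrite {1}wE quot_n_ray.
rewrite quot_e0//; apply: H => //; first exact: ray_nondeg.
- by rewrite -y2 E2.
- by move: d2; rewrite F2 -F1 subr0.
Qed.

Lemma inf_n_neg_lty : (inf_fiber_neg quot_n nz < +oo)%E.
Proof.
have [w hw] := n_neg_nonempty; apply: le_lt_trans (ltry (quot_n w)).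
by apply: ereal_inf_lbound; exists w.
Qed.

Lemma inf_fiber_chain :
  [/\ 0 < inf_fiber_pos quot_n nz,
      inf_fiber_pos quot_n nz < inf_fiber_pos quot_e nz,
      inf_fiber_pos quot_e nz < inf_fiber_neg quot_e nz,
      inf_fiber_neg quot_e nz < inf_fiber_neg quot_n nz &
      inf_fiber_neg quot_n nz < +oo]%E.
Proof.
split; [exact: inf_n_pos_gt0|exact: inf_n_pos_lt|exact: inf_e_pos_lt|
  exact: inf_e_neg_lt|exact: inf_n_neg_lty].
Qed.

End rayleigh_quotients.

(** * Application to the Sobolev space *)

Section rayleigh.
Context (R : realType) (N : nat) (Om : set 'rV[R]_N) (p gam : R).
Hypotheses (oOm : open Om) (bOm : bounded_set Om) (p1 : 1 < p) (N0 : (0 < N)%N).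
Hypotheses (p_gam : p < gam) (gN : gam * (N%:R - p) < p * N%:R).
Implicit Types (w : sobolev_pair R N).
Local Notation G := (int_grad_pow Om p).
Local Notation I := (int_pow Om).
Local Notation nz := (W1p0_nz Om p).

Lemma ray_nz s w : nz w -> nz (expR s *: w).
Proof. by apply: (W1p0_nzZ oOm bOm p1); rewrite gt_eqF// expR_gt0. Qed.

Lemma int_pow_ray r s w : 0 < r -> r <= gam -> nz w ->
  I r (expR s *: w) = expR (r * s) * I r w.
Proof.
move=> r0 rg [Ww _].
by rewrite (int_powZ oOm bOm p1 N0 p_gam gN r0 rg (expR_gt0 s) Ww) -expRM [s * _]mulrC.
Qed.

Lemma int_grad_ray s w : nz w -> G (expR s *: w) = expR (p * s) * G w.
Proof.
move=> [Ww _].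
by rewrite (int_gradZ oOm bOm p1 (expR_gt0 s) Ww) -expRM [s * _]mulrC.
Qed.

(** In the Sobolev inequalities at [q] and [gam] the powers of the gradient integral cancel, because
    [(gam - q) / (gam - p) = q / p + gam / p * t]; a positive constant remains. A bump function
    makes the infimum finite. *)
Lemma lambda_bar_gt0 q : Om !=set0 -> 0 < q -> q < p ->
  exists2 L : R, 0 < L & lambda_bar Om p q gam = L%:E.
Proof.
move=> Om0 q0 q_p; have q_gam : q < gam by exact: lt_trans p_gam.
have p0 : 0 < p by exact: lt_trans p1.
have gam0 : 0 < gam by exact: lt_trans p_gam.
have [Kq Kq0 hq] := sobolev_ineq oOm bOm p1 N0 p_gam gN q0 (ltW q_gam).
have [Kg Kg0 hg] := sobolev_ineq oOm bOm p1 N0 p_gam gN gam0 (lexx gam).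
have [t tE] : exists t, t = (p - q) / (gam - p) by eexists.
have t0 : 0 < t by rewrite tE divr_gt0// subr_gt0.
pose f w := G w `^ ((gam - q) / (gam - p)) / (I q w * I gam w `^ t).
have lb w : nz w -> (Kq * Kg `^ t)^-1 <= f w.
  move=> nw; have A0 := int_grad_gt0 oOm bOm p1 N0 p_gam gN nw.
  have B0 := int_pow_gt0 oOm bOm p1 N0 p_gam gN q0 (ltW q_gam) nw.
  have C0 := int_pow_gt0 oOm bOm p1 N0 p_gam gN gam0 (lexx gam) nw.
  rewrite /f ler_pdivlMr ?mulr_gt0 ?powR_gt0// mulrC.
  rewrite ler_pdivrMr ?mulr_gt0 ?powR_gt0//.
  have E : (gam - q) / (gam - p) = q / p + gam / p * t.
    by rewrite tE; field; rewrite subr_eq0 !gt_eqF.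
  have -> : G w `^ ((gam - q) / (gam - p)) * (Kq * Kg `^ t) =
      (Kq * G w `^ (q / p)) * (Kg * G w `^ (gam / p)) `^ t.
    rewrite powRM ?powR_ge0 ?(ltW Kg0)// -powRrM E powRD; last first.
      by rewrite (gt_eqF A0) implybT.
    ring.
  apply: ler_pM; [exact: ltW|exact: powR_ge0|exact: hq|].
  apply: ge0_ler_powR; rewrite ?nnegrE ?mulr_ge0 ?powR_ge0 ?(ltW t0) ?(ltW C0) ?(ltW Kg0)//.
  exact: hg.
have -> : lambda_bar Om p q gam = ereal_inf [set (f w)%:E | w in nz].
  by rewrite /lambda_bar -tE.
have L0 : (((Kq * Kg `^ t)^-1)%:E <= ereal_inf [set (f w)%:E | w in nz])%E.
  by apply/ereal_infP => _ [w nw <-]; rewrite lee_fin; exact: lb.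
have [w0 nw0] := W1p0_nz_nonempty oOm bOm p1 Om0.
have : (ereal_inf [set (f w)%:E | w in nz] <= (f w0)%:E)%E.
  by apply: ereal_inf_lbound; exists w0.
case: (ereal_inf _) L0 => [L| |]// L0 _; exists L => //.
rewrite lee_fin in L0; apply: lt_le_trans L0.
by rewrite invr_gt0 mulr_gt0// powR_gt0.
Qed.

End rayleigh.

(** A single form of subcriticality for both cases: when [N <= p] the left-hand side is
    nonpositive. *)
Lemma sobolev_exponent_lt (R : realType) (N : nat) (p gam : R) : 0 < p -> 0 < gam ->
  (0 < N)%N -> (gam%:E < sobolev_exponent N p)%E -> gam * (N%:R - p) < p * N%:R.
Proof.
move=> p0 gam0 N0; have N0' : (0 : R) < N%:R by rewrite ltr0n.
rewrite /sobolev_exponent; case: ifPn => [pN|].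
  by rewrite lte_fin ltr_pdivlMr// subr_gt0.
rewrite -leNgt => Np _; apply: (@le_lt_trans _ _ 0); last by rewrite mulr_gt0.
by rewrite pmulr_rle0// subr_le0.
Qed.

Theorem lemma1p1 (R : realType) (N : nat) (Om : set 'rV[R]_N)
    (p q alpha gamma : R) :
  (0 < N)%N -> smooth_bounded_domain Om ->
  1 < q -> q < alpha -> alpha < p -> p < gamma ->
  (gamma%:E < sobolev_exponent N p)%E ->
  [/\ 0 < lambda_e Om p q alpha gamma,
      lambda_e Om p q alpha gamma < lambda_n Om p q alpha gamma &
      lambda_n Om p q alpha gamma < +oo]%E /\
  forall lambda : R, 0 < lambda ->
    (lambda%:E < lambda_e Om p q alpha gamma)%E ->
    [/\ 0 < mu_n_pos Om p q alpha gamma lambda,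
        mu_n_pos Om p q alpha gamma lambda < mu_e_pos Om p q alpha gamma lambda,
        mu_e_pos Om p q alpha gamma lambda < mu_e_neg Om p q alpha gamma lambda,
        mu_e_neg Om p q alpha gamma lambda < mu_n_neg Om p q alpha gamma lambda &
        mu_n_neg Om p q alpha gamma lambda < +oo]%E.
Proof.
move=> N0 [oOm _ Om0 bOm _] q1 qa ap pg gN.
have q0 : 0 < q by exact: lt_trans q1.
have p0 : 0 < p by exact: lt_trans (lt_trans q0 qa) ap.
have {}gN := sobolev_exponent_lt p0 (lt_trans p0 pg) N0 gN.
have p1 : 1 < p by exact: lt_trans (lt_trans q1 qa) ap.
have [L L0 LE] := lambda_bar_gt0 oOm bOm p1 N0 pg gN Om0 q0 (lt_trans qa ap).
have ce0 := c_e_gt0 q0 qa ap pg; have cn0 := c_e_lt_c_n q0 qa ap pg.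
split; first split.
- by rewrite /lambda_e LE lte_fin mulr_gt0.
- by rewrite /lambda_e /lambda_n LE lte_fin ltr_pM2r.
- by rewrite /lambda_n LE ltry.
move=> lam lam0 lamE.
(* This is [kap = lambda^e / lambda]. *)
have kap1 : 1 < c_e p q alpha gamma * L / lam.
  by rewrite ltr_pdivlMr// mul1r -lte_fin EFinM -LE.
have kapE : c_e p q alpha gamma * L / lam * lam = c_e p q alpha gamma * L.
  by rewrite divfK// gt_eqF.
have ag : alpha < gamma by exact: lt_trans pg.
have qg : q < gamma by exact: lt_trans ag.
have al0 : 0 < alpha by exact: lt_trans qa.
have gam0 : 0 < gamma by exact: lt_trans pg.
have [K K0 hK] := poincare oOm bOm p1 N0 pg gN.
apply: (@inf_fiber_chain R (sobolev_pair R N) (W1p0_nz Om p) (int_grad_pow Om p)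
  (int_pow Om q) (int_pow Om gamma) (int_pow Om alpha) p q alpha gamma lam
  (c_e p q alpha gamma * L / lam) L K q1 qa ap pg lam0 kap1 K0
  (W1p0_nz_nonempty oOm bOm p1 Om0)).
- move=> s w; exact: (ray_nz oOm bOm p1).
- move=> w; exact: (int_grad_gt0 oOm bOm p1 N0 pg gN).
- move=> w; exact: (int_pow_gt0 oOm bOm p1 N0 pg gN q0 (ltW qg)).
- move=> w; exact: (int_pow_gt0 oOm bOm p1 N0 pg gN gam0 (lexx gamma)).
- move=> w; exact: (int_pow_gt0 oOm bOm p1 N0 pg gN al0 (ltW ag)).
- move=> s w; exact: (int_grad_ray oOm bOm p1).
- move=> s w; exact: (int_pow_ray oOm bOm p1 N0 pg gN s q0 (ltW qg)).
- move=> s w; exact: (int_pow_ray oOm bOm p1 N0 pg gN s gam0 (lexx gamma)).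
- move=> s w; exact: (int_pow_ray oOm bOm p1 N0 pg gN s al0 (ltW ag)).
- move=> w nw.
  apply: (le_trans (int_pow_interp oOm bOm p1 N0 pg gN q0 (ltW qa) (ltW ap) nw.1)).
  by rewrite lerD2l; exact: hK.
- exact: kapE.
- by move=> w nw; rewrite -lee_fin -LE; apply: ereal_inf_lbound; exists w.
Qed.
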